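(* Let $k$ be a field, let $X=\operatorname{Proj} R\subseteq\mathbb{P}^n$ be a projective scheme over $k$, and let $I=(F_0,\dots,F_m)\subseteq R$ be a homogeneous ideal generated by forms $F_0,\dots,F_m$ of the same degree $d$. Let $\phi:\widetilde{X}\to\bar{X}$ be the projection from the blowup of $X$ along the subscheme defined by $I$, and let $a^*(\phi)=\max\{a^*(\widetilde{X}_\wp)\mid \wp\in\bar{X}\}$, the maximum being over closed points $\wp$ of $\bar{X}$. Then for all $q\gg 0$, $$a^*(I^q)=qd+a^*(\phi).$$
   Context: $R$ is the standard graded homogeneous coordinate ring of $X\subseteq\mathbb{P}^n$. Rees algebra and blowup. $\mathcal{R}=R[It]=\bigoplus_{q\ge 0} I^q t^q$ is the Rees algebra of $I$, bigraded by $\mathcal{R}_{(p,q)}=(I^q)_{p+qd}\,t^q$ (so each $F_it$ has bidegree $(0,1)$, and elements of $R_1$ have bidegree $(1,0)$). $\widetilde{X}$ is the blowup of $X$ along the subscheme defined by $I$, identified with the bi-projective scheme $\operatorname{Proj}\mathcal{R}\subseteq\mathbb{P}^n\times\mathbb{P}^m$; $\phi$ is the restriction to $\widetilde{X}$ of the second projection $\mathbb{P}^n\times\mathbb{P}^m\to\mathbb{P}^m$, and $\bar{X}=\operatorname{image}(\phi)\subseteq\mathbb{P}^m$. The homogeneous coordinate ring of $\bar{X}$ is $S=k[F_0t,\dots,F_mt]=\bigoplus_q\mathcal{R}_{(0,q)}$. Fibers. For a closed point $\wp\in\bar{X}$, viewed as a homogeneous prime of $S$, the homogeneous localization $\mathcal{R}_{(\wp)}$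 is the ring of elements of degree $0$ in $t$ of the localization of $\mathcal{R}$ at the homogeneous elements of $S\setminus\wp$. It is $\mathbb{N}$-graded by the first degree $p$. The fiber is $\widetilde{X}_\wp=\widetilde{X}\times_{\bar{X}}\operatorname{Spec}\mathcal{O}_{\bar{X},\wp}=\operatorname{Proj}\mathcal{R}_{(\wp)}$. Invariants. For an $\mathbb{N}$-graded algebra $T$ with irrelevant ideal $T_+$ (generated by the elements of positive degree), $a^i(T)=\max\{l\mid [H^i_{T_+}(T)]_l\neq 0\}$, with $a^i(T)=-\infty$ if $H^i_{T_+}(T)=0$, and $a^*(T)=\max_{i\ge 0} a^i(T)$. For a finitely generated graded $R$-module $M$, such as $I^q$, $a^i(M)$ and $a^*(M)$ are defined in the same way using $H^i_{R_+}(M)$. Set $a^*(\widetilde{X}_\wp)=a^*(\mathcal{R}_{(\wp)})$. *)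

(* Defs.v *)
From HB Require Import structures.
From mathcomp Require Import all_boot all_order all_algebra.
From mathcomp Require Import boolp classical_sets constructive_ereal.
From mathcomp Require Import ring zify.

Set Implicit Arguments.
Unset Strict Implicit.
Unset Printing Implicit Defensive.

Import Order.TTheory GRing.Theory Num.Theory.

Local Open Scope classical_set_scope.
Local Open Scope ring_scope.
Local Open Scope quotient_scope.

Definition graded_sub (I : Type) (V : zmodType) (P : I -> set V) (Q : set V) :=
  forall v, Q v ->
    exists s : seq V, (forall u, u \in s -> Q u /\ exists i, P i u) /\
                      v = \sum_(u <- s) u.

Definition is_direct_sum (I : eqType) (V : zmodType) (P : I -> set V) : Prop :=
  [/\ forall i, P i 0,
      forall i u v, P i u -> P i v -> P i (u - v),
      graded_sub P setT &
      forall (s : seq I) (c : I -> V), uniq s -> (forall i, P i (c i)) ->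
        \sum_(i <- s) c i = 0 -> forall i, i \in s -> c i = 0].

Record grading (A : comPzRingType) := Grading {
  gr_part :> nat -> set A;
  gr_direct : is_direct_sum gr_part;
  gr_one : gr_part 0%N 1;
  gr_mul : forall i j a b,
    gr_part i a -> gr_part j b -> gr_part (i + j)%N (a * b) }.

Record grmod (A : comPzRingType) (G : grading A) := GrMod {
  gm_car :> lmodType A;
  gm_part : int -> set gm_car;
  gm_direct : is_direct_sum gm_part;
  gm_scale : forall i l a v,
    G i a -> gm_part l v -> gm_part (i%:Z + l) (a *: v) }.

Arguments gm_part {A G} M _ : rename.

Definition zpart (V : zmodType) (P : nat -> set V) (l : int) : set V :=
  if l is Posz p then P p else [set 0].

Lemma zpartP (V : zmodType) (P : nat -> set V) :
  is_direct_sum P -> is_direct_sum (zpart P).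
Proof.
move=> [P0 PB Pg Pi]; split.
- by case=> [p|p] //=.
- by case=> [p|p] u v /=; [exact: PB | move=> -> ->; rewrite subr0].
- move=> v Qv; have [s [sP ->]] := Pg v Qv; exists s; split=> // u us.
  have [_ [i Pu]] := sP u us; split=> //; by exists i%:Z.
- move=> s c us cP s0.
  pose t := pmap (fun l : int => if l is Posz p then Some p else None) s.
  have ut : uniq t.
    by apply: (@pmap_uniq _ _ _ Posz) => //; case.
  have cN l : c (Negz l) = 0 by have := cP (Negz l).
  have E : \sum_(l <- s) c l = \sum_(p <- t) c p%:Z.
    rewrite /t; elim: (s) => [|l s' IH]; first by rewrite !big_nil.
    by rewrite big_cons IH; case: l => p /=; rewrite ?big_cons ?cN ?add0r.
  have cP' p : P p (c p%:Z) by exact: (cP p%:Z).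
  case=> p ps; last exact: cN.
  apply: (Pi t (fun p => c p%:Z) ut cP') => //; first by rewrite -E.
  by rewrite mem_pmap; apply/mapP; exists p%:Z.
Qed.

Section SelfModule.
Variables (A : comPzRingType) (G : grading A).

Lemma self_scale i l (a : A) (v : A^o) :
  G i a -> zpart G l v -> (zpart G (i%:Z + l) : set A^o) (a *: v).
Proof.
case: l => [p|p] Ga /=; first exact: gr_mul.
move=> ->; rewrite scaler0.
by have [G0 _ _ _] := zpartP (gr_direct G); exact: G0.
Qed.

Definition self_grmod : grmod G :=
  @GrMod A G A^o (zpart G) (zpartP (gr_direct G)) self_scale.

End SelfModule.

Section Ideals.
Variable A : comPzRingType.
Implicit Types (B I J : set A) (a b c : A).

Definition is_ideal I :=
  [/\ I 0, forall a b, I a -> I b -> I (a + b) & forall a b, I b -> I (a * b)].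

Definition ideal_gen B : set A :=
  [set a | exists s : seq (A * A), (forall z, z \in s -> B z.2) /\
                                   a = \sum_(z <- s) z.1 * z.2].

Definition ideal_mul I J : set A := ideal_gen [set a * b | a in I & b in J].

Definition ideal_exp I n : set A := iter n (ideal_mul I) setT.

Lemma ideal_genP B : is_ideal (ideal_gen B).
Proof.
split.
- by exists [::]; rewrite big_nil.
- move=> a b [s [sB ->]] [t [tB ->]]; exists (s ++ t); rewrite big_cat.
  by split=> // z; rewrite mem_cat => /orP[/sB|/tB].
- move=> a b [s [sB ->]]; exists [seq (a * z.1, z.2) | z <- s]; split.
    by move=> z /mapP[y ys ->]; exact: (sB y ys).
  by rewrite big_map mulr_sumr; apply: eq_bigr => z _; rewrite mulrA.
Qed.

Lemma ideal_gen_in B b : B b -> ideal_gen B b.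
Proof.
move=> Bb; exists [:: (1, b)]; rewrite big_seq1 mul1r; split=> // z.
by rewrite inE => /eqP ->.
Qed.

Lemma ideal_sum I (T : eqType) (s : seq T) (f : T -> A) : is_ideal I ->
  (forall z, z \in s -> I (f z)) -> I (\sum_(z <- s) f z).
Proof.
move=> [I0 ID _]; elim: s => [|z s IH] fI; first by rewrite big_nil.
rewrite big_cons; apply: ID; first by apply: fI; rewrite mem_head.
by apply: IH => y ys; apply: fI; rewrite inE ys orbT.
Qed.

Lemma ideal_gen_min B I : is_ideal I -> B `<=` I -> ideal_gen B `<=` I.
Proof.
move=> iI BI a [s [sB ->]]; apply: ideal_sum => // z /sB /BI.
by case: iI => _ _; apply.
Qed.

Lemma ideal_expP I n : is_ideal (ideal_exp I n).
Proof. by case: n => [//|n]; exact: ideal_genP. Qed.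

Lemma ideal_mul_in I J a b : I a -> J b -> ideal_mul I J (a * b).
Proof. by move=> Ia Jb; apply: ideal_gen_in; exists a => //; exists b. Qed.

Lemma ideal_expD I i j a b :
  ideal_exp I i a -> ideal_exp I j b -> ideal_exp I (i + j)%N (a * b).
Proof.
elim: i a => [|i IH] a Ia Ib.
  by have [_ _ H] := ideal_expP I j; exact: H.
have [H0 HD HM] := ideal_expP I (i.+1 + j).
have C : is_ideal [set a | ideal_exp I (i.+1 + j)%N (a * b)].
  split=> [|x y /= Hx Hy|x y /= Hy]; rewrite /= ?mul0r ?mulrDl -?mulrA //.
  - exact: HD.
  - exact: HM.
apply: (ideal_gen_min C _ Ia) => _ [x Ix [y Iy <-]] /=.
by rewrite -mulrA; apply: ideal_mul_in => //; exact: IH.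
Qed.

End Ideals.

Definition irrelevant (A : comPzRingType) (G : grading A) : set A :=
  ideal_gen [set a | exists2 p, (0 < p)%N & G p a].

(* Local cohomology: [H^i_{A_+}] is the [i]-th right derived functor of the
   [A_+]-torsion functor on the category of graded modules and homomorphisms
   of degree 0. *)

Section LocalCohomology.
Variables (A : comPzRingType) (G : grading A).
Implicit Types M N E : grmod G.

Definition degree0 M N (f : {linear M -> N}) :=
  forall l v, gm_part M l v -> gm_part N l (f v).

Definition injective_grmod E : Prop :=
  forall (M N : grmod G) (i : {linear M -> N}) (f : {linear M -> E}),
    degree0 i -> degree0 f -> injective i ->
    exists2 g : {linear N -> E}, degree0 g & forall v, g (i v) = f v.

Record injective_resolution M := InjectiveResolution {
  ir_mod : nat -> grmod G;
  ir_aug : {linear M -> ir_mod 0%N};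
  ir_d : forall i, {linear ir_mod i -> ir_mod i.+1};
  ir_injective : forall i, injective_grmod (ir_mod i);
  ir_aug_degree0 : degree0 ir_aug;
  ir_d_degree0 : forall i, degree0 (ir_d i);
  ir_aug_inj : injective ir_aug;
  ir_exact0 : forall v, ir_d 0%N v = 0 <-> exists u, ir_aug u = v;
  ir_exact : forall i v, ir_d i.+1 v = 0 <-> exists u, ir_d i u = v }.

Definition torsion M : set M :=
  [set v | exists n, forall a, ideal_exp (irrelevant G) n a -> a *: v = 0].

Definition cocycles M (E : injective_resolution M) i l : set (ir_mod E i) :=
  [set v | [/\ gm_part (ir_mod E i) l v, torsion v & ir_d E i v = 0]].

Arguments cocycles {M} E i l _.

Definition coboundaries M (E : injective_resolution M) i l :
    set (ir_mod E i) :=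
  match i return set (ir_mod E i) with
  | 0 => [set 0]
  | j.+1 =>
    [set ir_d E j u | u in [set u | gm_part (ir_mod E j) l u /\ torsion u]]
  end.

Arguments coboundaries {M} E i l _.

(* [[H^i_{A_+}(M)]_l != 0]; this does not depend on the resolution. *)
Definition lc_nonzero M i (l : int) : Prop :=
  exists E : injective_resolution M,
    ~ (cocycles E i l `<=` coboundaries E i l).

(* Maximum of a set in [Z] extended with [-oo], that of the empty set being
   [-oo]; a nonempty set without a greatest element has no maximum. *)
Definition is_max (B : set (\bar int)) (v : \bar int) : Prop :=
  (B = set0 /\ v = -oo%E) \/ (B v /\ ubound B v).

Definition is_a_inv M i (v : \bar int) : Prop :=
  is_max [set l%:E%E | l in [set l | lc_nonzero M i l]] v.

Definition is_astar M (v : \bar int) : Prop :=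
  exists a : nat -> \bar int, (forall i, is_a_inv M i (a i)) /\
                              is_max (range a) v.

End LocalCohomology.

Record subring (A : comPzRingType) := Subring {
  sr_set :> A -> Prop;
  sr_one : sr_set 1;
  sr_sub : forall a b, sr_set a -> sr_set b -> sr_set (a - b);
  sr_mul : forall a b, sr_set a -> sr_set b -> sr_set (a * b) }.

Section SubringType.
Variables (A : comPzRingType) (B : subring A).

Definition sr_mem : {pred A} := fun a => `[< B a >].

Record subring_type := SubringElt { sr_val : A; _ : sr_mem sr_val }.

HB.instance Definition _ := [isSub for sr_val].
HB.instance Definition _ := [Choice of subring_type by <:].

Lemma sr_closed : GRing.subring_closed sr_mem.
Proof.
split; first by apply/asboolP/sr_one.
- by move=> a b /asboolP Ba /asboolP Bb; apply/asboolP/sr_sub.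
- by move=> a b /asboolP Ba /asboolP Bb; apply/asboolP/sr_mul.
Qed.

HB.instance Definition _ :=
  GRing.SubChoice_isSubComPzRing.Build A sr_mem subring_type sr_closed.

Definition sr_elt a (Ba : B a) : subring_type :=
  SubringElt (introT (asboolP _) Ba).

Lemma sr_valP (x : subring_type) : B (sr_val x).
Proof. by case: x => a Ha; apply/asboolP. Qed.

End SubringType.

Definition subring_gen (A : comPzRingType) (B : set A) : set A :=
  [set a | forall C : subring A, B `<=` sr_set C -> C a].

Section SubringGenerated.
Variables (A : comPzRingType) (B : set A).

Lemma subring_gen1 : subring_gen B 1.
Proof. by move=> C _; exact: sr_one. Qed.

Lemma subring_genB a b :
  subring_gen B a -> subring_gen B b -> subring_gen B (a - b).
Proof. by move=> Ba Bb C BC; apply: sr_sub; [exact: Ba | exact: Bb]. Qed.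

Lemma subring_genM a b :
  subring_gen B a -> subring_gen B b -> subring_gen B (a * b).
Proof. by move=> Ba Bb C BC; apply: sr_mul; [exact: Ba | exact: Bb]. Qed.

Definition subring_generated : subring A :=
  Subring subring_gen1 subring_genB subring_genM.

End SubringGenerated.

Section IdealModule.
Variables (A : comPzRingType) (I : set A) (idI : is_ideal I).

Definition id_mem : {pred A^o} := fun a => `[< I a >].

Record ideal_type := IdealElt { id_val : A^o; _ : id_mem id_val }.

HB.instance Definition _ := [isSub for id_val].
HB.instance Definition _ := [Choice of ideal_type by <:].

Lemma id_closed : GRing.subsemimod_closed id_mem.
Proof.
have [I0 ID IM] := idI.
split; first split; first by apply/asboolP.
- by move=> a b /asboolP Ia /asboolP Ib; apply/asboolP/ID.
- by move=> a b /asboolP Ib; apply/asboolP/IM.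
Qed.

HB.instance Definition _ :=
  GRing.SubChoice_isSubLmodule.Build A A^o id_mem ideal_type id_closed.

Lemma id_valP (x : ideal_type) : I (id_val x).
Proof. by case: x => a Ha; apply/asboolP. Qed.

Variables (G : grading A) (hI : graded_sub G I).

Definition id_part (l : int) : set ideal_type :=
  [set x | (zpart G l : set A^o) (id_val x)].

Lemma id_val0 : id_val 0 = 0. Proof. exact: (raddf0 val). Qed.
Lemma id_valB x y : id_val (x - y) = id_val x - id_val y.
Proof. exact: (raddfB val). Qed.
Lemma id_val_sum (T : Type) (s : seq T) (f : T -> ideal_type) :
  id_val (\sum_(i <- s) f i) = \sum_(i <- s) id_val (f i).
Proof. exact: (raddf_sum val). Qed.

Lemma id_direct : is_direct_sum id_part.
Proof.
have [Z0 ZB _ Zi] := zpartP (gr_direct G); split.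
- by move=> l; exact: Z0.
- by move=> l x y; exact: ZB.
- move=> x _; have [s [sP E]] := hI (id_valP x).
  exists (pmap insub s); split.
    move=> u; rewrite mem_pmap => /mapP[a /sP[_ [p Gp]] /esym].
    case: insubP => //= y _ ya [<-]; split=> //; exists p%:Z.
    by rewrite /id_part /=; move: ya => /= ->.
  apply: val_inj; rewrite /= E id_val_sum.
  have : forall u, u \in s -> I u by move=> u /sP[].
  elim: (s) => [|a t IH] tI; first by rewrite !big_nil.
  rewrite /= big_cons IH; last by move=> u ut; apply: tI; rewrite inE ut orbT.
  have Ia : id_mem a by apply/asboolP/tI/mem_head.
  by rewrite insubT /= big_cons.
- move=> s c us cP s0 l ls; apply: val_inj.
  apply: (etrans _ (esym id_val0)).
  apply: (Zi s (fun l => id_val (c l))) => //.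
  exact: etrans (esym (id_val_sum s c)) (etrans (congr1 _ s0) id_val0).
Qed.

Lemma id_scale i l a v :
  G i a -> id_part l v -> id_part (i%:Z + l) (a *: v).
Proof. by move=> Ga /(self_scale Ga). Qed.

Definition ideal_grmod : grmod G := GrMod id_direct id_scale.

End IdealModule.

Record mulset (A : comPzRingType) := Mulset {
  ms_set :> A -> Prop;
  ms_one : ms_set 1;
  ms_mul : forall a b, ms_set a -> ms_set b -> ms_set (a * b) }.

Module Loc.
Section Loc.
Variables (A : comPzRingType) (W : mulset A).

Record den := Den { den_val : A; _ : `[< W den_val >] }.
HB.instance Definition _ := [isSub for den_val].
HB.instance Definition _ := [Choice of den by <:].

Lemma denP (s : den) : W (den_val s).
Proof. by case: s => a Ha; apply/asboolP. Qed.

Definition mkden a (Wa : W a) : den := Den (introT (asboolP _) Wa).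
Definition den1 : den := mkden (ms_one W).
Definition denM (s t : den) : den := mkden (ms_mul (denP s) (denP t)).

Lemma denC s t : denM s t = denM t s.
Proof. by apply: val_inj; rewrite /= mulrC. Qed.

(* [(a, s)] stands for the fraction [a / s]. *)
Definition equivl (x y : A * den) : bool :=
  `[< exists2 u, W u &
        u * (x.1 * den_val y.2) = u * (y.1 * den_val x.2) >].

Lemma equivl_refl : reflexive equivl.
Proof. by move=> x; apply/asboolP; exists 1 => //; exact: ms_one. Qed.

Lemma equivl_sym : symmetric equivl.
Proof.
by move=> x y; apply/asboolP/asboolP => -[u Wu E]; exists u.
Qed.

Lemma equivl_trans : transitive equivl.
Proof.
move=> y x z /asboolP[u Wu E] /asboolP[v Wv F]; apply/asboolP.
exists (u * v * den_val y.2); first by do 2?apply: ms_mul => //; exact: denP.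
transitivity (v * den_val z.2 * (u * (x.1 * den_val y.2))); first ring.
rewrite E; transitivity (u * den_val x.2 * (v * (y.1 * den_val z.2))); first ring.
rewrite F; ring.
Qed.

Canonical equivl_equiv := EquivRel equivl equivl_refl equivl_sym equivl_trans.

Definition type := {eq_quot equivl}.
HB.instance Definition _ : EqQuotient _ equivl type := EqQuotient.on type.
HB.instance Definition _ := Choice.on type.

Definition frac (a : A) (s : den) : type := \pi_type (a, s).

Lemma fracE a s b t : frac a s = frac b t <->
  exists2 u, W u & u * (a * den_val t) = u * (b * den_val s).
Proof.
split=> [/eqmodP|H]; first by move=> /= /asboolP.
by apply/eqmodP => /=; apply/asboolP.
Qed.

Lemma fracP (x : type) : exists a s, x = frac a s.
Proof. by elim/quotW: x => -[a s]; exists a, s. Qed.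

Definition num (x : type) := (repr x).1.
Definition dnm (x : type) := (repr x).2.
Lemma numdnm x : frac (num x) (dnm x) = x.
Proof. by rewrite /frac /num /dnm -surjective_pairing reprK. Qed.

Definition addl (x y : type) : type :=
  frac (num x * den_val (dnm y) + num y * den_val (dnm x)) (denM (dnm x) (dnm y)).
Definition oppl (x : type) : type := frac (- num x) (dnm x).
Definition mull (x y : type) : type :=
  frac (num x * num y) (denM (dnm x) (dnm y)).

Lemma addlE a s b t : addl (frac a s) (frac b t) =
  frac (a * den_val t + b * den_val s) (denM s t).
Proof.
have /fracE[u Wu E] := numdnm (frac a s).
have /fracE[v Wv F] := numdnm (frac b t).
rewrite /addl; apply/fracE; exists (u * v); first exact: ms_mul.
move: E F; set x := frac a s; set y := frac b t.
move: (num x) (num y) (dnm x) (dnm y) => a' b' s' t' E F /=.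
transitivity (v * den_val t' * den_val t * (u * (a' * den_val s))
  + u * den_val s' * den_val s * (v * (b' * den_val t))); first ring.
rewrite E F; ring.
Qed.

Lemma opplE a s : oppl (frac a s) = frac (- a) s.
Proof.
have /fracE[u Wu E] := numdnm (frac a s).
by rewrite /oppl; apply/fracE; exists u => //; rewrite !mulNr !mulrN E.
Qed.

Lemma mullE a s b t : mull (frac a s) (frac b t) = frac (a * b) (denM s t).
Proof.
have /fracE[u Wu E] := numdnm (frac a s).
have /fracE[v Wv F] := numdnm (frac b t).
rewrite /mull; apply/fracE; exists (u * v); first exact: ms_mul.
move: E F; set x := frac a s; set y := frac b t.
move: (num x) (num y) (dnm x) (dnm y) => a' b' s' t' E F /=.
transitivity ((u * (a' * den_val s)) * (v * (b' * den_val t))); first ring.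
rewrite E F; ring.
Qed.

Lemma frac_eq a s b t : a * den_val t = b * den_val s -> frac a s = frac b t.
Proof. by move=> E; apply/fracE; exists 1; [exact: ms_one | rewrite E]. Qed.

Lemma addlA : associative addl.
Proof.
move=> x y z; have [a [s ->]] := fracP x; have [b [t ->]] := fracP y.
have [c [r ->]] := fracP z; rewrite !addlE; apply: frac_eq => /=; ring.
Qed.

Lemma addlC : commutative addl.
Proof.
move=> x y; have [a [s ->]] := fracP x; have [b [t ->]] := fracP y.
rewrite !addlE; apply: frac_eq => /=; ring.
Qed.

Lemma add0l : left_id (frac 0 den1) addl.
Proof.
move=> x; have [a [s ->]] := fracP x.
rewrite !addlE; apply: frac_eq => /=; ring.
Qed.

Lemma addNl : left_inverse (frac 0 den1) oppl addl.
Proof.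
move=> x; have [a [s ->]] := fracP x.
rewrite opplE addlE; apply: frac_eq => /=; ring.
Qed.

Lemma mullA : associative mull.
Proof.
move=> x y z; have [a [s ->]] := fracP x; have [b [t ->]] := fracP y.
have [c [r ->]] := fracP z; rewrite !mullE; apply: frac_eq => /=; ring.
Qed.

Lemma mullC : commutative mull.
Proof.
move=> x y; have [a [s ->]] := fracP x; have [b [t ->]] := fracP y.
rewrite !mullE; apply: frac_eq => /=; ring.
Qed.

Lemma mul1l : left_id (frac 1 den1) mull.
Proof.
move=> x; have [a [s ->]] := fracP x.
rewrite !mullE; apply: frac_eq => /=; ring.
Qed.

Lemma mulDl : left_distributive mull addl.
Proof.
move=> x y z; have [a [s ->]] := fracP x; have [b [t ->]] := fracP y.
have [c [r ->]] := fracP z; rewrite !(mullE, addlE).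
apply: frac_eq => /=; ring.
Qed.

HB.instance Definition _ := GRing.isZmodule.Build type addlA addlC add0l addNl.
HB.instance Definition _ :=
  GRing.Zmodule_isComPzRing.Build type mullA mullC mul1l mulDl.

End Loc.
End Loc.
HB.export Loc.

Notation localization := Loc.type.
Notation frac := Loc.frac.

Section Proj.
Variables (A : comPzRingType) (G : grading A).
Implicit Types p J : set A.

Definition prime_ideal p :=
  [/\ is_ideal p, ~ p 1 & forall a b, p (a * b) -> p a \/ p b].

Definition Proj : set (set A) :=
  [set p | [/\ prime_ideal p, graded_sub G p & ~ (irrelevant G `<=` p)]].

Definition Proj_closed (Z : set (set A)) :=
  exists J, [/\ is_ideal J, graded_sub G J & Z = Proj `&` [set p | J `<=` p]].

Record closed_point := ClosedPoint {
  cp_ideal :> A -> Prop;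
  cp_Proj : Proj cp_ideal;
  cp_closed : Proj_closed [set (cp_ideal : set A)] }.

End Proj.

Section Rees.
Variables (k : fieldType) (R : comAlgType k).

(* [R = k[X_0, ..., X_n] / J] with [J] homogeneous and [x i] the class of
   [X_i]: the homogeneous coordinate ring of a subscheme of [P^n]. *)
Definition standard_graded (G : grading R) n (x : 'I_n.+1 -> R) : Prop :=
  [/\ G 0%N = range (fun c : k => c%:A),
      forall i, G 1%N (x i) &
      subring_gen (range (fun c : k => c%:A) `|` range x) = setT].

Variables (G : grading R) (n : nat) (x : 'I_n.+1 -> R).
Hypothesis R_std : standard_graded G x.
Variables (d m : nat) (F : 'I_m.+1 -> R).
Hypothesis F_hom : forall i, G d (F i).

Local Notation I := (ideal_gen (range F)).

Lemma graded_sub_setT : graded_sub G setT.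
Proof. by case: (gr_direct G). Qed.

Lemma hsum_sum (V : zmodType) (J : Type) (P : J -> set V) (Q : set V)
    (T : eqType) (s : seq T) (f : T -> V) :
  (forall z, z \in s -> exists t : seq V,
    (forall u, u \in t -> Q u /\ exists i, P i u) /\ f z = \sum_(u <- t) u) ->
  exists t : seq V,
    (forall u, u \in t -> Q u /\ exists i, P i u) /\
    \sum_(z <- s) f z = \sum_(u <- t) u.
Proof.
elim: s => [|z s IH] H; first by exists [::]; rewrite !big_nil.
have [t [tP E]] := H z (mem_head _ _).
have [|t' [tP' E']] := IH; first by move=> y ys; apply: H; rewrite inE ys orbT.
exists (t ++ t'); rewrite big_cons big_cat /= E E'; split=> // u.
by rewrite mem_cat => /orP[/tP|/tP'].
Qed.

(* [I^q] is homogeneous and generated in degrees at least [q * d]. *)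
Lemma ideal_exp_graded_shift q :
  graded_sub (fun p => G (p + q * d)%N) (ideal_exp I q).
Proof.
elim: q => [|q IH] v.
  move=> _; have [s [sP ->]] := graded_sub_setT (Logic.I : setT v).
  exists s; split=> // u /sP[_ [i Gu]]; split=> //.
  by exists i; rewrite mul0n addn0.
move=> [s [sP ->]]; apply: hsum_sum => -[e w] /sP /= [a [r [rP ->]]] [b Ib <-].
rewrite mulr_suml mulr_sumr; apply: hsum_sum => -[c _] /rP /= [i _ <-].
have [t [tP ->]] := IH b Ib.
have [t' [tP' E]] := graded_sub_setT (Logic.I : setT (e * c)).
have -> : e * (c * F i * (\sum_(u <- t) u)) =
    \sum_(u' <- t') \sum_(u <- t) u' * F i * u.
  under [RHS]eq_bigr do rewrite -mulr_sumr.
  by rewrite -mulr_suml -mulr_suml -E !mulrA.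
apply: hsum_sum => u' /tP'[_ [j Gu']]; apply: hsum_sum => u /tP[Iu [l Gu]].
exists [:: u' * F i * u]; rewrite big_seq1; split=> // _ /[1!inE] /eqP ->.
split.
  apply: ideal_mul_in => //.
  have [_ _ IM] := ideal_genP (range F); apply: IM.
  by apply: ideal_gen_in; exists i.
exists (j + l)%N; have := gr_mul (gr_mul Gu' (F_hom i)) Gu.
by congr (G _ _); rewrite mulSn; lia.
Qed.

Lemma ideal_exp_graded q : graded_sub G (ideal_exp I q).
Proof.
move=> v /ideal_exp_graded_shift[s [sP ->]]; exists s; split=> // u /sP[Iu [p Gu]].
by split=> //; exists (p + q * d)%N.
Qed.

Definition ideal_exp_grmod q : grmod G :=
  ideal_grmod (ideal_expP I q) (@ideal_exp_graded q).

(* The Rees algebra [R[It]] inside [R[t]]; ['X] is [t]. *)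
Definition rees_set : set {poly R} := [set f | forall q, ideal_exp I q f`_q].

Lemma rees1 : rees_set 1.
Proof.
move=> q; rewrite coef1; case: q => [//|q] /=.
by have [I0 _ _] := ideal_expP I q.+1.
Qed.

Lemma reesB f g : rees_set f -> rees_set g -> rees_set (f - g).
Proof.
move=> If Ig q; rewrite coefB -mulN1r.
by have [_ ID IM] := ideal_expP I q; apply: ID => //; exact: IM.
Qed.

Lemma reesM f g : rees_set f -> rees_set g -> rees_set (f * g).
Proof.
move=> If Ig q; rewrite coefM; apply: ideal_sum (ideal_expP _ _) _ => i _.
have := ideal_expD (If i) (Ig (q - i)%N); rewrite subnKC //.
by rewrite -ltnS.
Qed.

Definition rees_subring : subring {poly R} := Subring rees1 reesB reesM.
Definition rees : comPzRingType := subring_type rees_subring.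

(* [S = k[F_0 t, ..., F_m t]]. *)
Definition Sbar_subring : subring {poly R} :=
  subring_generated (range (fun c : k => (c%:A)%:P) `|`
                     range (fun i => F i *: 'X)).
Definition Sbar : comPzRingType := subring_type Sbar_subring.

Definition tmono q (f : {poly R}) := exists c : R, f = c *: 'X^q.

Lemma tmonoP q f : tmono q f -> f = f`_q *: 'X^q.
Proof. by move=> [c ->]; rewrite coefZ coefXn eqxx mulr1. Qed.

Lemma tmonoM q r f g : tmono q f -> tmono r g -> tmono (q + r) (f * g).
Proof.
move=> [a ->] [b ->]; exists (a * b).
by rewrite -scalerAl -scalerAr scalerA exprD.
Qed.

Lemma tmonoB q f g : tmono q f -> tmono q g -> tmono q (f - g).
Proof. by move=> [a ->] [b ->]; exists (a - b); rewrite scalerBl. Qed.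

Lemma tmono0 q : tmono q 0.
Proof. by exists 0; rewrite scale0r. Qed.

Lemma tmono1 : tmono 0 1.
Proof. by exists 1; rewrite scale1r expr0. Qed.

Definition Sbar_part q : set Sbar := [set f | tmono q (sr_val f)].

Lemma Sbar_coef f q : Sbar_subring f -> Sbar_subring (f`_q *: 'X^q).
Proof.
pose C := [set f : {poly R} | forall q, Sbar_subring (f`_q *: 'X^q)].
have S0 : Sbar_subring 0.
  have := sr_sub (sr_one Sbar_subring) (sr_one Sbar_subring).
  by rewrite subrr.
have SD (a b : {poly R}) : Sbar_subring a -> Sbar_subring b ->
    Sbar_subring (a + b).
  move=> Sa Sb; rewrite -(opprK b) -(sub0r b).
  by apply: sr_sub => //; apply: sr_sub.
have C1 : C 1.
  move=> [|r]; rewrite coef1 ?scale0r //= expr0 scale1r //.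
  exact: (sr_one Sbar_subring).
have CB a b : C a -> C b -> C (a - b).
  by move=> Ca Cb r; rewrite coefB scalerBl; apply: sr_sub.
have CM a b : C a -> C b -> C (a * b).
  move=> Ca Cb r; rewrite coefM scaler_suml; elim/big_ind: _ => // i _.
  suff -> : (a`_i * b`_(r - i)) *: 'X^r =
    (a`_i *: 'X^i) * (b`_(r - i) *: 'X^(r - i)) by apply: sr_mul.
  by rewrite -scalerAl -scalerAr scalerA -exprD subnKC // -ltnS.
move=> Sf; apply: (Sf (Subring C1 CB CM)) => _ [[c _ <-]|[i _ <-]] r /=.
- rewrite coefC; case: r => [|r] /=; last by rewrite scale0r.
  by rewrite expr0 alg_polyC => D /(_ _) H; apply: H; left; exists c.
- rewrite coefZ coefX; case: eqP => [->|_]; last by rewrite mulr0 scale0r.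
  by rewrite mulr1 expr1 => D H; apply: H; right; exists i.
Qed.

Lemma Sbar_val_sum (T : Type) (s : seq T) (f : T -> Sbar) :
  sr_val (\sum_(i <- s) f i) = \sum_(i <- s) sr_val (f i).
Proof. exact: (raddf_sum val). Qed.

Lemma Sbar_direct : is_direct_sum Sbar_part.
Proof.
split.
- move=> q; exact: tmono0.
- by move=> q f g; exact: tmonoB.
- move=> f _.
  pose h q : Sbar := sr_elt (Sbar_coef q (sr_valP f)).
  exists [seq h q | q <- iota 0 (size (sr_val f))]; split.
    by move=> _ /mapP[q _ ->]; split=> //; exists q; exists (sr_val f)`_q.
  apply: val_inj => /=; rewrite Sbar_val_sum big_map.
  rewrite -{1}[sr_val f]coefK poly_def -(big_mkord xpredT (fun i => _`_i *: 'X^i)).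
  by rewrite /index_iota subn0.
- move=> s c us cP s0 i si; apply: val_inj => /=.
  rewrite (tmonoP (cP i)).
  have := congr1 (fun f : Sbar => (sr_val f : {poly R})`_i) s0.
  rewrite Sbar_val_sum coef_sum coef0 (bigD1_seq i) //= big1 ?addr0.
    by move=> ->; rewrite scale0r.
  move=> j ji; rewrite (tmonoP (cP j)) coefZ coefXn eq_sym (negPf ji).
  by rewrite mulr0.
Qed.

(* The grading of [S] by the degree in [t], so that [Proj S] is the image of
   the blowup in [P^m]. *)
Definition Sbar_grading : grading Sbar.
Proof.
refine (@Grading Sbar Sbar_part Sbar_direct tmono1 _).
by move=> i j a b; exact: tmonoM.
Defined.

Lemma Sbar_deg f q : Sbar_subring f -> G (q * d)%N f`_q.
Proof.
pose C := [set f : {poly R} | forall q, G (q * d)%N f`_q].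
have [G0 GB _ _] := gr_direct G.
have GD i a b : G i a -> G i b -> G i (a + b).
  by move=> Ga Gb; rewrite -(opprK b) -(sub0r b); apply: (GB) => //; exact: GB.
have C1 : C 1.
  by move=> [|r]; rewrite coef1 ?mul0n //=; exact: gr_one.
have CB a b : C a -> C b -> C (a - b).
  by move=> Ca Cb r; rewrite coefB; apply: GB.
have CM a b : C a -> C b -> C (a * b).
  move=> Ca Cb r; rewrite coefM; elim/big_ind: _ => [//||i _]; first exact: GD.
  by have := gr_mul (Ca i) (Cb (r - i)%N); rewrite -mulnDl subnKC // -ltnS.
have [GE _ _] := R_std.
move=> Sf; apply: (Sf (Subring C1 CB CM)) => _ [[c _ <-]|[i _ <-]] r /=.
- by rewrite coefC; case: r => [|r] //=; rewrite mul0n GE; exists c.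
- rewrite coefZ coefX; case: eqP => [->|_]; last by rewrite mulr0.
  by rewrite mulr1 mul1n.
Qed.

Section Fiber.
Variable p : closed_point Sbar_grading.

Definition den_set : set rees :=
  [set f | exists s : Sbar,
    [/\ sr_val s = sr_val f, exists q, Sbar_grading q s & ~ p s]].

Lemma den_set1 : den_set 1.
Proof.
exists 1; split=> //; first by exists 0%N; exact: gr_one.
by have [[]] := cp_Proj p.
Qed.

Lemma den_setM a b : den_set a -> den_set b -> den_set (a * b).
Proof.
move=> [s [sa [q qs] ps]] [t [tb [r rt] pt]]; exists (s * t); split.
- by rewrite /= -sa -tb.
- by exists (q + r)%N; exact: gr_mul.
- by have [[_ _ H] _ _] := cp_Proj p => /H[].
Qed.

Definition fiber_den : mulset rees := Mulset den_set1 den_setM.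

Local Notation L := (localization fiber_den).
Local Notation dval s := (sr_val (Loc.den_val s)).

(* The elements of degree 0 in [t]: those of [fiber_den] are homogeneous. *)
Definition fiber_set : set L :=
  [set y | exists q (f : rees) (s : Loc.den fiber_den),
    [/\ tmono q (sr_val f), tmono q (dval s) & y = frac f s]].

Lemma frac_sub (f g : rees) (s t : Loc.den fiber_den) :
  (frac f s : L) - frac g t =
  frac (f * Loc.den_val t - g * Loc.den_val s) (Loc.denM s t).
Proof.
rewrite -mulNr -[LHS]/(Loc.addl (frac f s) (Loc.oppl (frac g t))).
by rewrite Loc.opplE Loc.addlE.
Qed.

Lemma frac_mul (f g : rees) (s t : Loc.den fiber_den) :
  (frac f s : L) * frac g t = frac (f * g) (Loc.denM s t).
Proof. exact: Loc.mullE. Qed.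

Lemma fiber1 : fiber_set 1.
Proof.
exists 0%N, 1, (Loc.den1 fiber_den); split=> //; exact: tmono1.
Qed.

Lemma fiberB y z : fiber_set y -> fiber_set z -> fiber_set (y - z).
Proof.
move=> [q [f [s [qf qs ->]]]] [r [g [t [rg rt ->]]]]; rewrite frac_sub.
exists (q + r)%N; eexists; eexists; split; last by [].
  by apply: tmonoB; [|rewrite addnC]; exact: tmonoM.
exact: tmonoM.
Qed.

Lemma fiberM y z : fiber_set y -> fiber_set z -> fiber_set (y * z).
Proof.
move=> [q [f [s [qf qs ->]]]] [r [g [t [rg rt ->]]]]; rewrite frac_mul.
by exists (q + r)%N; eexists; eexists; split=> //; exact: tmonoM.
Qed.

(* The homogeneous localization of the Rees algebra at [p]: the fiber over [p]
   is its Proj. *)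
Definition fiber_subring : subring L := Subring fiber1 fiberB fiberM.
Definition fiber : comPzRingType := subring_type fiber_subring.

(* The part [(I^q)_(e + q * d) t^q] of bidegree [(e, q)]; membership in [I^q]
   comes from the type [rees]. *)
Definition rees_part e q : set rees :=
  [set f | exists2 c, G (e + q * d)%N c & sr_val f = c *: 'X^q].

Definition fiber_part e : set fiber :=
  [set y | exists q (f : rees) (s : Loc.den fiber_den),
    [/\ rees_part e q f, tmono q (dval s) & sr_val y = frac f s]].

Lemma rees_partM e e' q q' f g :
  rees_part e q f -> rees_part e' q' g -> rees_part (e + e') (q + q') (f * g).
Proof.
move=> [a Ga fa] [b Gb gb]; exists (a * b).
  by have := gr_mul Ga Gb; congr (G _ _); rewrite mulnDl; lia.
by rewrite /= fa gb -scalerAl -scalerAr scalerA exprD.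
Qed.

Lemma rees_partB e q f g :
  rees_part e q f -> rees_part e q g -> rees_part e q (f - g).
Proof.
have [_ GB _ _] := gr_direct G.
move=> [a Ga fa] [b Gb gb]; exists (a - b); first exact: GB.
by rewrite /= fa gb scalerBl.
Qed.

Lemma rees_part0 e q : rees_part e q 0.
Proof. by have [G0 _ _ _] := gr_direct G; exists 0; rewrite ?scale0r. Qed.

Lemma rees_part_den q (s : Loc.den fiber_den) :
  tmono q (dval s) -> rees_part 0 q (Loc.den_val s).
Proof.
move=> qs; exists (dval s)`_q; last exact: tmonoP.
have [u [<- _ _]] := Loc.denP s; rewrite add0n; apply: Sbar_deg.
exact: sr_valP.
Qed.

Lemma fiber_partM e e' y z :
  fiber_part e y -> fiber_part e' z -> fiber_part (e + e') (y * z).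
Proof.
move=> [q [f [s [qf qs yE]]]] [r [g [t [rg rt zE]]]].
exists (q + r)%N, (f * g), (Loc.denM s t); split.
- exact: rees_partM.
- exact: tmonoM.
- by rewrite /= yE zE frac_mul.
Qed.

Lemma fiber_partB e y z :
  fiber_part e y -> fiber_part e z -> fiber_part e (y - z).
Proof.
move=> [q [f [s [qf qs yE]]]] [r [g [t [rg rt zE]]]].
exists (q + r)%N; eexists; exists (Loc.denM s t).
split; last by rewrite /= yE zE frac_sub.
  have := rees_partM rg (rees_part_den qs); rewrite addn0 addnC.
  have := rees_partM qf (rees_part_den rt); rewrite addn0.
  exact: rees_partB.
exact: tmonoM.
Qed.

Lemma fiber_val_sum (T : Type) (s : seq T) (f : T -> fiber) :
  sr_val (\sum_(i <- s) f i) = \sum_(i <- s) sr_val (f i).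
Proof. exact: (raddf_sum val). Qed.

Lemma fiber_common_den (l : seq nat) (c : nat -> fiber) :
  (forall e, fiber_part e (c e)) ->
  exists q (s : Loc.den fiber_den) (f : nat -> rees),
    tmono q (dval s) /\
    forall e, e \in l -> rees_part e q (f e) /\ sr_val (c e) = frac (f e) s.
Proof.
move=> cP; elim: l => [|e l [q [s [f [qs H]]]]].
  by exists 0%N, (Loc.den1 fiber_den), (fun=> 0); split=> //; exact: tmono1.
have [r [g [t [rg rt E]]]] := cP e.
exists (r + q)%N, (Loc.denM t s).
exists (fun e' => if e' == e then g * Loc.den_val s else f e' * Loc.den_val t).
split; first exact: tmonoM.
move=> e'; case: eqP => [->|ne] e'l.
  split; last by rewrite E; apply: Loc.frac_eq => /=; ring.
  by have := rees_partM rg (rees_part_den qs); rewrite addn0.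
move: e'l; rewrite inE => /orP[/eqP//|/H[qf E']]; split.
  by have := rees_partM qf (rees_part_den rt); rewrite addn0 addnC.
by rewrite E'; apply: Loc.frac_eq => /=; ring.
Qed.

Lemma frac_sum (T : Type) (l : seq T) (f : T -> rees)
    (s : Loc.den fiber_den) :
  \sum_(i <- l) (frac (f i) s : L) = frac (\sum_(i <- l) f i) s.
Proof.
elim: l => [|i l IH].
  by rewrite !big_nil; apply: Loc.frac_eq => /=; ring.
rewrite !big_cons IH -[LHS]/(Loc.addl _ _) Loc.addlE.
by apply: Loc.frac_eq => /=; ring.
Qed.

Lemma rees_val_sum (T : Type) (l : seq T) (f : T -> rees) :
  sr_val (\sum_(i <- l) f i) = \sum_(i <- l) sr_val (f i).
Proof. exact: (raddf_sum val). Qed.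

Lemma fiber_direct : is_direct_sum fiber_part.
Proof.
have [G0 _ _ Gi] := gr_direct G; split.
- move=> e; exists 0%N, 0, (Loc.den1 fiber_den); split=> //.
    exact: rees_part0.
  exact: tmono1.
- by move=> e y z; exact: fiber_partB.
- move=> y _; have [q [f [s [qf qs yE]]]] := sr_valP y.
  have If : rees_set (sr_val f) := sr_valP f.
  have [r [rP fE]] := ideal_exp_graded_shift (If q).
  have mono_rees a : ideal_exp I q a -> rees_set (a *: 'X^q).
    move=> Ia j; rewrite coefZ coefXn; case: eqP => [->|_].
      by rewrite mulr1.
    by rewrite mulr0; have [] := ideal_expP I j.
  pose h a : rees := if pselect (ideal_exp I q a) is left Ia
    then @sr_elt _ rees_subring _ (mono_rees a Ia) else 0.
  have hE a : ideal_exp I q a -> sr_val (h a) = a *: 'X^q.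
    by rewrite /h; case: pselect.
  have h_fiber a : fiber_set (frac (h a) s).
    exists q, (h a), s; split=> //; rewrite /h; case: pselect => Ia.
      by exists a.
    exact: tmono0.
  pose g a : fiber := @sr_elt _ fiber_subring _ (h_fiber a).
  exists [seq g a | a <- r]; split.
    move=> _ /mapP[a /rP[Ia [e Ge]] ->]; split=> //; exists e.
    by exists q, (h a), s; split=> //; exists a => //; exact: hE.
  apply: val_inj; rewrite /= fiber_val_sum big_map yE frac_sum.
  congr Loc.frac; apply: val_inj; rewrite /= rees_val_sum (tmonoP qf) fE.
  rewrite scaler_suml; apply: eq_big_seq => a /rP[Ia _].
  by rewrite hE.
- move=> l c ul cP c0 e el; apply: val_inj.
  have [q [s [f [qs H]]]] := fiber_common_den l cP.
  have fP i : i \in l -> rees_part i q (f i) by move=> /H[].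
  have : frac (\sum_(i <- l) f i) s = frac 0 (Loc.den1 fiber_den).
    rewrite -frac_sum -[RHS]/(sr_val (0 : fiber)) -c0 fiber_val_sum.
    by apply: eq_big_seq => i /H[].
  move=> /Loc.fracE[u Wu /=]; rewrite mulr1 mul0r mulr0 => uE.
  have [r ru] : exists r, rees_part 0 r u.
    have [s' [us' [r rs'] _]] := Wu.
    by exists r; apply: (@rees_part_den r (Loc.mkden Wu)) => /=; rewrite -us'.
  have uf0 : u * f e = 0.
    have [u0 Gu uu] := ru; rewrite add0n in Gu.
    pose a i : R := if i \in l then (sr_val (f i) : {poly R})`_q else 0.
    have fa i : i \in l -> sr_val (f i) = a i *: 'X^q.
      move=> il; rewrite /a il; apply: tmonoP.
      by have [b _ ->] := fP i il; exists b.
    have Ga i : G (i + q * d)%N (a i).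
      rewrite /a; case: ifP => [/fP[b Gb ->]|_]; last exact: G0.
      by rewrite coefZ coefXn eqxx mulr1.
    pose D := (r * d + q * d)%N.
    pose b j : R := if (D <= j)%N then u0 * a (j - D)%N else 0.
    have bD i : b (i + D)%N = u0 * a i by rewrite /b leq_addl addnK.
    have Gb j : G j (b j).
      rewrite /b; case: ifP => [Dj|_]; last exact: G0.
      have := gr_mul Gu (Ga (j - D)%N); congr (G _ _).
      by rewrite addnCA subnK.
    have ub : uniq [seq (i + D)%N | i <- l].
      by rewrite map_inj_uniq // => i j /addIn.
    have sb : \sum_(j <- [seq (i + D)%N | i <- l]) b j = 0.
      rewrite big_map; under eq_bigr do rewrite bD.
      have := congr1 (fun g : rees => (sr_val g : {poly R})`_(r + q)) uE.
      rewrite /= rees_val_sum uu (eq_big_seq _ fa) -scaler_suml.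
      by rewrite -scalerAl -scalerAr scalerA -exprD coefZ coefXn eqxx mulr1
        mulr_sumr coef0.
    have := Gi _ b ub Gb sb (e + D)%N; rewrite bD => ua.
    apply: val_inj => /=; rewrite uu (fa e el) -scalerAl -scalerAr scalerA.
    by rewrite ua ?scale0r //; apply/mapP; exists e.
  have [_ ->] := H e el; apply/Loc.fracE; exists u => //.
  by rewrite mul0r mulr0 mulr1.
Qed.

Lemma fiber_part1 : fiber_part 0 1.
Proof.
exists 0%N, 1, (Loc.den1 fiber_den); split=> //; last exact: tmono1.
by exists 1; [exact: gr_one | rewrite expr0 scale1r].
Qed.

Definition fiber_grading : grading fiber :=
  Grading fiber_direct fiber_part1 fiber_partM.

End Fiber.

Definition is_astar_phi (v : \bar int) : Prop :=
  exists a : closed_point Sbar_grading -> \bar int,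
    (forall p, is_astar (self_grmod (fiber_grading p)) (a p)) /\
    is_max (range a) v.

End Rees.

(* Main.v *)
Require Import Defs.
From HB Require Import structures.
From mathcomp Require Import all_boot all_order all_algebra.
From mathcomp Require Import boolp classical_sets constructive_ereal.
From mathcomp Require Import ring zify.

(** Let [b(M)] be the greatest degree in which the Koszul homology of a graded
    module [M] on generators [x_0, ..., x_n] of degree 1 of the ring does not
    vanish. Then [a^*(M) = b(M) - (n + 1)] when the Koszul homology of the ring
    itself vanishes in high degrees: this is [local_cohomology_Koszul], from
    which both sides of the equality are read off.

    For the proof of that fact, let [E] be an injective resolution of [M] and
    [T] its torsion. The Koszul complexes of [M] and [E] have the same homology.
    So do those of [E] and [T], since for an injective module the Koszul complex
    modulo that of the torsion is exact ([injective_Koszul_torsion], by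
    self-duality of the Koszul complex). The Koszul complex of [T] is an iterated
    cone on multiplications by the [x_i], which are nilpotent on each element of
    the homology of [T]: the top degree goes up by exactly 1 with each cone.
    Injective resolutions exist because the rings contain a field in degree 0,
    so that coinduced modules are injective ([injective_resolution_ex]).

    Now all modules of the theorem come from the Rees algebra. The Koszul complex
    of its [x_i] is bigraded. Its row [q] is the Koszul complex of [I^q] with
    degrees counted from [q d] ([Koszul_ideal_exp]), and its homogeneous
    localization at a closed point [p] is the Koszul complex of the fiber over
    [p] ([Koszul_fiber]). It remains to see that, for large [q], the top degree of
    nonzero homology in row [q] is the maximum of those of the fibers. The cycles
    are a noetherian module, since the Rees algebra is of finite type over a
    field. Hence only finitely many first degrees matter, and beyond some [Q] an
    exact row is followed by exact rows ([Koszul_bounds]). In a given first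
    degree, if the rows are exact for large [q], so are all fibers, because
    fractions can be written with numerators in high rows ([fiber_acyclic]).
    Otherwise let [S] be the coordinate ring of the image: some homology class
    is killed by no power of its irrelevant ideal, and survives in the fiber
    over a closed point whose ideal contains the annihilator of the class
    ([fiber_not_acyclic]). *)

Set Implicit Arguments.
Unset Strict Implicit.
Unset Printing Implicit Defensive.

Import Order.TTheory GRing.Theory Num.Theory.

Local Open Scope classical_set_scope.
Local Open Scope ring_scope.

(** * Direct sums and homogeneous components *)

(** The components, differentials and homotopies below are plain functions,
    often built inside proofs; additivity is therefore a separate property. *)
Section AdditiveFunctions.
Variables (U V : zmodType) (f : U -> V).
Hypothesis fD : {morph f : u v / u + v}.

Lemma addf0 : f 0 = 0.
Proof. by apply: (@addrI _ (f 0)); rewrite -fD !addr0. Qed.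

Lemma addfN u : f (- u) = - f u.
Proof. by apply: (@addrI _ (f u)); rewrite -fD !subrr addf0. Qed.

Lemma addfB u v : f (u - v) = f u - f v.
Proof. by rewrite fD addfN. Qed.

Lemma addf_sum (T : Type) (s : seq T) (g : T -> U) :
  f (\sum_(i <- s) g i) = \sum_(i <- s) f (g i).
Proof.
by elim: s => [|i s IH]; rewrite ?big_nil ?addf0 // !big_cons fD IH.
Qed.

End AdditiveFunctions.

Lemma in_sum_span (V : zmodType) (Q : set V) (T : eqType) (s : seq T)
    (f : T -> V) :
  Q 0 -> (forall u v, Q u -> Q v -> Q (u + v)) ->
  (forall i, i \in s -> Q (f i)) -> Q (\sum_(i <- s) f i).
Proof.
move=> Q0 QD Qf; by rewrite big_seq; elim/big_ind: _ => // i /Qf.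
Qed.

Section FiniteSums.
Variables (V : zmodType) (P : set V).

Definition finite_sums : set V := [set v | exists t : seq V,
  (forall u, u \in t -> P u) /\ v = \sum_(u <- t) u].

Lemma finite_sums0 : finite_sums 0.
Proof. by exists [::]; rewrite big_nil. Qed.

Lemma finite_sumsD u v : finite_sums u -> finite_sums v -> finite_sums (u + v).
Proof.
move=> [s [sP ->]] [t [tP ->]]; exists (s ++ t); rewrite big_cat; split=> // w.
by rewrite mem_cat => /orP[/sP|/tP].
Qed.

Lemma finite_sums_in v : P v -> finite_sums v.
Proof.
by move=> Pv; exists [:: v]; rewrite big_seq1; split=> // u /[1!inE] /eqP ->.
Qed.

End FiniteSums.

Section SubringFacts.
Variables (A : comPzRingType) (B : subring A).

Lemma sr0 : B 0.
Proof. by rewrite -(subrr 1); apply: sr_sub; exact: sr_one. Qed.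

Lemma srN a : B a -> B (- a).
Proof. by move=> Ba; rewrite -sub0r; apply: sr_sub => //; exact: sr0. Qed.

Lemma srD a b : B a -> B b -> B (a + b).
Proof. by move=> Ba Bb; rewrite -(opprK b); apply/sr_sub/srN. Qed.

Lemma sr_sum (T : eqType) (s : seq T) (f : T -> A) :
  (forall i, i \in s -> B (f i)) -> B (\sum_(i <- s) f i).
Proof. by apply: in_sum_span; [exact: sr0|exact: srD]. Qed.

Definition submodule (V : lmodType A) (J : set V) :=
  [/\ J 0, forall u v, J u -> J v -> J (u + v) &
      forall c v, B c -> J v -> J (c *: v)].

Lemma submoduleB (V : lmodType A) (J : set V) u v :
  submodule J -> J u -> J v -> J (u - v).
Proof.
move=> [J0 JD JZ] Ju Jv; apply: JD => //; rewrite -scaleN1r; apply: JZ => //.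
by apply: srN; exact: sr_one.
Qed.

End SubringFacts.

Section Components.
Variables (I : eqType) (V : zmodType) (P : I -> set V).
Hypothesis hP : is_direct_sum P.

Lemma part0 i : P i 0. Proof. by have [] := hP. Qed.

Lemma partB i u v : P i u -> P i v -> P i (u - v).
Proof. by have [_ + _ _] := hP; apply. Qed.

Lemma partN i u : P i u -> P i (- u).
Proof. by rewrite -sub0r; apply: partB; exact: part0. Qed.

Lemma partD i u v : P i u -> P i v -> P i (u + v).
Proof. by move=> Pu Pv; rewrite -(opprK v); apply/partB/partN. Qed.

Definition decomposition v (c : I -> V) (s : seq I) :=
  [/\ forall i, P i (c i), uniq s, forall i, i \notin s -> c i = 0 &
      v = \sum_(i <- s) c i].

Lemma decomposition_ex v : exists c s, decomposition v c s.
Proof.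
have [_ _ Pg _] := hP; have [t [tP ->]] := Pg v Logic.I.
elim: t tP => [|u t IH] tP.
  exists (fun=> 0), [::]; split=> //; first by move=> i; exact: part0.
  by rewrite !big_nil.
have [|c [s [Pc us c0 E]]] := IH.
  by move=> w wt; apply: tP; rewrite inE wt orbT.
have [_ [i Pu]] := tP u (mem_head _ _).
pose s' := if i \in s then s else i :: s.
exists (fun j => if j == i then u + c j else c j), s'; split.
- by move=> j; case: eqP => [->|_]; [exact: partD|exact: Pc].
- by rewrite /s'; case: ifP => //= ->.
- move=> j; rewrite /s'; case: ifP => si.
    by case: eqP => [->|_ /c0//]; rewrite si.
  by rewrite inE negb_or => /andP[/negPf -> /c0].
- have us' : uniq s' by rewrite /s'; case: ifP => //= ->.
  have is' : i \in s' by rewrite /s'; case: ifP => //; rewrite mem_head.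
  have E' : \sum_(j <- s) c j = \sum_(j <- s') c j.
    by rewrite /s'; case: ifP => // /negbT/c0 ci; rewrite big_cons ci add0r.
  rewrite big_cons E E' (bigD1_seq i) //= [RHS](bigD1_seq i) //= eqxx addrA.
  by congr (_ + _); apply: eq_bigr => j /negPf ->.
Qed.

(** The components are chosen from some decomposition, and do not depend on it
    ([decomposition_uniq]); [supp v] is a list of indices off which they
    vanish, which may still contain indices of zero components. *)
Definition hcomp v : I -> V := sval (cid (decomposition_ex v)).
Definition supp v : seq I := sval (cid (svalP (cid (decomposition_ex v)))).

Lemma compP v : decomposition v (hcomp v) (supp v).
Proof. exact: svalP (cid (svalP (cid (decomposition_ex v)))). Qed.

Lemma comp_part v i : P i (hcomp v i).
Proof. by have [] := compP v. Qed.

Lemma sum_compS v s : uniq s -> {subset supp v <= s} ->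
  \sum_(i <- s) hcomp v i = v.
Proof.
move=> us sub; have [_ ut c0 E] := compP v.
rewrite [RHS]E (bigID (mem (supp v))) /= [X in _ + X]big1 ?addr0 => [|i /c0//].
rewrite -big_filter; apply: perm_big; apply: uniq_perm => //.
  exact: filter_uniq.
move=> i; rewrite mem_filter; by case: (boolP (i \in supp v)) => // /sub ->.
Qed.

Lemma sum_comp v : \sum_(i <- supp v) hcomp v i = v.
Proof. by have [_ _ _ <-] := compP v. Qed.

(** The difference of two decompositions of [v] sums to zero over the union of
    their index lists, and the parts are independent. *)
Lemma decomposition_uniq v c s : decomposition v c s -> hcomp v =1 c.
Proof.
move=> [Pc us c0 E] i.
have [Pd ut d0 E'] := compP v; have [_ _ _ Pind] := hP.
pose r := undup (s ++ supp v).
have ur : uniq r by exact: undup_uniq.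
have sr : {subset s <= r} by move=> j; rewrite mem_undup mem_cat => ->.
have tr : {subset supp v <= r}.
  by move=> j; rewrite mem_undup mem_cat => ->; rewrite orbT.
have Er : \sum_(j <- r) c j = v.
  rewrite E (bigID (mem s)) /= [X in _ + X]big1 ?addr0 => [|j /c0//].
  rewrite -big_filter; apply: perm_big; apply: uniq_perm => //.
    exact: filter_uniq.
  move=> j; rewrite mem_filter; by case: (boolP (j \in s)) => // /sr ->.
have [ir|] := boolP (i \in r).
  apply/eqP; rewrite -subr_eq0; apply/eqP.
  apply: (Pind r (fun j => hcomp v j - c j)) => //.
    by move=> j; exact: partB.
  by rewrite sumrB Er sum_compS // subrr.
by rewrite mem_undup mem_cat negb_or => /andP[/c0 -> /d0].
Qed.

Lemma comp_eq v i : P i v -> hcomp v i = v.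
Proof.
move=> Pv; rewrite (@decomposition_uniq v (fun j => if j == i then v else 0)
  [:: i]) ?eqxx //; split=> //.
- by move=> j; case: eqP => [->//|_]; exact: part0.
- by move=> j; rewrite inE => /negPf ->.
- by rewrite big_seq1 eqxx.
Qed.

Lemma comp_neq v i j : P i v -> j != i -> hcomp v j = 0.
Proof.
move=> Pv /negPf ji.
rewrite (@decomposition_uniq v (fun j => if j == i then v else 0) [:: i]) ?ji //.
split=> //.
- by move=> r; case: eqP => [->//|_]; exact: part0.
- by move=> r; rewrite inE => /negPf ->.
- by rewrite big_seq1 eqxx.
Qed.

Lemma compD i : {morph hcomp^~ i : u v / u + v}.
Proof.
move=> u v; pose r := undup (supp u ++ supp v).
apply: (@decomposition_uniq _ (fun i => hcomp u i + hcomp v i) r); split.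
- by move=> j; apply: partD; exact: comp_part.
- exact: undup_uniq.
- move=> j; rewrite mem_undup mem_cat negb_or => /andP[].
  have [_ _ u0 _] := compP u; have [_ _ v0 _] := compP v.
  by move=> /u0 -> /v0 ->; rewrite addr0.
- rewrite big_split /= !sum_compS ?undup_uniq // => j.
    by rewrite mem_undup mem_cat => ->; rewrite orbT.
  by rewrite mem_undup mem_cat => ->.
Qed.

(** Homomorphisms out of a direct sum are built from maps [phi i] that are
    additive on [P i] only; [phi i] may take any values elsewhere. *)
Definition glue (W : zmodType) (phi : I -> V -> W) (v : V) : W :=
  \sum_(i <- supp v) phi i (hcomp v i).

Section Glue.
Variables (W : zmodType) (phi : I -> V -> W).
Hypothesis phiD :
  forall i u v, P i u -> P i v -> phi i (u + v) = phi i u + phi i v.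

Lemma phi0 i : phi i 0 = 0.
Proof.
apply: (@addrI _ (phi i 0)); rewrite -phiD ?addr0 //; exact: part0.
Qed.

Lemma glue_sum v s : uniq s -> {subset supp v <= s} ->
  glue phi v = \sum_(i <- s) phi i (hcomp v i).
Proof.
move=> us sub; have [_ ut c0 _] := compP v.
rewrite [RHS](bigID (mem (supp v))) /= [X in _ + X]big1 ?addr0 => [|i].
  rewrite -big_filter; apply: perm_big; apply: uniq_perm => //.
    exact: filter_uniq.
  move=> i; rewrite mem_filter; by case: (boolP (i \in supp v)) => // /sub ->.
by move=> /c0 ->; exact: phi0.
Qed.

Lemma glueD : {morph glue phi : u v / u + v}.
Proof.
move=> u v; pose r := undup (supp u ++ supp v ++ supp (u + v)).
have ur : uniq r by exact: undup_uniq.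
rewrite !(@glue_sum _ r) //.
- rewrite -big_split; apply: eq_bigr => i _.
  by rewrite compD phiD //; exact: comp_part.
- by move=> j; rewrite mem_undup !mem_cat => ->; rewrite !orbT.
- by move=> j; rewrite mem_undup !mem_cat => ->.
- by move=> j; rewrite mem_undup !mem_cat => ->; rewrite !orbT.
Qed.

Lemma glueE i v : P i v -> glue phi v = phi i v.
Proof.
move=> Pv; pose r := undup (i :: supp v).
rewrite (@glue_sum _ r) ?undup_uniq //; last first.
  by move=> j jv; rewrite mem_undup inE jv orbT.
rewrite (bigD1_seq i) ?undup_uniq ?mem_undup ?mem_head //= comp_eq // big1.
  by rewrite addr0.
by move=> j ji; rewrite (comp_neq Pv ji) phi0.
Qed.

End Glue.

End Components.

Section ComponentsMorphism.
Variables (I J : eqType) (U V : zmodType) (P : I -> set U) (Q : J -> set V).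
Hypotheses (hP : is_direct_sum P) (hQ : is_direct_sum Q).
Variables (f : U -> V) (sigma : I -> J).
Hypotheses (fD : {morph f : u v / u + v}) (sigma_inj : injective sigma).
Hypothesis fP : forall i u, P i u -> Q (sigma i) (f u).

(** A map that sends parts to parts sends the decomposition of [u] to one of
    [f u]. This makes kernels and images of homogeneous maps graded: components
    of cycles are cycles, and boundaries have homogeneous preimages. *)
Lemma comp_morph u i : hcomp hQ (f u) (sigma i) = f (hcomp hP u i).
Proof.
rewrite -{1}(sum_comp hP u) (addf_sum fD) (addf_sum (compD hQ (sigma i))).
have [_ us c0 _] := compP hP u.
have E j : hcomp hQ (f (hcomp hP u j)) (sigma i) =
    if j == i then f (hcomp hP u i) else 0.
  have Pj := fP (comp_part hP u j).
  case: eqP => [ji|/eqP ji].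
    by rewrite ji in Pj *; exact: comp_eq.
  by rewrite (comp_neq hQ Pj) // inj_eq // eq_sym.
rewrite (eq_bigr _ (fun j _ => E j)).
have [iu|/c0 ->] := boolP (i \in supp hP u).
  rewrite (bigD1_seq i) //= eqxx big1 ?addr0 // => j /negPf -> //.
by rewrite (addf0 fD) big1 // => j _; case: eqP.
Qed.

End ComponentsMorphism.

Section DirectSums.

Lemma direct_sum_reindex (I J : eqType) (V : zmodType) (P : I -> set V)
    (f : J -> I) (g : I -> J) :
  cancel f g -> cancel g f -> is_direct_sum P ->
  is_direct_sum (fun j => P (f j)).
Proof.
move=> fK gK [P0 PB Pg Pi]; split=> [//|j|v /Pg[s [sP ->]]|s c us Pc s0 j js].
- exact: PB.
- exists s; split=> // u /sP[_ [i Pu]]; split=> //; exists (g i).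
  by rewrite gK.
- have := Pi (map f s) (fun i => c (g i)); rewrite big_map.
  have -> : \sum_(j <- s) c (g (f j)) = \sum_(j <- s) c j.
    by apply: eq_bigr => i _; rewrite fK.
  rewrite map_inj_uniq; last exact: can_inj fK.
  move=> /(_ us _ s0 (f j)); rewrite fK; apply; last exact: map_f.
  by move=> i; have := Pc (g i); rewrite gK.
Qed.

Lemma direct_sum_prod (I : eqType) (U V : zmodType) (P : I -> set U)
    (Q : I -> set V) :
  is_direct_sum P -> is_direct_sum Q ->
  is_direct_sum (fun i (w : U * V) => P i w.1 /\ Q i w.2).
Proof.
move=> hP hQ; split.
- by move=> i; split; [exact: part0 hP i|exact: part0 hQ i].
- move=> i u v [Pu Qu] [Pv Qv]; split; first exact: partB hP _ _ _ Pu Pv.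
  exact: partB hQ _ _ _ Qu Qv.
- move=> [u v] _.
  exists ([seq (hcomp hP u i, 0) | i <- supp hP u] ++
          [seq (0, hcomp hQ v i) | i <- supp hQ v]); split.
    move=> w; rewrite mem_cat => /orP[]/mapP[i _ ->]; split=> //; exists i.
      by split; [exact: comp_part|exact: part0 hQ i].
    by split; [exact: part0 hP i|exact: comp_part].
  rewrite big_cat !big_map /=.
  have fD : {morph (fun u : U => (u, 0 : V)) : a b / a + b}.
    by move=> a b; congr pair; rewrite /= addr0.
  have gD : {morph (fun v : V => (0 : U, v)) : a b / a + b}.
    by move=> a b; congr pair; rewrite /= addr0.
  rewrite -(addf_sum fD) -(addf_sum gD) !sum_comp.
  by congr pair; rewrite /= ?addr0 ?add0r.
- move=> s c us cP s0 i si.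
  have D1 : {morph (@fst U V) : a b / a + b} by [].
  have D2 : {morph (@snd U V) : a b / a + b} by [].
  have [_ _ _ Pi] := hP; have [_ _ _ Qi] := hQ.
  have := congr1 fst s0; rewrite (addf_sum D1) => s1.
  have := congr1 snd s0; rewrite (addf_sum D2) => s2.
  have := Pi s (fun i => (c i).1) us (fun i => (cP i).1) s1 i si.
  have := Qi s (fun i => (c i).2) us (fun i => (cP i).2) s2 i si.
  by case: (c i) => a b /= -> ->.
Qed.

End DirectSums.

(** * Graded modules inside a module *)

(** A graded module inside [H], without the condition that its parts span [H]:
    a graded submodule, or the homogeneous maps among all maps. *)
Record gfamily (A : comPzRingType) (G : grading A) (H : lmodType A) := GFamily {
  gf_part :> int -> set H;
  gf_0 : forall l, gf_part l 0;
  gf_B : forall l u v, gf_part l u -> gf_part l v -> gf_part l (u - v);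
  gf_ind : forall (s : seq int) (c : int -> H), uniq s ->
    (forall l, gf_part l (c l)) -> \sum_(l <- s) c l = 0 ->
    forall l, l \in s -> c l = 0;
  gf_scale : forall i l a v,
    G i a -> gf_part l v -> gf_part (i%:Z + l) (a *: v) }.

Section SumModule.
Variables (A : comPzRingType) (G : grading A) (H : lmodType A).
Variable P : gfamily G H.

Definition hsum : set H := finite_sums [set u | exists l, P l u].

Definition hsum_mem : {pred H} := fun v => `[< hsum v >].

Record hsum_type := HSumElt { hs_val : H; _ : hsum_mem hs_val }.

HB.instance Definition _ := [isSub for hs_val].
HB.instance Definition _ := [Choice of hsum_type by <:].

Lemma hsum_part l v : P l v -> hsum v.
Proof. by move=> Pv; apply: finite_sums_in; exists l. Qed.

Lemma hsumD u v : hsum u -> hsum v -> hsum (u + v).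
Proof. exact: finite_sumsD. Qed.

Lemma hsum0 : hsum 0. Proof. exact: finite_sums0. Qed.

Lemma hsumZ a v : hsum v -> hsum (a *: v).
Proof.
move=> [s [sP ->]]; rewrite -(sum_comp (gr_direct G) a) scaler_suml.
apply: in_sum_span => [||i _]; [exact: hsum0|exact: hsumD|].
rewrite scaler_sumr; apply: in_sum_span => [||u /sP[l Pu]].
- exact: hsum0.
- exact: hsumD.
- by apply: hsum_part (gf_scale _ Pu); exact: (comp_part (gr_direct G)).
Qed.

Lemma hsum_closed : GRing.subsemimod_closed hsum_mem.
Proof.
split; first split; first by apply/asboolP/hsum0.
- by move=> a b /asboolP Ia /asboolP Ib; apply/asboolP/hsumD.
- by move=> a b /asboolP Ib; apply/asboolP/hsumZ.
Qed.

HB.instance Definition _ :=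
  GRing.SubChoice_isSubLmodule.Build A H hsum_mem hsum_type hsum_closed.

Lemma hs_valP (x : hsum_type) : hsum (hs_val x).
Proof. by case: x => a Ha; apply/asboolP. Qed.

Definition hs_elt v (hv : hsum v) : hsum_type := HSumElt (introT (asboolP _) hv).

Lemma hs_valZ a x : hs_val (a *: x) = a *: hs_val x.
Proof. exact: (linearZZ val). Qed.

Lemma hs_val_inj : injective hs_val. Proof. exact: val_inj. Qed.

Lemma hs_valD : {morph hs_val : x y / x + y}.
Proof. by move=> x y; exact: (raddfD val). Qed.

Definition hs_part (l : int) : set hsum_type := [set x | P l (hs_val x)].

Lemma hs_direct : is_direct_sum hs_part.
Proof.
split.
- by move=> l; rewrite -[hs_part _ _]/(P l (hs_val 0)) (addf0 hs_valD); exact: gf_0.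
- move=> l x y Px Py.
  by rewrite -[hs_part _ _]/(P l (hs_val (x - y))) (addfB hs_valD); exact: gf_B.
- move=> x _; have [s [sP E]] := hs_valP x.
  have : exists t : seq hsum_type, (forall y, y \in t -> exists l, hs_part l y) /\
      \sum_(y <- t) hs_val y = \sum_(u <- s) u.
    elim: s {E} sP => [|u s IH] sP; first by exists [::]; rewrite !big_nil.
    have [l Pu] := sP u (mem_head _ _).
    have [|t [tP E]] := IH; first by move=> v vs; apply: sP; rewrite inE vs orbT.
    exists (hs_elt (hsum_part Pu) :: t); rewrite !big_cons E; split=> // y.
    by rewrite inE => /orP[/eqP ->|/tP//]; exists l.
  move=> [t [tP F]]; exists t; split=> [y /tP//|].
  by apply: hs_val_inj; rewrite (addf_sum hs_valD) F.
- move=> s c us cP s0 l ls; apply: hs_val_inj; rewrite (addf0 hs_valD).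
  apply: (gf_ind us cP) => //.
  by rewrite -(addf_sum hs_valD) s0 (addf0 hs_valD).
Qed.

Lemma hs_scale i l a x : G i a -> hs_part l x -> hs_part (i%:Z + l) (a *: x).
Proof.
move=> Ga Px; rewrite -[hs_part _ _]/(P _ (hs_val (a *: x))).
rewrite hs_valZ; exact: gf_scale.
Qed.

(** The direct sum of the parts, with the sums of homogeneous elements of [H]
    as underlying module. *)
Definition sum_grmod : grmod G := GrMod hs_direct hs_scale.

End SumModule.

(** * Koszul complexes as iterated cones *)

Section Cones.
Variables (A : comPzRingType) (J : comPzRingType) (tau delta : J).
Implicit Types (V : lmodType A) (j : J).

(** A complex is a module with an endomorphism [D] of square zero and parts
    [P j], which need not span it, such that [D] has degree [delta]. Degrees lie
    in a ring [J], to cover both [int] and [int * int]. The second summand of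
    the cone of [x] is shifted by [tau]; so [x] has degree [delta - tau]. *)
Definition coneD V (x : A) (D : V -> V) (w : V * V) : V * V :=
  (D w.1 + x *: w.2, - D w.2).

Definition coneP V (P : J -> set V) j : set (V * V) :=
  [set w | P j w.1 /\ P (j + tau) w.2].

Definition differential V (D : V -> V) :=
  [/\ {morph D : u v / u + v}, forall a v, D (a *: v) = a *: D v &
      forall v, D (D v) = 0].

Record subcomplex (X : set A) V (D : V -> V) (P : J -> set V) : Prop :=
  Subcomplex {
    sub_0 : forall j, P j 0;
    sub_B : forall j u v, P j u -> P j v -> P j (u - v);
    sub_D : forall j v, P j v -> P (j + delta) (D v);
    sub_X : forall x j v, X x -> P j v -> P (j + (delta - tau)) (x *: v) }.

Lemma subN X V (D : V -> V) (P : J -> set V) j v :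
  subcomplex X D P -> P j v -> P j (- v).
Proof. by move=> [P0 PB _ _] Pv; rewrite -sub0r; exact: PB. Qed.

Lemma subD X V (D : V -> V) (P : J -> set V) j u v :
  subcomplex X D P -> P j u -> P j v -> P j (u + v).
Proof.
move=> sP Pu Pv; rewrite -(opprK v).
by apply: (sub_B sP) => //; exact: subN sP _.
Qed.

(** Exactness at [j] of the quotient complex [P / P']. *)
Definition acyclic_rel (V : zmodType) (D : V -> V) (P P' : J -> set V) j :=
  forall v, P j v -> P' (j + delta) (D v) ->
    exists2 u, P (j - delta) u & P' j (v - D u).

Definition acyclic (V : zmodType) (D : V -> V) (P : J -> set V) j :=
  forall v, P j v -> D v = 0 -> exists2 u, P (j - delta) u & D u = v.

Lemma acyclic_rel0 (V : zmodType) (D : V -> V) (P P' : J -> set V) j :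
  (forall i v, P' i v <-> v = 0) ->
  acyclic_rel D P P' j <-> acyclic D P j.
Proof.
move=> P'0; split=> H v Pv.
  move=> Dv; have [|u Pu /P'0 /eqP] := H v Pv; first exact/P'0.
  by rewrite subr_eq0 => /eqP vE; exists u.
by move=> /P'0 /(H _ Pv)[u Pu <-]; exists u => //; apply/P'0; rewrite subrr.
Qed.

Definition tors_homology (X : set A) V (D : V -> V) (P : J -> set V) :=
  forall x j v, X x -> P j v -> D v = 0 ->
    exists N u, P (j + (delta - tau) *+ N - delta) u /\ D u = x ^+ N *: v.

Lemma differential_cone V x (D : V -> V) : differential D ->
  differential (coneD x D).
Proof.
move=> [D1 D2 D3]; split.
- move=> [a b] [c e]; rewrite /coneD /=; congr pair.
    by rewrite /= D1 scalerDr addrACA.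
  by rewrite /= D1 opprD.
- move=> a [b c]; rewrite /coneD /=; congr pair; rewrite /= D2.
    by rewrite scalerDr !scalerA mulrC.
  by rewrite scalerN.
- move=> [b c]; rewrite /coneD /=; congr pair; rewrite /=.
    by rewrite D1 D3 add0r D2 scalerN subrr.
  by rewrite (addfN D1) D3 !oppr0.
Qed.

Section ConeOf.
Variables (X : set A) (V : lmodType A) (D : V -> V).
Hypothesis dD : differential D.

Lemma subcomplex_cone x P : X x -> subcomplex X D P ->
  subcomplex X (coneD x D) (coneP P).
Proof.
move=> Xx sP; have [P0 PB PD PX] := sP; split.
- by move=> j; split; exact: P0.
- by move=> j u v [Pu Qu] [Pv Qv]; split; exact: PB.
- move=> j [u v] [/= Pu Pv]; split=> /=.
    apply: (subD sP); first exact: PD.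
    by have := PX x _ _ Xx Pv; congr (P _ _); ring.
  by rewrite addrAC; apply: (subN sP); exact: PD.
- move=> y j [u v] Xy [/= Pu Pv]; split=> /=; first exact: PX.
  by rewrite addrAC; exact: PX.
Qed.

(** The cone is an extension of a shift of the complex by the complex; hence
    the two degrees. *)
Lemma acyclic_rel_cone x P P' j : X x -> subcomplex X D P ->
  subcomplex X D P' -> acyclic_rel D P P' j -> acyclic_rel D P P' (j + tau) ->
  acyclic_rel (coneD x D) (coneP P) (coneP P') j.
Proof.
move=> Xx sP sP' H1 H2 [u v] [/= Pu Pv] [/= Qu Qv].
have [D1 D2 D3] := dD.
have [|v' Pv' Qv'] := H2 v Pv.
  by have := subN sP' Qv; rewrite opprK addrAC.
have Pxv : P j (x *: v').
  by have := sub_X sP Xx Pv'; congr (P _ _); ring.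
have [||u' Pu' Qu'] := H1 (u + x *: v').
- exact: subD sP Pu Pxv.
- have -> : D (u + x *: v') = (D u + x *: v) - x *: (v - D v').
    by rewrite D1 D2 scalerBr opprB -addrA [x *: v + _]addrC subrK.
  apply: (sub_B sP') => //.
  by have := sub_X sP' Xx Qv'; congr (P' _ _); ring.
exists (u', - v'); split=> /=.
- exact: Pu'.
- by rewrite addrAC; exact: subN sP Pv'.
- by rewrite scalerN opprB addrA.
- by rewrite (addfN D1) opprK.
Qed.

(** Exactness of the cone makes [x] injective on homology in the degree of [v]
    and in those of its multiples by powers of [x]. A class killed by [x ^+ N]
    is then zero, by induction on [N]. *)
Lemma acyclic_of_cone x P j : X x -> subcomplex X D P ->
  tors_homology X D P ->
  (forall n, acyclic (coneD x D) (coneP P) (j + (delta - tau) *+ n - tau)) ->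
  acyclic D P j.
Proof.
move=> Xx sP tP H v Pv Dv.
have [D1 D2 D3] := dD.
have [N [u [Pu uv]]] := tP x j v Xx Pv Dv.
elim: N u Pu uv => [|N IH] u Pu uv.
  by exists u; rewrite ?uv ?expr0 ?scale1r //; move: Pu; rewrite addr0.
have Pxv : P (j + (delta - tau) *+ N) (x ^+ N *: v).
  elim: N {IH u Pu uv} => [|N IHN]; first by rewrite addr0 scale1r.
  by have := sub_X sP Xx IHN; rewrite scalerA -exprS -addrA -mulrSr.
have [||[u' v'] [_ /= Pv'] [_ vE]] := H N (- u, x ^+ N *: v).
- split=> /=; last by rewrite subrK.
  by have := subN sP Pu; congr (P _ _); rewrite mulrSr; ring.
- rewrite /coneD /= (addfN D1) uv D2 Dv scaler0 oppr0 scalerA -exprS.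
  by rewrite addNr.
apply: (IH (- v')); last by rewrite (addfN D1).
by have := subN sP Pv'; congr (P _ _); ring.
Qed.

(** Homology of the cone is an extension of two torsion modules: a power of [y]
    kills the image in the quotient, and another one what remains. *)
Lemma tors_homology_cone x P : X x -> subcomplex X D P ->
  tors_homology X D P -> tors_homology X (coneD x D) (coneP P).
Proof.
move=> Xx sP tP y j [u v] Xy [/= Pu Pv] [uE vE].
have [D1 D2 D3] := dD.
have Dv : D v = 0 by rewrite -(opprK (D v)) vE oppr0.
have [N [v' [Pv' v'E]]] := tP y _ _ Xy Pv Dv.
have powP (Q : J -> set V) : subcomplex X D Q -> forall n i w, Q i w ->
    Q (i + (delta - tau) *+ n) (y ^+ n *: w).
  move=> sQ n i w Qw; elim: n => [|n IHn]; first by rewrite addr0 scale1r.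
  by have := sub_X sQ Xy IHn; rewrite scalerA -exprS -addrA -mulrSr.
have [||M [u' [Pu' u'E]]] :=
    tP y (j + (delta - tau) *+ N) (y ^+ N *: u + x *: v') Xy.
- apply: (subD sP); first exact: powP.
  by have := sub_X sP Xx Pv'; congr (P _ _); ring.
- by rewrite D1 !D2 v'E !scalerA mulrC -scalerA -scalerDr uE scaler0.
exists (N + M)%N, (u', - (y ^+ M *: v')); split.
  split=> /=; first by move: Pu'; rewrite mulrnDr addrA.
  by have := subN sP (powP P sP M _ _ Pv'); congr (P _ _); ring.
rewrite /coneD /=; congr pair; rewrite /=.
  by rewrite u'E scalerDr scalerA -exprD addnC scalerN !scalerA mulrC addrK.
by rewrite (addfN D1) opprK D2 v'E scalerA -exprD addnC.
Qed.

End ConeOf.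

Section TwoOfThree.
Variables (X : set A) (V : lmodType A) (D : V -> V).
Hypothesis dD : differential D.
Variables P P' P'' : J -> set V.
Hypothesis sP : subcomplex X D P.
Hypothesis subP : forall j, P' j `<=` P j.

(** The lemmas of this section are the uses of the long exact homology sequence
    of [P' -> P -> P / P']. *)
Lemma acyclic_big j : acyclic_rel D P P' j -> (forall i, P' i 0) ->
  acyclic D P' j -> acyclic D P j.
Proof.
move=> H P'0 H' v Pv Dv; have [D1 D2 D3] := dD.
have [|u Pu Qu] := H v Pv; first by rewrite Dv.
have [|w Pw wE] := H' _ Qu; first by rewrite (addfB D1) Dv D3 subrr.
exists (u + w); first by apply: (subD sP) => //; exact: subP.
by rewrite D1 wE addrC subrK.
Qed.

Lemma acyclic_small j : acyclic D P j -> acyclic_rel D P P' (j - delta) ->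
  acyclic D P' j.
Proof.
move=> H H' v Pv Dv; have [D1 D2 D3] := dD.
have [u Pu uE] := H v (subP Pv) Dv.
have [|w Pw wE] := H' u Pu; first by rewrite subrK uE.
by exists (u - D w) => //; rewrite (addfB D1) D3 uE subr0.
Qed.

Lemma acyclic_quotient j : acyclic D P j -> acyclic D P' (j + delta) ->
  acyclic_rel D P P' j.
Proof.
move=> H H' v Pv Qv; have [D1 D2 D3] := dD.
have [|u Pu uE] := H' _ Qv; first exact: D3.
rewrite addrK in Pu.
have [||w Pw wE] := H (v - u).
- by apply: (sub_B sP) => //; exact: subP.
- by rewrite (addfB D1) uE subrr.
by exists w => //; rewrite wE opprB addrC subrK.
Qed.

Lemma acyclic_rel_trans j : (forall i, P'' i `<=` P' i) ->
  acyclic_rel D P P' j -> acyclic_rel D P' P'' j -> acyclic_rel D P P'' j.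
Proof.
move=> sub'' H H' v Pv Qv; have [D1 D2 D3] := dD.
have [|u Pu Qu] := H v Pv; first exact: sub''.
have [|w Pw wE] := H' _ Qu; first by rewrite (addfB D1) D3 subr0.
exists (u + w); first by apply: (subD sP) => //; exact: subP.
by rewrite D1 opprD addrA.
Qed.

End TwoOfThree.

(** The Koszul complex on [s] with coefficients in a complex, as an iterated
    cone on the elements of [s]. A summand of [Kmod s V] is given by a subset of
    [s], the positions where the second component is taken; their number will
    be called the exterior degree. *)
Fixpoint Kmod (s : seq A) V : lmodType A :=
  if s is _ :: s' then ((Kmod s' V * Kmod s' V)%type : lmodType A) else V.

Fixpoint KD s V (D : V -> V) : Kmod s V -> Kmod s V :=
  if s is x :: s' return Kmod s V -> Kmod s V then coneD x (@KD s' V D) else D.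

Fixpoint KP s V (P : J -> set V) : J -> set (Kmod s V) :=
  if s is _ :: s' return J -> set (Kmod s V) then coneP (@KP s' V P) else P.

Arguments KD s {V} D w.
Arguments KP s {V} P j w.

Section KoszulOf.
Variables (X : set A) (V : lmodType A) (D : V -> V).
Hypothesis dD : differential D.
Implicit Type s : seq A.

Lemma differential_K s : differential (KD s D).
Proof. by elim: s => [|x s IH] //=; exact: differential_cone. Qed.

Lemma subcomplex_K s P : (forall x, x \in s -> X x) -> subcomplex X D P ->
  subcomplex X (KD s D) (KP s P).
Proof.
move=> + sP; elim: s => [//|x s IH] sX /=.
apply: subcomplex_cone; first by apply: sX; exact: mem_head.
by apply: IH => y ys; apply: sX; rewrite inE ys orbT.
Qed.

Lemma KP_sub s (P P' : J -> set V) :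
  (forall j, P j `<=` P' j) -> forall j, KP s P j `<=` KP s P' j.
Proof.
by move=> H; elim: s => [//|x s IH] j w [w1 w2]; split; exact: IH.
Qed.

Lemma KP_zero s (P : J -> set V) : (forall j v, P j v <-> v = 0) ->
  forall j w, KP s P j w <-> w = 0.
Proof.
move=> P0; elim: s => [//|x s IH] j [u v]; split.
  by move=> [/= /IH -> /IH ->].
by move=> [-> ->]; split; apply/IH.
Qed.

Variable U : set J.
Hypothesis Utau : forall j, U (j + tau) -> U j.

(** A cone at [j] uses exactness at [j] and at [j + tau]: hence the shift of the
    set [U] by [tau *+ size s]. *)
Lemma acyclic_rel_K s P P' : (forall x, x \in s -> X x) ->
  subcomplex X D P -> subcomplex X D P' ->
  (forall j, U j -> acyclic_rel D P P' j) ->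
  forall j, U (j + tau *+ size s) ->
    acyclic_rel (KD s D) (KP s P) (KP s P') j.
Proof.
move=> + sP sP' H; elim: s => [_ j|x s IH sX j].
  by rewrite addr0; exact: H.
have sX' y : y \in s -> X y by move=> ys; apply: sX; rewrite inE ys orbT.
rewrite /= mulrS addrA => Uj.
apply: (@acyclic_rel_cone X) => //.
- exact: differential_K.
- by apply: sX; exact: mem_head.
- exact: subcomplex_K.
- exact: subcomplex_K.
- by apply: IH => //; apply: Utau; rewrite addrAC.
- exact: IH.
Qed.

Lemma acyclic_K s P : (forall x, x \in s -> X x) -> subcomplex X D P ->
  (forall j, U j -> acyclic D P j) ->
  forall j, U (j + tau *+ size s) -> acyclic (KD s D) (KP s P) j.
Proof.
move=> sX sP H j Uj; pose Z (i : J) : set V := [set 0].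
have Z0 i v : Z i v <-> v = 0 by [].
have sZ : subcomplex X D Z.
  have [D1 D2 D3] := dD; split=> //.
  - by move=> i u v -> ->; rewrite /Z /= subr0.
  - by move=> i v ->; rewrite /Z /= (addf0 D1).
  - by move=> a i v _ ->; rewrite /Z /= scaler0.
apply/(@acyclic_rel0 _ _ _ (KP s Z) j (KP_zero Z0)).
apply: acyclic_rel_K => // i Ui.
by apply/(@acyclic_rel0 _ _ _ Z i Z0); exact: H.
Qed.

Hypothesis Ux : forall j, U j -> U (j + (delta - tau)).

Lemma tors_homology_K s P : (forall x, x \in s -> X x) -> subcomplex X D P ->
  tors_homology X D P -> tors_homology X (KD s D) (KP s P).
Proof.
move=> + sP tP; elim: s => [//|x s IH] sX /=.
have sX' y : y \in s -> X y by move=> ys; apply: sX; rewrite inE ys orbT.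
apply: tors_homology_cone; [exact: differential_K| |exact: subcomplex_K|].
  by apply: sX; exact: mem_head.
exact: IH.
Qed.

(** With [acyclic_K], this determines from its Koszul complex the degrees above
    which a complex with torsion homology is exact, the shift by
    [tau *+ size s] being the same in both directions. *)
Lemma acyclic_of_K s P : (forall x, x \in s -> X x) -> subcomplex X D P ->
  tors_homology X D P ->
  (forall j, U (j + tau *+ size s) -> acyclic (KD s D) (KP s P) j) ->
  forall j, U j -> acyclic D P j.
Proof.
move=> + sP tP; elim: s => [_ H j Uj|x s IH sX H].
  by apply: H; rewrite addr0.
have sX' y : y \in s -> X y by move=> ys; apply: sX; rewrite inE ys orbT.
apply: (IH sX') => j Uj; apply: (@acyclic_of_cone X _ _ _ x).
- exact: differential_K.
- by apply: sX; exact: mem_head.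
- exact: subcomplex_K.
- exact: tors_homology_K.
- move=> n; apply: H => /=.
  have : U (j + tau *+ size s + (delta - tau) *+ n).
    elim: n => [|n IHn]; first by rewrite addr0.
    by rewrite mulrSr addrA; exact: Ux.
  by congr U; rewrite mulrS; ring.
Qed.

End KoszulOf.

Lemma direct_sum_K s V (P : J -> set V) :
  is_direct_sum P -> is_direct_sum (KP s P).
Proof.
move=> dP; elim: s => [//|x s IH].
have fK : cancel (fun j => j + tau) (fun j => j - tau).
  by move=> j; rewrite addrK.
have gK : cancel (fun j => j - tau) (fun j => j + tau).
  by move=> j; rewrite subrK.
exact: (direct_sum_prod IH (direct_sum_reindex fK gK IH)).
Qed.

Lemma KP0 s V (P : J -> set V) : (forall j, P j 0) -> forall j, KP s P j 0.
Proof. by move=> P0; elim: s => [//|x s IH] j; split; exact: IH. Qed.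

Lemma KPB s V (P : J -> set V) :
  (forall j u v, P j u -> P j v -> P j (u - v)) ->
  forall j u v, KP s P j u -> KP s P j v -> KP s P j (u - v).
Proof.
move=> PB; elim: s => [//|x s IH] j [a b] [c e] [Pa Pb] [Pc Pe].
by split; exact: IH.
Qed.

(** Contraction with the basis vector of [y] is a homotopy between zero and
    multiplication by [y]. *)
Lemma K_homotopy s V (D : V -> V) y : differential D -> y \in s ->
  exists h : Kmod s V -> Kmod s V,
    [/\ {morph h : u v / u + v}, forall a w, h (a *: w) = a *: h w,
        forall w, KD s D (h w) + h (KD s D w) = y *: w &
        forall (X : set A) P, (forall x, x \in s -> X x) ->
          subcomplex X D P -> forall j w, KP s P j w -> KP s P (j - tau) (h w)].
Proof.
move=> dD; elim: s => [//|x s IH]; rewrite inE.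
have [K1 K2 K3] := differential_K dD s.
have [ys _|ys /orP[/eqP yx|ys']] := boolP (y \in s); last by [].
  have [h [hD hZ hh hP]] := IH ys.
  exists (fun w => (h w.1, - h w.2)); split.
  - by move=> [a b] [c e]; congr pair; rewrite /= hD // opprD.
  - by move=> a [u v]; congr pair; rewrite /= hZ // scalerN.
  - move=> [u v]; rewrite /= /coneD /=; congr pair; rewrite /=.
      by rewrite hD hZ scalerN addrACA addNr addr0 hh.
    by rewrite (addfN K1) (addfN hD) !opprK hh.
  - move=> X P sX sP j [u v] [/= Pu Pv].
    have sX' z : z \in s -> X z by move=> zs; apply: sX; rewrite inE zs orbT.
    split=> /=; first exact: (hP X P sX' sP).
    by rewrite addrAC; exact: subN (subcomplex_K sX' sP) (hP X P sX' sP _ _ Pv).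
(* in the cone of [y], the contraction moves the first summand to the second *)
exists (fun w => (0, w.1)); split.
- by move=> [a b] [c e]; congr pair; rewrite /= addr0.
- by move=> a [u v]; congr pair; rewrite /= scaler0.
- move=> [u v]; rewrite yx /= /coneD /=; congr pair; rewrite /=.
    by rewrite (addf0 K1) add0r addr0.
  by rewrite addrA addNr add0r.
- move=> X P sX sP j [u v] [/= Pu Pv].
  have sX' z : z \in s -> X z by move=> zs; apply: sX; rewrite inE zs orbT.
  have [S0 _ _ _] := subcomplex_K sX' sP.
  by split=> /=; [exact: S0|rewrite subrK].
Qed.

(** Elements of [s] thus kill Koszul homology: a cycle with coefficients in the
    ideal of [s] is a boundary. *)
Lemma K_killed (X : set A) s V (D : V -> V) P y j z : differential D ->
  subcomplex X D P -> (forall x, x \in s -> X x) -> y \in s ->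
  KP s P j z -> KD s D z = 0 ->
  exists2 u, KP s P (j - tau) u & KD s D u = y *: z.
Proof.
move=> dD sP sX ys Pz Dz; have [h [hD _ hh hP]] := K_homotopy dD ys.
exists (h z); first exact: (hP X P sX sP).
by rewrite -(hh z) Dz (addf0 hD) addr0.
Qed.

End Cones.

Arguments KD {A} s {V} D w.
Arguments KP {A J} tau s {V} P j w.

Lemma KP_reindex (A : comPzRingType) (J J' : comPzRingType) (tau : J)
    (tau' : J') (h : J -> J') s (V : lmodType A) (P : J' -> set V) :
  (forall j, h (j + tau) = h j + tau') ->
  forall j w, KP tau s (fun j => P (h j)) j w <-> KP tau' s P (h j) w.
Proof.
move=> hh; elim: s => [//|x s IH] j [u v] /=; rewrite /coneP /=.
split=> -[Pu Pv]; split; try exact/IH.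
  by rewrite -hh; exact/IH.
by apply/IH; rewrite hh.
Qed.

(** * Comparison of Koszul complexes *)

Section Transfer.
Variables (J : comPzRingType) (delta : J) (V V2 : zmodType) (pi : V -> V2).
Variables (D : V -> V) (D2 : V2 -> V2) (P P' : J -> set V) (P2 P2' : J -> set V2).
Hypothesis piD : {morph pi : u v / u + v}.
Hypothesis P2'B : forall j u v, P2' j u -> P2' j v -> P2' j (u - v).
Hypothesis pi_diff : forall j v, P j v -> P2' (j + delta) (pi (D v) - D2 (pi v)).
Hypothesis DP : forall j v, P j v -> P (j + delta) (D v).
Hypothesis PB : forall j u v, P j u -> P j v -> P j (u - v).
Hypothesis piP : forall j v, P j v -> P2 j (pi v).
Hypothesis pi_onto : forall j w, P2 j w -> exists2 v, P j v & pi v = w.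
Hypothesis piP' : forall j v, P j v -> (P2' j (pi v) <-> P' j v).

Let P2'N j v : P2' j v -> P2' j (- v).
Proof.
by move=> Qv; have := P2'B (P2'B Qv Qv) Qv; rewrite subrr sub0r.
Qed.

(** The hypotheses make [pi] an isomorphism from [P / P'] to [P2 / P2'], and a
    chain map between these quotients although not on [V] itself. *)
Lemma acyclic_rel_transfer j :
  acyclic_rel delta D P P' j <-> acyclic_rel delta D2 P2 P2' j.
Proof.
split=> H v Pv Qv.
  have [w Pw wv] := pi_onto Pv.
  have [|u Pu Qu] := H w Pw.
    apply/piP'; first exact: DP.
    have := P2'B Qv (P2'N (pi_diff Pw)).
    by rewrite opprK wv [D2 v + _]addrC subrK.
  exists (pi u); first exact: piP.
  have Qw : P2' j (pi (w - D u)).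
    by apply/piP' => //; apply: PB => //; have := DP Pu; rewrite subrK.
  have := pi_diff Pu; rewrite subrK => /P2'N /(P2'B Qw).
  by rewrite opprK (addfB piD) wv addrA subrK.
have [||u Pu Qu] := H (pi v).
- exact: piP.
- have /piP' Qpi : P (j + delta) (D v) by exact: DP.
  have := P2'B (iffRL Qpi Qv) (pi_diff Pv).
  by rewrite opprB [pi _ + _]addrC subrK.
have [w Pw wu] := pi_onto Pu.
exists w => //; apply/piP'.
  by apply: PB => //; have := DP Pw; rewrite subrK.
have := pi_diff Pw; rewrite subrK wu => /(P2'B Qu).
by rewrite (addfB piD) opprB addrA subrK.
Qed.

End Transfer.

Section KoszulMap.
Variables (A A2 : comPzRingType) (f : A -> A2).
Variables (V : lmodType A) (V2 : lmodType A2) (pi : V -> V2).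

Fixpoint Kmap s : Kmod s V -> Kmod (map f s) V2 :=
  if s is _ :: s' return Kmod s V -> Kmod (map f s) V2
  then fun w => (@Kmap s' w.1, @Kmap s' w.2) else pi.
Arguments Kmap : clear implicits.

Hypothesis piD : {morph pi : u v / u + v}.
Hypothesis piX : forall x v, pi (x *: v) = f x *: pi v.

Lemma KmapD s : {morph Kmap s : u v / u + v}.
Proof.
by elim: s => [//|x s IH] [a b] [c e] /=; congr pair; rewrite /= IH.
Qed.

Lemma KmapX s x w : Kmap s (x *: w) = f x *: Kmap s w.
Proof.
by elim: s w => [//|y s IH] [a b] /=; congr pair; rewrite /= IH.
Qed.

Section Diff.
Variables (D : V -> V) (D2 : V2 -> V2).
Hypothesis pi_diff : forall v, pi (D v) = D2 (pi v).

Lemma Kmap_diff s w : Kmap s (KD s D w) = KD (map f s) D2 (Kmap s w).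
Proof.
elim: s w => [//|x s IH] [a b] /=; congr pair; rewrite /=.
  by rewrite KmapD IH KmapX.
by rewrite (addfN (@KmapD s)) IH.
Qed.

End Diff.

Variables (J : comPzRingType) (tau delta : J).
Variables (P P' : J -> set V) (P2 P2' : J -> set V2).

Lemma Kmap_part : (forall j v, P j v -> P2 j (pi v)) ->
  forall s j w, KP tau s P j w -> KP tau (map f s) P2 j (Kmap s w).
Proof.
by move=> H; elim=> [//|x s IH] j [u v] [/= Pu Pv]; split; exact: IH.
Qed.

Lemma Kmap_onto : (forall j w, P2 j w -> exists2 v, P j v & pi v = w) ->
  forall s j w, KP tau (map f s) P2 j w ->
    exists2 v, KP tau s P j v & Kmap s v = w.
Proof.
move=> H; elim=> [//|x s IH] j [u v] [/= /IH[u' Pu <-] /IH[v' Pv <-]].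
by exists (u', v').
Qed.

Lemma Kmap_iff : (forall j v, P j v -> (P2' j (pi v) <-> P' j v)) ->
  forall s j w, KP tau s P j w ->
    (KP tau (map f s) P2' j (Kmap s w) <-> KP tau s P' j w).
Proof.
move=> H; elim=> [//|x s IH] j [u v] [/= Pu Pv].
by split=> -[/= /(IH _ _ Pu) Qu /(IH _ _ Pv) Qv].
Qed.

Lemma Kmap_diff_mod (D : V -> V) (D2 : V2 -> V2) :
  (forall j, P2' j 0) -> (forall j u v, P2' j u -> P2' j v -> P2' j (u - v)) ->
  (forall j v, P j v -> P2' (j + delta) (pi (D v) - D2 (pi v))) ->
  forall s j w, KP tau s P j w ->
    KP tau (map f s) P2' (j + delta)
      (Kmap s (KD s D w) - KD (map f s) D2 (Kmap s w)).
Proof.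
move=> P0 PB H; elim=> [//|x s IH] j [u v] [/= Pu Pv]; split=> /=.
  rewrite KmapD KmapX opprD addrACA subrr addr0; exact: IH.
rewrite (addfN (@KmapD s)) -opprD addrAC.
by rewrite -sub0r; apply: KPB => //; [exact: KP0|exact: IH].
Qed.

Variables (X : set A) (D : V -> V) (D2 : V2 -> V2) (s : seq A).
Hypothesis dD : differential D.
Hypothesis sX : forall x, x \in s -> X x.
Hypothesis sP : subcomplex tau delta X D P.
Hypothesis piP : forall j v, P j v -> P2 j (pi v).
Hypothesis pi_onto : forall j w, P2 j w -> exists2 v, P j v & pi v = w.

(** An isomorphism of quotients of coefficients, semilinear along [f], induces
    one of Koszul complexes. *)
Lemma acyclic_rel_Kmap j :
  (forall j, P2' j 0) -> (forall j u v, P2' j u -> P2' j v -> P2' j (u - v)) ->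
  (forall j v, P j v -> P2' (j + delta) (pi (D v) - D2 (pi v))) ->
  (forall j v, P j v -> (P2' j (pi v) <-> P' j v)) ->
  acyclic_rel delta (KD s D) (KP tau s P) (KP tau s P') j <->
  acyclic_rel delta (KD (map f s) D2)
    (KP tau (map f s) P2) (KP tau (map f s) P2') j.
Proof.
move=> P0 PB piD' piP'; have sK := subcomplex_K sX sP.
apply: (@acyclic_rel_transfer _ _ _ _ (Kmap s)).
- exact: KmapD.
- exact: KPB.
- exact: Kmap_diff_mod.
- exact: sub_D sK.
- exact: sub_B sK.
- exact: Kmap_part.
- exact: Kmap_onto.
- exact: Kmap_iff.
Qed.

Lemma acyclic_Kmap j : (forall v, pi (D v) = D2 (pi v)) ->
  (forall j v, P j v -> pi v = 0 -> v = 0) ->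
  acyclic delta (KD s D) (KP tau s P) j <->
  acyclic delta (KD (map f s) D2) (KP tau (map f s) P2) j.
Proof.
move=> pi_diff inj; have sK := subcomplex_K sX sP.
pose Z (V : zmodType) (i : J) : set V := [set 0].
have ZP (V' : zmodType) i (v : V') : Z V' i v <-> v = 0 by [].
rewrite -!(@acyclic_rel0 _ _ _ _ _ (Z _)) //.
apply: (@acyclic_rel_transfer _ _ _ _ (Kmap s)).
- exact: KmapD.
- by move=> i u v -> ->; exact: subr0.
- by move=> i w _; rewrite (Kmap_diff pi_diff) subrr.
- exact: sub_D sK.
- exact: sub_B sK.
- exact: Kmap_part.
- exact: Kmap_onto.
- move=> i w Pw; split; last by move=> ->; exact: addf0 (@KmapD s).
  elim: (s) i w Pw => [|y t IH] i /=; first exact: inj.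
  move=> [u v] [/= Pu Pv] [uE vE].
  by rewrite (IH _ _ Pu uE) (IH _ _ Pv vE).
Qed.

End KoszulMap.

Arguments Kmap {A A2} f {V V2} pi s w.

Section ForgetIndex.
Variables (A : comPzRingType) (V : lmodType A) (r : int).
Implicit Types (s : seq A) (P : int -> set V) (i l : int) (j : int * int).

Definition concentrated P j : set V := [set v | P j.2 v /\ (j.1 != r -> v = 0)].

Local Notation zero := (fun _ : V => 0 : V).
Local Notation tau2 := ((1, -1) : int * int).
Local Notation delta2 := ((1, 0) : int * int).

Lemma concentrated_forget s P j w :
  KP tau2 s (concentrated P) j w -> KP (-1) s P j.2 w.
Proof.
elim: s j w => [|x s IH] j; first by move=> w [].
by move=> [u v] [/= /IH Pu /IH Pv].
Qed.

(** The projection to the elements of exterior degree [r - i]: those with first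
    degree [i], since each second component adds 1 to this degree. *)
Fixpoint Kproj s i : Kmod s V -> Kmod s V :=
  if s is _ :: s' return Kmod s V -> Kmod s V
  then fun w => (@Kproj s' i w.1, @Kproj s' (i + 1) w.2)
  else fun v => if i == r then v else 0.
Arguments Kproj : clear implicits.

Lemma KprojD s i : {morph Kproj s i : u v / u + v}.
Proof.
elim: s i => [|x s IH] i; first by move=> u v /=; case: eqP; rewrite ?addr0.
by move=> [a b] [c e] /=; congr pair; rewrite /= IH.
Qed.

Lemma KprojZ s i a w : Kproj s i (a *: w) = a *: Kproj s i w.
Proof.
elim: s i w => [|x s IH] i w; first by rewrite /=; case: eqP; rewrite ?scaler0.
by case: w => u v /=; congr pair; rewrite /= IH.
Qed.

Lemma Kproj_diff s i w : KD s zero (Kproj s i w) = Kproj s (i + 1) (KD s zero w).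
Proof.
elim: s i w => [|x s IH] i w; first by rewrite /=; case: eqP.
case: w => u v /=; congr pair; rewrite /=.
  by rewrite KprojD KprojZ IH.
by rewrite (addfN (@KprojD _ _)) IH.
Qed.

Lemma Kproj_part s P : (forall l, P l 0) ->
  forall j w, KP (-1) s P j.2 w -> KP tau2 s (concentrated P) j (Kproj s j.1 w).
Proof.
move=> P0; elim: s => [|x s IH] j.
  by move=> w Pw /=; case: eqP => // jr; split=> //; rewrite jr eqxx.
by move=> [u v] [/= Pu Pv]; split=> /=; [exact: IH|exact: (IH (j + tau2))].
Qed.

Lemma Kproj_id s P j w : KP tau2 s (concentrated P) j w -> Kproj s j.1 w = w.
Proof.
elim: s j w => [|x s IH] j w.
  by move=> [_] /=; case: eqP => // _ ->.
case: w => u v [/= Pu Pv]; congr pair; first exact: IH.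
exact: (IH (j + tau2)).
Qed.

Lemma Kproj_sum s (t : seq int) : uniq t ->
  (forall k, (k <= size s)%N -> r - k%:Z \in t) ->
  forall w, \sum_(i <- t) Kproj s i w = w.
Proof.
elim: s t => [|x s IH] t ut st w /=.
  rewrite (bigD1_seq r) //=; last by have := st 0%N isT; rewrite subr0.
  by rewrite eqxx big1 ?addr0 // => i /negPf ->.
case: w => u v.
have E : \sum_(i <- t) ((Kproj s i u, Kproj s (i + 1) v) : Kmod (x :: s) V) =
    (\sum_(i <- t) Kproj s i u, \sum_(i <- t) Kproj s (i + 1) v).
  elim: (t) => [|i t' IHt]; first by rewrite !big_nil.
  by rewrite !big_cons IHt.
rewrite /= in E *; rewrite E; congr pair.
  by apply: IH => // k ks; apply: st; rewrite ltnW.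
rewrite -(big_map (fun i => i + 1) xpredT (fun i => Kproj s i v)).
apply: IH; first by rewrite map_inj_uniq //; exact: addIr.
move=> k ks; have := st k.+1 ks => kt.
by apply/mapP; exists (r - k.+1%:Z) => //; lia.
Qed.

Lemma acyclic_rel_concentrated s P P' l :
  (forall l, P l 0) -> (forall l, P' l 0) ->
  acyclic_rel 0 (KD s zero) (KP (-1) s P) (KP (-1) s P') l ->
  forall i, acyclic_rel delta2 (KD s zero)
    (KP tau2 s (concentrated P)) (KP tau2 s (concentrated P')) (i, l).
Proof.
move=> P0 P'0 H i v Pv /concentrated_forget Qv.
have [|u Pu Qu] := H v (concentrated_forget Pv); first exact: Qv.
exists (Kproj s (i - 1) u).
  exact: (Kproj_part P0 (j := (i, l) - delta2)) Pu.
rewrite Kproj_diff subrK -{1}(Kproj_id Pv) -(addfB (@KprojD _ _)).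
exact: (Kproj_part P'0 (j := (i, l))).
Qed.

(** The first degree of a Koszul element with coefficients in a single module
    is determined by its exterior degree; so a Koszul complex graded by
    internal degree only is the sum of its bigraded parts. *)
Lemma acyclic_concentrated s P l :
  (forall l, P l 0) -> (forall l u v, P l u -> P l v -> P l (u - v)) ->
  acyclic 0 (KD s zero) (KP (-1) s P) l <->
  forall i, acyclic delta2 (KD s zero) (KP tau2 s (concentrated P)) (i, l).
Proof.
move=> P0 PB; split=> [H i v Pv Dv|H v Pv Dv].
  have [u Pu uv] := H v (concentrated_forget Pv) Dv.
  exists (Kproj s (i - 1) u).
    exact: (Kproj_part P0 (j := (i, l) - delta2)) Pu.
  by rewrite Kproj_diff subrK uv; exact: Kproj_id Pv.
have K1 : {morph KD s zero : u v / u + v}.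
  have dz : differential zero.
    by split=> [u w|a w|//]; rewrite ?addr0 ?scaler0.
  by have [] := differential_K dz s.
have /choice[u uP] i : exists u, KP tau2 s (concentrated P) ((i, l) - delta2) u /\
    KD s zero u = Kproj s i v.
  have [||u Pu uv] := H i (Kproj s i v).
  - exact: (Kproj_part P0 (j := (i, l))).
  - rewrite Kproj_diff Dv; exact: addf0 (@KprojD _ _).
  by exists u.
pose t := [seq r - k%:Z | k <- iota 0 (size s).+1].
have ut : uniq t.
  by rewrite map_inj_uniq ?iota_uniq // => a b; lia.
have tP k : (k <= size s)%N -> r - k%:Z \in t.
  by move=> ks; apply/mapP; exists k => //; rewrite mem_iota.
exists (\sum_(i <- t) u i); last first.
  rewrite (addf_sum K1) -[RHS](Kproj_sum ut tP).
  by apply: eq_bigr => i _; have [_] := uP i.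
have cP i : KP (-1) s P (l - 0) (u i).
  by have [/concentrated_forget + _] := uP i.
apply: in_sum_span => [|a b Pa Pb|i _] //; first exact: KP0.
have -> : a + b = a - (0 - b) by rewrite sub0r opprK.
apply: KPB => //; by apply: KPB => //; exact: KP0.
Qed.

End ForgetIndex.

(** * Standard graded rings and injective modules *)

Section MkLinear.
Variables (A : comPzRingType) (U V : lmodType A) (f : U -> V).

(** Bundles a function whose linearity is proved in the course of a proof. *)
Definition linear_fun_of (_ : linear f) := f.

HB.instance Definition _ (fP : linear f) :=
  GRing.isLinear.Build A U V *:%R (linear_fun_of fP) fP.

Definition mk_linear (fP : linear f) : {linear U -> V} := linear_fun_of fP.

End MkLinear.

Section Homogeneous.
Variables (A : comPzRingType) (G : grading A).

Lemma scale_homogeneous (U V : lmodType A) (Q : int -> set U) (f : U -> V) :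
  is_direct_sum Q -> {morph f : u v / u + v} ->
  (forall i a l u, G i a -> Q l u -> f (a *: u) = a *: f u) ->
  forall a u, f (a *: u) = a *: f u.
Proof.
move=> dQ fD fZ a u.
have [_ _ _] := compP (gr_direct G) a.
move: (hcomp (gr_direct G) a) (supp (gr_direct G) a) (comp_part (gr_direct G) a) => c t cP -> {a}.
 rewrite !scaler_suml (addf_sum fD).
apply: eq_bigr => i _; move: (c i) (cP i) => {c cP t} a Ga.
have [_ _ _] := compP dQ u.
move: (hcomp dQ u) (supp dQ u) (comp_part dQ u) => c t cP -> {u}.
rewrite scaler_sumr !(addf_sum fD) scaler_sumr; apply: eq_bigr => l _.
exact: fZ Ga (cP l).
Qed.

Lemma gm_0 (M : grmod G) l : gm_part M l 0.
Proof. exact: part0 (gm_direct M) l. Qed.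

Lemma gm_B (M : grmod G) l u v :
  gm_part M l u -> gm_part M l v -> gm_part M l (u - v).
Proof. exact: partB (gm_direct M) l u v. Qed.

Lemma gm_D (M : grmod G) l u v :
  gm_part M l u -> gm_part M l v -> gm_part M l (u + v).
Proof. exact: partD (gm_direct M) l u v. Qed.

(** The ideal [A_{>= n}]: torsion refers to powers of the irrelevant ideal,
    which are compared with it. *)
Definition degree_ge n : set A :=
  finite_sums [set u | exists2 p, (n <= p)%N & G p u].

Lemma degree_ge_in n p a : (n <= p)%N -> G p a -> degree_ge n a.
Proof. by move=> np Ga; apply: finite_sums_in; exists p. Qed.

Lemma degree_ge_ideal n : is_ideal (degree_ge n).
Proof.
have D0 := @finite_sums0 _ [set u | exists2 p, (n <= p)%N & G p u].
have DD := @finite_sumsD _ [set u | exists2 p, (n <= p)%N & G p u].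
split=> // a b [t [tP ->]].
rewrite -(sum_comp (gr_direct G) a) mulr_suml.
apply: in_sum_span => [//|//|i _]; rewrite mulr_sumr.
apply: in_sum_span => [//|//|u /tP[p np Gu]].
apply: (@degree_ge_in n (i + p)); first exact: leq_trans (leq_addl _ _).
by apply: gr_mul => //; exact: (comp_part (gr_direct G)).
Qed.

Lemma degree_geM m n a b :
  degree_ge m a -> degree_ge n b -> degree_ge (m + n) (a * b).
Proof.
move=> [s [sP ->]] [t [tP ->]]; rewrite mulr_suml.
have [D0 DD _] := degree_ge_ideal (m + n).
apply: in_sum_span => [//|//|u /sP[p mp Gu]]; rewrite mulr_sumr.
apply: in_sum_span => [//|//|v /tP[q nq Gv]].
by apply: (@degree_ge_in _ (p + q)); [exact: leq_add|exact: gr_mul].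
Qed.

Lemma ideal_exp_degree_ge n : ideal_exp (irrelevant G) n `<=` degree_ge n.
Proof.
have irr1 : irrelevant G `<=` degree_ge 1.
  apply: ideal_gen_min (degree_ge_ideal 1) _ => a [p p0 Ga].
  exact: degree_ge_in Ga.
elim: n => [|n IH].
  move=> a _; rewrite -(sum_comp (gr_direct G) a).
  have [D0 DD _] := degree_ge_ideal 0.
  apply: in_sum_span => [//|//|i _].
  by apply: (@degree_ge_in 0 i) => //; exact: (comp_part (gr_direct G)).
apply: ideal_gen_min (degree_ge_ideal n.+1) _ => _ [a Ia [b Ib <-]].
by rewrite -add1n; apply: degree_geM; [exact: irr1|exact: IH].
Qed.

Definition lincomb (V : lmodType A) (s : seq A) (Q : set V) : set V :=
  [set v | exists t : seq (A * V),
    (forall z, z \in t -> z.1 \in s /\ Q z.2) /\ v = \sum_(z <- t) z.1 *: z.2].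

Lemma lincomb0 (V : lmodType A) s (Q : set V) : lincomb s Q 0.
Proof. by exists [::]; rewrite big_nil. Qed.

Lemma lincombD (V : lmodType A) s (Q : set V) u v :
  lincomb s Q u -> lincomb s Q v -> lincomb s Q (u + v).
Proof.
move=> [t [tP ->]] [t' [tP' ->]]; exists (t ++ t'); rewrite big_cat.
by split=> // z; rewrite mem_cat => /orP[/tP|/tP'].
Qed.

Lemma lincomb_sum (V : lmodType A) s (Q : set V) (T : eqType) (t : seq T)
    (f : T -> V) :
  (forall z, z \in t -> lincomb s Q (f z)) -> lincomb s Q (\sum_(z <- t) f z).
Proof. by apply: in_sum_span; [exact: lincomb0|exact: lincombD]. Qed.

Lemma lincomb_in (V : lmodType A) s (Q : set V) a v :
  a \in s -> Q v -> lincomb s Q (a *: v).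
Proof.
move=> sa Qv; exists [:: (a, v)]; rewrite big_seq1.
by split=> // z /[1!inE] /eqP ->.
Qed.

(** Generation of [A] by [s] as an algebra over [A_0], in the form that
    inductions on the degree use. *)
Definition generated_by (s : seq A) :=
  (forall x, x \in s -> G 1%N x) /\
  forall l a, G l.+1 a -> lincomb s (G l : set A^o) a.

Lemma part_ideal_exp s : generated_by s ->
  forall p n a, (n <= p)%N -> G p a -> ideal_exp (irrelevant G) n a.
Proof.
move=> [s1 sg]; elim=> [|p IH] [|n] a //= np Ga.
have [t [tP ->]] := sg p a Ga.
apply: ideal_sum => [|z /tP[zs Gz]]; first exact: ideal_genP.
apply: ideal_mul_in; last exact: IH np Gz.
by apply: ideal_gen_in; exists 1%N => //; exact: s1.
Qed.

End Homogeneous.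

(** The maps [phi l], given on pieces [T l] that are stable under scalars, glue
    to a homomorphism from the graded submodule with parts [T l]; injectivity
    applies to its inclusion in [N]. *)
Lemma injective_extension (A : comPzRingType) (G : grading A) (E N : grmod G)
    (T : int -> set N) (phi : int -> N -> E) :
  injective_grmod E ->
  (forall l, T l 0) -> (forall l u v, T l u -> T l v -> T l (u - v)) ->
  (forall l, T l `<=` gm_part N l) ->
  (forall i l a v, G i a -> T l v -> T (i%:Z + l) (a *: v)) ->
  (forall l u v, T l u -> T l v -> phi l (u + v) = phi l u + phi l v) ->
  (forall l v, T l v -> gm_part E l (phi l v)) ->
  (forall i l a v, G i a -> T l v -> phi (i%:Z + l) (a *: v) = a *: phi l v) ->
  exists2 g : {linear N -> E}, degree0 g & forall l v, T l v -> g v = phi l v.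
Proof.
move=> injE T0 TB TN TZ phiD phiP phiZ.
have Tind (s : seq int) (c : int -> N) : uniq s ->
    (forall l, T l (c l)) -> \sum_(l <- s) c l = 0 ->
    forall l, l \in s -> c l = 0.
  have [_ _ _ Nind] := gm_direct N => us cT.
  by apply: Nind => // l; exact: TN.
pose F := @GFamily A G N T T0 TB Tind TZ.
pose M := sum_grmod F.
pose f0 : M -> E := glue (hs_direct F) (fun l x => phi l (hs_val x)).
have psiD l x y : hs_part (P := F) l x -> hs_part l y ->
    phi l (hs_val (x + y)) = phi l (hs_val x) + phi l (hs_val y).
  by move=> Tx Ty; rewrite hs_valD phiD.
have f0D : {morph f0 : u v / u + v} by exact: glueD psiD.
have f0E l x : hs_part (P := F) l x -> f0 x = phi l (hs_val x).
  by move=> Px; exact: (glueE (hs_direct F) psiD).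
have f0Z a x : f0 (a *: x) = a *: f0 x.
  apply: (scale_homogeneous (G := G) (hs_direct F) f0D) => i {}a l {}x Ga Px.
  rewrite (f0E _ _ (hs_scale Ga Px)) (f0E _ _ Px).
  by rewrite -(phiZ _ _ _ _ Ga Px) (hs_valZ (P := F)).
have fL : linear f0 by move=> a x y; rewrite f0D f0Z.
have iL : linear (@hs_val _ _ _ F : M -> N).
  by move=> a x y; rewrite hs_valD (hs_valZ (P := F)).
have [||| g g0 gE] := @injE M N (mk_linear iL) (mk_linear fL).
- by move=> l x Px; apply: TN; exact: Px.
- by move=> l x Px; rewrite /= /linear_fun_of (f0E _ _ Px); exact: phiP.
- exact: hs_val_inj.
exists g => // l v Tv.
have hv : hsum F v := hsum_part (P := F) Tv.
have := gE (hs_elt hv); rewrite /= /linear_fun_of => ->.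
exact: f0E.
Qed.

(** * Self-duality of the Koszul complex *)

Section Pairing.
Variables (A : comPzRingType) (G : grading A).
Implicit Type s : seq A.

Local Notation zero := (fun=> 0).
Local Notation KG s := (KP (-1) s (zpart G : int -> set A^o)).

Lemma differential0 (V : lmodType A) : differential (zero : V -> V).
Proof. by split=> [u v|a v|//]; rewrite ?addr0 ?scaler0. Qed.

Lemma subcomplex_gm (M : grmod G) s : (forall x, x \in s -> G 1%N x) ->
  subcomplex (-1) (0 : int) [set x | x \in s] zero (gm_part M).
Proof.
move=> s1; split=> [j|j u v|j v _|x j v xs Pv].
- exact: gm_0.
- exact: gm_B.
- exact: gm_0.
- by have := gm_scale (s1 x xs) Pv; congr gm_part; lia.
Qed.

Lemma KP_scale (M : grmod G) s i a l w : G i a ->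
  KP (-1) s (gm_part M) l w -> KP (-1) s (gm_part M) (i%:Z + l) (a *: w).
Proof.
move=> Ga; elim: s l w => [|x s IH] l w; first exact: gm_scale.
by case: w => u v [Pu Pv]; split; [exact: IH|rewrite -addrA; exact: IH].
Qed.

(** The sign [(-1)^i] in exterior degree [i]; it anticommutes with the Koszul
    differential. *)
Fixpoint Keps s (V : lmodType A) : Kmod s V -> Kmod s V :=
  if s is _ :: s' return Kmod s V -> Kmod s V
  then fun w => (@Keps s' V w.1, - @Keps s' V w.2) else id.
Arguments Keps s {V} w.

Section Sign.
Variable V : lmodType A.

Lemma KepsD s : {morph @Keps s V : u v / u + v}.
Proof.
elim: s => [//|x s IH] [a b] [c e] /=; congr pair; rewrite /= IH //.
by rewrite opprD.
Qed.

Lemma KepsZ s a (w : Kmod s V) : Keps s (a *: w) = a *: Keps s w.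
Proof.
elim: s w => [//|x s IH] [b c] /=; congr pair; rewrite /= IH //.
by rewrite scalerN.
Qed.

Lemma KepsK s (w : Kmod s V) : Keps s (Keps s w) = w.
Proof.
elim: s w => [//|x s IH] [b c] /=; congr pair; rewrite /= ?IH //.
by rewrite (addfN (@KepsD s)) IH opprK.
Qed.

Lemma Keps_diff s (w : Kmod s V) : Keps s (KD s zero w) = - KD s zero (Keps s w).
Proof.
elim: s w => [|x s IH] w; first by rewrite /= oppr0.
case: w => u v /=; congr pair; rewrite /=.
  by rewrite KepsD KepsZ IH scalerN opprD opprK.
have [K1 _ _] := differential_K (differential0 V) s.
by rewrite (addfN (@KepsD s)) IH (addfN K1) !opprK.
Qed.

Lemma Keps_part s (P : int -> set V) : (forall l v, P l v -> P l (- v)) ->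
  forall l w, KP (-1) s P l w -> KP (-1) s P l (Keps s w).
Proof.
move=> PN.
have KN t l w : KP (-1) t P l w -> KP (-1) t P l (- w).
  elim: t l w => [|x t IH] l w; first exact: PN.
  by case: w => u v [Pu Pv]; split; exact: IH.
elim: s => [//|x s IH] l [u v] [/= Pu Pv]; split=> /=; first exact: IH.
by apply: KN; exact: IH.
Qed.

End Sign.

Lemma KG0 s l : KG s l 0.
Proof. apply: KP0; exact: part0 (zpartP (gr_direct G)). Qed.

Lemma KGB s l u v : KG s l u -> KG s l v -> KG s l (u - v).
Proof. apply: KPB => p a b; exact: partB (zpartP (gr_direct G)) p a b. Qed.

Lemma KGD s l u v : KG s l u -> KG s l v -> KG s l (u + v).
Proof.
move=> Pu Pv; have -> : u + v = u - (0 - v) by rewrite sub0r opprK.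
by apply: KGB => //; apply: KGB => //; exact: KG0.
Qed.

Lemma Keps_partG s l w : KG s l w -> KG s l (Keps s w).
Proof. apply: Keps_part => p a; exact: partN (zpartP (gr_direct G)) p a. Qed.

(** Complementary subsets of [s] pair to [E], so that the Koszul complex with
    coefficients in [E] becomes the dual of the one of the ring with values in
    [E]. The signs [Keps] make the differential self-adjoint, and not only up to
    sign ([Kpair_adjoint]). *)
Fixpoint Kpair s (E : lmodType A) : Kmod s E -> Kmod s A^o -> E :=
  if s is _ :: s' return Kmod s E -> Kmod s A^o -> E
  then fun z w => @Kpair s' E z.1 (Keps s' w.2) + @Kpair s' E z.2 (Keps s' w.1)
  else fun v a => (a : A) *: v.
Arguments Kpair s {E} z w.

Section PairTheory.
Variable E : grmod G.
Implicit Types (l p : int).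

Local Notation KE s := (KP (-1) s (gm_part E)).

Lemma KpairDl s w : {morph (fun z : Kmod s E => Kpair s z w) : y z / y + z}.
Proof.
elim: s w => [|x s IH] w; first by move=> y z /=; rewrite scalerDr.
by case: w => a b [y1 y2] [z1 z2] /=; rewrite !IH addrACA.
Qed.

Lemma KpairDr s z : {morph @Kpair s E z : y w / y + w}.
Proof.
elim: s z => [|x s IH] z; first by move=> a b /=; rewrite scalerDl.
by case: z => a b [y1 y2] [z1 z2] /=; rewrite !KepsD !IH addrACA.
Qed.

Lemma KpairZl s a (z : Kmod s E) w : Kpair s (a *: z) w = a *: Kpair s z w.
Proof.
elim: s z w => [|x s IH] z w; first by rewrite /= !scalerA mulrC.
by case: z w => b c [u v] /=; rewrite !IH scalerDr.
Qed.

Lemma KpairZr s a (z : Kmod s E) w : Kpair s z (a *: w) = a *: Kpair s z w.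
Proof.
elim: s z w => [|x s IH] z w; first by rewrite /= scalerA.
by case: z w => b c [u v] /=; rewrite !KepsZ !IH scalerDr.
Qed.

Lemma Kpair_adjoint s (z : Kmod s E) w :
  Kpair s (KD s zero z) w = Kpair s z (KD s zero w).
Proof.
elim: s z w => [|x s IH] z w; first by rewrite /= scaler0 scale0r.
case: z w => z1 z2 [w1 w2] /=.
rewrite KpairDl KpairZl (addfN (KpairDl _)) !IH.
rewrite (addfN (@KepsD _ s)) (addfN (KpairDr z1)) KepsD KepsZ !Keps_diff.
rewrite KpairDr !(addfN (KpairDr _)) KpairZr opprK.
by rewrite -addrA [in LHS](addrC (x *: _)).
Qed.

Lemma Kpair_part s (z : Kmod s E) w l p : KE s l z -> KG s p w ->
  gm_part E (l + p - (size s)%:Z) (Kpair s z w).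
Proof.
elim: s z w l p => [|x s IH] z w l p.
  move=> /= Pz; case: p => [p|p] /= Gw; last first.
    by rewrite Gw scale0r; exact: gm_0.
  by have := gm_scale Gw Pz; congr gm_part; lia.
case: z w => z1 z2 [w1 w2] [/= Pz1 Pz2] [/= Pw1 Pw2].
have E1 := IH _ _ _ _ Pz1 (Keps_partG Pw2).
have E2 := IH _ _ _ _ Pz2 (Keps_partG Pw1).
apply: gm_D.
  by move: E1; congr gm_part; lia.
by move: E2; congr gm_part; lia.
Qed.

Lemma Kpair_nondegenerate s (z : Kmod s E) :
  (forall p w, KG s p w -> Kpair s z w = 0) -> z = 0.
Proof.
elim: s z => [|x s IH] z H.
  by have /= := H 0 1 (gr_one G); rewrite scale1r.
case: z H => z1 z2 H; congr pair; apply: IH => p w Pw.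
  have := H (p + 1) (0, Keps s w); rewrite /= KepsK (addf0 (@KepsD _ s)).
  rewrite (addf0 (KpairDr z2)) addr0; apply; split=> /=; first exact: KG0.
  by rewrite addrK; exact: Keps_partG.
have := H p (Keps s w, 0); rewrite /= KepsK (addf0 (@KepsD _ s)).
rewrite (addf0 (KpairDr z1)) add0r; apply; split=> /=; last exact: KG0.
exact: Keps_partG.
Qed.

(** The Koszul complex of the ring is free: a functional is determined by its
    restrictions to the two summands of a cone, and each of them is represented
    by induction. *)
Lemma Kpair_onto s (f : Kmod s A^o -> E) l :
  {morph f : u v / u + v} -> (forall a w, f (a *: w) = a *: f w) ->
  (forall p w, KG s p w -> gm_part E (l + p - (size s)%:Z) (f w)) ->
  exists2 z, KE s l z & forall w, f w = Kpair s z w.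
Proof.
elim: s f l => [|x s IH] f l fD fZ fP.
  exists (f 1); first by have := fP 0 1 (gr_one G); congr gm_part; rewrite /=; lia.
  by move=> w; rewrite /= -fZ; congr f; rewrite /GRing.scale /= mulr1.
have [|||z1 Pz1 E1] := IH (fun w => f (0, Keps s w)) l.
- move=> u v; rewrite -fD KepsD; congr f.
  by congr pair; rewrite /= addr0.
- move=> a w; rewrite -fZ KepsZ; congr f.
  by congr pair; rewrite /= scaler0.
- move=> p w Pw; have := fP (p + 1) (0, Keps s w).
  have -> : l + (p + 1) - (size (x :: s))%:Z = l + p - (size s)%:Z.
    by rewrite /=; lia.
  apply; split=> /=; first exact: KG0.
  by rewrite addrK; exact: Keps_partG.
have [|||z2 Pz2 E2] := IH (fun w => f (Keps s w, 0)) (l - 1).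
- move=> u v; rewrite -fD KepsD; congr f.
  by congr pair; rewrite /= addr0.
- move=> a w; rewrite -fZ KepsZ; congr f.
  by congr pair; rewrite /= scaler0.
- move=> p w Pw; have := fP p (Keps s w, 0).
  have -> : l + p - (size (x :: s))%:Z = l - 1 + p - (size s)%:Z.
    by rewrite /=; lia.
  apply; split=> /=; last exact: KG0.
  exact: Keps_partG.
exists (z1, z2); first by split.
move=> [u v] /=; rewrite -E1 -E2 !KepsK addrC -fD; congr f.
by congr pair; rewrite /= ?addr0 ?add0r.
Qed.

Variable s0 : seq A.
Hypothesis gen : generated_by G s0.

Definition torsion_part l : set E := [set v | gm_part E l v /\ torsion v].

Lemma torsionP (v : E) : torsion v <->
  exists n, forall (p : nat) a, (n <= p)%N -> G p a -> a *: v = 0.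
Proof.
split=> -[n H].
  exists n => p a np Ga; apply: H; exact: part_ideal_exp gen _ _ _ np Ga.
exists n => a /ideal_exp_degree_ge[t [tP ->]].
rewrite scaler_suml big_seq big1 // => u /tP[p np Gu]; exact: H Gu.
Qed.

(** Torsion of the coefficients of [z] can be seen on the functional that [z]
    defines: it vanishes on elements of high degree. *)
Lemma torsion_of_Kpair s (z : Kmod s E) l N : KE s l z ->
  (forall p w, N <= p -> KG s p w -> Kpair s z w = 0) ->
  KP (-1) s torsion_part l z.
Proof.
elim: s z l => [|x s IH] z l.
  move=> Pz H; split=> //; apply/torsionP; exists `|N|%N => p a np Ga.
  by apply: (H p%:Z) => //; lia.
case: z => z1 z2 [/= Pz1 Pz2] H; split=> /=; apply: IH => // p w Np Pw.
  have := H (p + 1) (0, Keps s w); rewrite /= KepsK (addf0 (@KepsD _ s)).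
  rewrite (addf0 (KpairDr z2)) addr0; apply; first by lia.
  split=> /=; first exact: KG0.
  by rewrite addrK; exact: Keps_partG.
have := H p (Keps s w, 0); rewrite /= KepsK (addf0 (@KepsD _ s)).
rewrite (addf0 (KpairDr z1)) add0r; apply=> //; split=> /=; last exact: KG0.
exact: Keps_partG.
Qed.

Lemma Kpair_torsion s (z : Kmod s E) l : KP (-1) s torsion_part l z ->
  exists N : int, forall p w, N <= p -> KG s p w -> Kpair s z w = 0.
Proof.
elim: s z l => [|x s IH] z l.
  move=> [_ /torsionP[n H]]; exists n%:Z => -[p|p] w /= Np //.
  by move=> Gw; apply: H Gw; lia.
case: z => z1 z2 [/= /IH[N1 H1] /IH[N2 H2]].
exists (Num.max (N1 + 1) N2) => p [w1 w2]; rewrite ge_max => /andP[p1 p2].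
move=> [/= Pw1 Pw2].
rewrite (H1 _ _ _ (Keps_partG Pw2)); last by lia.
by rewrite (H2 _ _ _ (Keps_partG Pw1)) ?addr0.
Qed.

Variable s : seq A.
Hypothesis s1 : forall x, x \in s -> G 1%N x.
Hypothesis injE : injective_grmod E.
Variable b0 : int.
Hypothesis bA : forall p, b0 <= p -> acyclic 0 (KD s zero) (KG s) p.

Lemma Kshift_direct c : is_direct_sum (fun e => KG s (e - c)).
Proof.
have fK : cancel (fun e => e - c) (fun e => e + c) by move=> e; rewrite subrK.
have gK : cancel (fun e => e + c) (fun e => e - c) by move=> e; rewrite addrK.
apply: (direct_sum_reindex fK gK); apply: direct_sum_K.
exact: zpartP (gr_direct G).
Qed.

Lemma Kshift_scale c i l a (w : Kmod s A^o) :
  G i a -> KG s (l - c) w -> KG s (i%:Z + l - c) (a *: w).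
Proof. by move=> Ga Pw; rewrite -addrA; exact: (KP_scale (M := self_grmod G)). Qed.

(** The shift makes functionals of any degree into homomorphisms of degree 0. *)
Definition Kshift c : grmod G := GrMod (Kshift_direct c) (@Kshift_scale c).

(** By duality, to extend a homomorphism from a graded submodule of the Koszul
    complex of the ring to [E] is to find an element of the Koszul complex with
    coefficients in [E]. *)
Lemma Kpair_extension l (T : int -> set (Kmod s A^o))
    (phi : int -> Kmod s A^o -> E) :
  (forall p, T p 0) -> (forall p u v, T p u -> T p v -> T p (u - v)) ->
  (forall p, T p `<=` KG s p) ->
  (forall i p a v, G i a -> T p v -> T (i%:Z + p) (a *: v)) ->
  (forall p u v, T p u -> T p v -> phi p (u + v) = phi p u + phi p v) ->
  (forall p v, T p v -> gm_part E (l + p - (size s)%:Z) (phi p v)) ->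
  (forall i p a v, G i a -> T p v -> phi (i%:Z + p) (a *: v) = a *: phi p v) ->
  exists2 z, KE s l z & forall p w, T p w -> Kpair s z w = phi p w.
Proof.
move=> T0 TB TK TZ phiD phiP phiZ; pose c := l - (size s)%:Z.
have [|||||||g g0 gE] := @injective_extension A G E (Kshift c)
  (fun e => T (e - c)) (fun e => phi (e - c)) injE.
- by move=> e; exact: T0.
- by move=> e u v; exact: TB.
- by move=> e w; exact: TK.
- by move=> i e a v Ga Tv; rewrite -addrA; exact: TZ.
- by move=> e u v; exact: phiD.
- by move=> e v /phiP; congr gm_part; rewrite /c; lia.
- by move=> i e a v Ga Tv; rewrite -addrA; exact: phiZ.
have [|||z Pz zE] := @Kpair_onto s g l.
- by move=> u v; exact: (raddfD g).
- by move=> a w; exact: (linearZZ g).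
- move=> p w Pw; have := g0 (p + c) w; rewrite /= addrK => /(_ Pw).
  by congr gm_part; rewrite /c; lia.
exists z => // p w Tw; rewrite -zE.
by have := gE (p + c) w; rewrite addrK; apply.
Qed.

(** For injective [E], the quotient of the Koszul complexes of [E] and of its
    torsion is exact. Let [D z] be torsion. As a functional, [z] vanishes on
    boundaries of high degree, which are all the cycles of high degree. The
    restriction of [z] to cycles of degree less than [N] thus extends by zero
    to the elements of degree at least [N], and then to some [w], which is
    torsion. Now [z - w] vanishes on cycles; it factors through the
    differential, and injectivity gives [u] with [z - w = D u]. *)
Lemma injective_Koszul_torsion l :
  acyclic_rel 0 (KD s zero) (KE s) (KP (-1) s torsion_part) l.
Proof.
move=> z Pz; rewrite addr0 => /Kpair_torsion[N1 H1].
pose N := Num.max N1 b0.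
have [K1 K2 K3] := differential_K (differential0 A^o) s.
have kill p w : N <= p -> KG s p w -> KD s zero w = 0 -> Kpair s z w = 0.
  rewrite ge_max => /andP[p1 p0] Pw Dw.
  have [u Pu <-] := bA p0 Pw Dw.
  by rewrite -Kpair_adjoint; apply: (H1 p); rewrite // -(subr0 p).
(* [w] equals [z] on cycles of degree less than [N], and 0 from degree [N] on *)
have [|||||||w Pw wE] := @Kpair_extension l
  (fun p => [set v | KG s p v /\ (p < N -> KD s zero v = 0)])
  (fun p v => if p < N then Kpair s z v else 0).
- by move=> p; split; [exact: KG0|rewrite (addf0 K1)].
- move=> p u v [Pu Du] [Pv Dv]; split; first exact: KGB.
  by move=> pN; rewrite (addfB K1) Du // Dv // subr0.
- by move=> p v [].
- move=> i p a v Ga [Pv Dv]; split.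
    exact: (KP_scale (M := self_grmod G)).
  by move=> ipN; rewrite K2 Dv ?scaler0 //; lia.
- by move=> p u v _ _; case: ifP => _; rewrite ?addr0 ?KpairDr.
- by move=> p v [Pv _]; case: ifP => _; [exact: Kpair_part|exact: gm_0].
- move=> i p a v Ga [Pv Dv]; case: ifP => ipN; case: ifP => pN.
  + by rewrite KpairZr.
  + by lia.
  + rewrite -KpairZr; apply/esym/(@kill (i%:Z + p)); first by lia.
      exact: (KP_scale (M := self_grmod G)).
    by rewrite K2 Dv ?scaler0.
  + by rewrite scaler0.
have Tw : KP (-1) s torsion_part l w.
  apply: (@torsion_of_Kpair s w l N) => // p v Np Pv.
  have := wE p v; rewrite ltNge Np /=; apply; split=> //.
have zw p v : KG s p v -> KD s zero v = 0 -> Kpair s (z - w) v = 0.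
  move=> Pv Dv; rewrite (addfB (KpairDl v)) (wE p) //.
  case: ltP => [_|Np]; first by rewrite subrr.
  by rewrite subr0; exact: (kill p).
(* the functional on boundaries through which [z - w] factors *)
pose psi p v := if pselect (exists2 u, KG s p u & KD s zero u = v) is left H
  then Kpair s (z - w) (sval (cid2 H)) else 0.
have psiE p u : KG s p u -> psi p (KD s zero u) = Kpair s (z - w) u.
  move=> Pu; rewrite /psi; case: pselect => [H|[]]; last by exists u.
  case: (cid2 H) => u' /= Pu' E'; apply/eqP.
  rewrite -subr_eq0 -(addfB (KpairDr (z - w))); apply/eqP/(zw p).
    exact: KGB.
  by rewrite (addfB K1) E' subrr.
have [|||||||u Pu uE] := @Kpair_extension l
  (fun p => [set v | exists2 u, KG s p u & KD s zero u = v]) psi.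
- by move=> p; exists 0; [exact: KG0|rewrite (addf0 K1)].
- move=> p _ _ [u Pu <-] [v Pv <-]; exists (u - v); first exact: KGB.
  by rewrite (addfB K1).
- move=> p _ [u Pu <-].
  have := sub_D (subcomplex_K (s := s) (D := zero) (fun x xs => xs)
    (subcomplex_gm (self_grmod G) s1)) Pu.
  by rewrite addr0.
- move=> i p a _ Ga [u Pu <-]; exists (a *: u); last by rewrite K2.
  exact: (KP_scale (M := self_grmod G)).
- move=> p _ _ [u Pu <-] [v Pv <-]; rewrite -K1 !psiE ?KpairDr //.
  exact: KGD.
- move=> p _ [u Pu <-]; rewrite psiE //; apply: Kpair_part => //.
  apply: KPB => //; exact: gm_B.
- move=> i p a _ Ga [u Pu <-]; rewrite -K2 !psiE ?KpairZr //.
  exact: (KP_scale (M := self_grmod G)).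
exists u => //.
suff -> : z - KD s zero u = w by [].
apply/eqP; rewrite subr_eq addrC -subr_eq -subr_eq0; apply/eqP.
apply: Kpair_nondegenerate => p v Pv.
rewrite (addfB (KpairDl v)) Kpair_adjoint (uE p) ?psiE ?subrr //.
by exists v.
Qed.

End PairTheory.
End Pairing.

(** * Local cohomology and Koszul homology *)

Section DependentProduct.
Variables (A : comPzRingType) (X : nat -> lmodType A).

(** The product holds all terms of a resolution in one module, as [Kmod] asks
    for; only its elements with one nonzero entry will matter. *)
Definition dprod := forall j, X j.

HB.instance Definition _ := gen_eqMixin dprod.
HB.instance Definition _ := gen_choiceMixin dprod.

Definition dprod_add (u v : dprod) : dprod := fun j => u j + v j.
Definition dprod_opp (u : dprod) : dprod := fun j => - u j.
Definition dprod_zero : dprod := fun j => 0.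
Definition dprod_scale (a : A) (u : dprod) : dprod := fun j => a *: u j.

Lemma dprod_eq (u v : dprod) : (forall j, u j = v j) -> u = v.
Proof. exact: functional_extensionality_dep. Qed.

Lemma dprod_addA : associative dprod_add.
Proof. by move=> u v w; apply: dprod_eq => j; exact: addrA. Qed.

Lemma dprod_addC : commutative dprod_add.
Proof. by move=> u v; apply: dprod_eq => j; exact: addrC. Qed.

Lemma dprod_add0 : left_id dprod_zero dprod_add.
Proof. by move=> u; apply: dprod_eq => j; exact: add0r. Qed.

Lemma dprod_addN : left_inverse dprod_zero dprod_opp dprod_add.
Proof. by move=> u; apply: dprod_eq => j; exact: addNr. Qed.

HB.instance Definition _ :=
  GRing.isZmodule.Build dprod dprod_addA dprod_addC dprod_add0 dprod_addN.

Lemma dprod_scaleA a b (u : dprod) :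
  dprod_scale a (dprod_scale b u) = dprod_scale (a * b) u.
Proof. by apply: dprod_eq => j; exact: scalerA. Qed.

Lemma dprod_scale1 : left_id 1 dprod_scale.
Proof. by move=> u; apply: dprod_eq => j; exact: scale1r. Qed.

Lemma dprod_scaleDr : right_distributive dprod_scale +%R.
Proof. by move=> a u v; apply: dprod_eq => j; exact: scalerDr. Qed.

Lemma dprod_scaleDl (u : dprod) : {morph dprod_scale^~ u : a b / a + b}.
Proof. by move=> a b; apply: dprod_eq => j; exact: scalerDl. Qed.

HB.instance Definition _ := GRing.Zmodule_isLmodule.Build A dprod
  dprod_scaleA dprod_scale1 dprod_scaleDr dprod_scaleDl.

End DependentProduct.

Section LocalCohomologyKoszul.
Variables (A : comPzRingType) (G : grading A).
Variable s : seq A.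
Hypothesis gen : generated_by G s.
Variable b0 : int.
Hypothesis bA : forall p, b0 <= p ->
  acyclic 0 (KD s (fun=> 0)) (KP (-1) s (zpart G : int -> set A^o)) p.

Variables (M : grmod G) (E : injective_resolution M).

Local Notation tau2 := ((1, -1) : int * int).
Local Notation delta2 := ((1, 0) : int * int).
Local Notation Xs := [set x | x \in s].

(** The augmented resolution [0 -> M -> E^0 -> E^1 -> ...]: position 0 is that
    of [M], and [E^i] has position [i + 1]. *)
Definition aug (j : nat) : grmod G := if j is i.+1 then ir_mod E i else M.

Definition aug_d (j : nat) : {linear aug j -> aug j.+1} :=
  match j return {linear aug j -> aug j.+1} with
  | 0 => ir_aug E
  | i.+1 => ir_d E i
  end.

Lemma aug_d_degree0 j : degree0 (aug_d j).
Proof. by case: j => [|j]; [exact: ir_aug_degree0|exact: ir_d_degree0]. Qed.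

Lemma aug_exact j v : aug_d j.+1 v = 0 <-> exists u, aug_d j u = v.
Proof. by case: j v => [|j] v; [exact: ir_exact0|exact: ir_exact]. Qed.

Definition augW : lmodType A := dprod (fun j => aug j : lmodType A).

Definition augD (v : augW) : augW :=
  fun j => match j return aug j with 0 => 0 | i.+1 => aug_d i (v i) end.

Lemma differential_aug : differential augD.
Proof.
split.
- move=> u v; apply: dprod_eq => -[|j]; first exact: esym (addr0 (0 : aug 0%N)).
  exact: (raddfD (aug_d j)).
- move=> a u; apply: dprod_eq => -[|j]; first exact: esym (scaler0 (aug 0%N) a).
  exact: (linearZZ (aug_d j)).
- move=> v; apply: dprod_eq => -[//|[|j]] /=; first exact: (raddf0 (aug_d 0%N)).
  by apply/aug_exact; exists (v j).
Qed.

(** Bidegree [(j, l)]: only the entry at position [j] can be nonzero, it has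
    degree [l] and lies in [S j]. *)
Definition aug_part (S : forall j, set (aug j)) (e : int * int) : set augW :=
  [set v | forall j, [/\ gm_part (aug j) e.2 (v j), S j (v j) &
                         j%:Z != e.1 -> v j = 0]].

Definition stable (S : forall j, set (aug j)) :=
  [/\ forall j, S j 0, forall j u v, S j u -> S j v -> S j (u - v),
      forall j a v, S j v -> S j (a *: v) &
      forall j v, S j v -> S j.+1 (aug_d j v)].

Lemma subcomplex_aug S : stable S ->
  subcomplex tau2 delta2 Xs augD (aug_part S).
Proof.
move=> [S0 SB SZ Sd]; split.
- by move=> e j; split=> //; exact: gm_0.
- move=> e u v Pu Pv j; have [Pu1 Pu2 Pu3] := Pu j.
  have [Pv1 Pv2 Pv3] := Pv j; split; [exact: gm_B|exact: SB|].
  move=> je; rewrite -[LHS]/(u j - v j) Pu3 // Pv3 //; exact: subr0.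
- move=> e v Pv [|j] /=; first by split=> //; exact: gm_0.
  have [Pv1 Pv2 Pv3] := Pv j; split.
  + by rewrite addr0; exact: aug_d_degree0.
  + exact: Sd.
  + by move=> je; rewrite Pv3 ?(raddf0 (aug_d j)) //; apply: contra je; lia.
- move=> x e v xs Pv j; have [Pv1 Pv2 Pv3] := Pv j; split.
  + have := gm_scale (gen.1 x xs) Pv1; congr gm_part => /=; lia.
  + exact: SZ.
  + move=> je; rewrite -[LHS]/(x *: v j) Pv3 ?scaler0 //.
    by move: je; rewrite /= subrr addr0.
Qed.

Lemma stable_torsion (N : grmod G) :
  [/\ torsion (0 : N), forall u v : N, torsion u -> torsion v -> torsion (u - v) &
      forall a (v : N), torsion v -> torsion (a *: v)].
Proof.
split.
- by exists 0%N => a _; rewrite scaler0.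
- move=> u v /(torsionP gen)[m Hm] /(torsionP gen)[n Hn].
  apply/(torsionP gen); exists (maxn m n) => p a; rewrite geq_max.
  by move=> /andP[mp np] Ga; rewrite scalerBr (Hm p) // (Hn p) // subr0.
- move=> a v [n H]; exists n => b Hb; rewrite scalerA mulrC -scalerA.
  by rewrite H // scaler0.
Qed.

Lemma torsion_linear (N N' : grmod G) (f : {linear N -> N'}) v :
  torsion v -> torsion (f v).
Proof.
by move=> [n H]; exists n => a Ha; rewrite -linearZ_LR H //; exact: raddf0.
Qed.

Definition all_part (j : nat) : set (aug j) := setT.

(** [M] is dropped, and [E^i] is replaced by its torsion if [b i] holds. For the
    conditions [i < r] this is a filtration by subcomplexes from the resolution
    to its torsion, with quotients [E^r] modulo torsion, one at a time. *)
Definition tors_on (b : pred nat) (j : nat) : set (aug j) :=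
  if j is i.+1 then (if b i then torsion (M := aug i.+1) else setT)
  else [set 0].

Local Notation tors_all := (tors_on xpredT).
Local Notation tors_upto r := (tors_on (fun i => i < r)%N).

Arguments all_part : clear implicits.
Arguments tors_on : clear implicits.

Lemma stable_all : stable all_part. Proof. by []. Qed.

Lemma stable_tors_on (b : pred nat) : (forall i, b i.+1 -> b i) -> stable (tors_on b).
Proof.
move=> bS; have T i := stable_torsion (aug i.+1); split.
- by case=> [//|j] /=; case: ifP => // _; case: (T j).
- case=> [|j] u v /=; first by move=> -> ->; exact: subr0.
  by case: ifP => // _; case: (T j) => _ H _; exact: H.
- case=> [|j] a v /=; first by move=> ->; exact: scaler0.
  by case: ifP => // _; case: (T j) => _ _; exact.
- case=> [|j] v /=.
    by move=> ->; case: ifP => // _; rewrite (raddf0 (aug_d 0%N)); case: (T 0%N).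
  case: ifP => jr; case: ifP => // jr'; first exact: torsion_linear.
  by rewrite (bS _ jr') in jr.
Qed.

Lemma stable_tors_upto r : stable (tors_upto r).
Proof. by apply: stable_tors_on => i /ltnW. Qed.

Lemma stable_tors_all : stable tors_all.
Proof. exact: stable_tors_on. Qed.

Definition single r (m : aug r) : augW :=
  dfwith (fun j => 0 : (fun j => aug j : Type) j) m.
Arguments single : clear implicits.

Lemma single_eq r m : single r m r = m.
Proof. exact: dfwith_in. Qed.

Lemma single_neq r m j : r != j -> single r m j = 0.
Proof. exact: dfwith_out. Qed.

Lemma single_part S r m l : stable S -> gm_part (aug r) l m -> S r m ->
  aug_part S (r%:Z, l) (single r m).
Proof.
move=> [S0 _ _ _] Pm Sm j; have [<-|rj] := eqVneq r j.
  by rewrite single_eq; split=> //; rewrite eqxx.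
by rewrite single_neq //; split=> //; exact: gm_0.
Qed.

Lemma aug_part_single S e v r : aug_part S e v -> e.1 = r%:Z ->
  v = single r (v r).
Proof.
move=> Pv er; apply: dprod_eq => j; have [<-|rj] := eqVneq r j.
  by rewrite single_eq.
rewrite single_neq //; have [_ _ ->//] := Pv j.
by rewrite er eq_sym; apply: contra rj; lia.
Qed.

Lemma aug_part_neg S e v : aug_part S e v -> e.1 < 0 -> v = 0.
Proof.
move=> Pv e0; apply: dprod_eq => j; have [_ _ ->//] := Pv j.
by apply/eqP; lia.
Qed.

Lemma augD_single r m : augD (single r m) = single r.+1 (aug_d r m).
Proof.
apply: dprod_eq => -[|j] /=; first by rewrite single_neq.
have [<-|rj] := eqVneq r j; first by rewrite !single_eq.
by rewrite !single_neq ?(raddf0 (aug_d j)).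
Qed.

Lemma acyclic_aug e : acyclic delta2 augD (aug_part all_part) e.
Proof.
case: e => i l v Pv Dv.
have [i0|i0] := ltP i 0.
  by exists 0; rewrite ?(aug_part_neg Pv) //;
    [exact: (sub_0 (subcomplex_aug stable_all))|
     have [D1 _ _] := differential_aug; exact: addf0].
case: i i0 Pv => // r _ Pv.
have vr := aug_part_single (r := r) Pv erefl.
have : aug_d r (v r) = 0.
  have := congr1 (fun w : augW => w r.+1) Dv.
  by [].
have [Pvr _ _] := Pv r.
case: r Pv vr Pvr => [|r] Pv vr Pvr dv.
  have v0 : v 0%N = 0.
    by apply: (@ir_aug_inj _ _ _ E); rewrite [LHS]dv raddf0.
  have -> : v = 0.
    by rewrite vr v0; apply: dprod_eq => -[|j]; rewrite ?single_eq ?single_neq.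
  exists 0; first exact: (sub_0 (subcomplex_aug stable_all)).
  by have [D1 _ _] := differential_aug; exact: addf0.
have [u uv] := (@aug_exact r (v r.+1)).1 dv.
(* exactness is that of modules; a preimage has to be made homogeneous *)
pose u' := hcomp (gm_direct (aug r)) u l.
have u'v : aug_d r u' = v r.+1.
  have := @comp_morph _ _ _ _ _ _ (gm_direct (aug r)) (gm_direct (aug r.+1))
    (aug_d r) id (raddfD _) (fun _ _ => id) (@aug_d_degree0 r) u l.
  by rewrite uv /u' => <-; exact: comp_eq.
exists (single r u'); last by rewrite augD_single u'v.
have -> : (r.+1%:Z, l) - delta2 = (r%:Z, l).
  by congr pair; rewrite /= ?subr0 //; lia.
apply: single_part => //; exact: comp_part.
Qed.

Lemma acyclic_K_aug e :
  acyclic delta2 (KD s augD) (KP tau2 s (aug_part all_part)) e.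
Proof.
apply: (@acyclic_K _ _ tau2 _ Xs _ _ differential_aug setT) => //.
- exact: subcomplex_aug stable_all.
- by move=> e' _; exact: acyclic_aug.
Qed.

Local Notation KW := (KP tau2 s (aug_part all_part)).
Local Notation KQ r := (KP tau2 s (aug_part (tors_upto r))).
Local Notation KT := (KP tau2 s (aug_part tors_all)).

Lemma aug_partS S S' : (forall j, S j `<=` S' j) ->
  forall e, aug_part S e `<=` aug_part S' e.
Proof. by move=> H e v Pv j; have [? ? ?] := Pv j; split=> //; exact: H. Qed.

Lemma tors_all_upto r j : tors_all j `<=` tors_upto r j.
Proof. by case: j => [//|j] v /=; case: ifP. Qed.

Lemma tors_uptoS r j : tors_upto r.+1 j `<=` tors_upto r j.
Proof.
case: j => [//|j] v /=; case: ifP => jr; case: ifP => jr' //.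
by move: jr jr'; lia.
Qed.

Definition at_position (S : forall j, set (aug j)) r (l : int) : set (aug r) :=
  [set v | gm_part (aug r) l v /\ S r v].

Arguments at_position : clear implicits.

(** If two subcomplexes differ at the position [r] only, their quotient is a
    module at this position, without differential. *)
Lemma acyclic_rel_position S S' r e : stable S -> stable S' ->
  (forall j, S' j `<=` S j) -> (forall j, r != j -> S j `<=` S' j) ->
  acyclic_rel delta2 (KD s augD) (KP tau2 s (aug_part S))
    (KP tau2 s (aug_part S')) e <->
  acyclic_rel delta2 (KD s (fun=> 0))
    (KP tau2 s (concentrated r%:Z (at_position S r)))
    (KP tau2 s (concentrated r%:Z (at_position S' r))) e.
Proof.
move=> sS sS' S'S SS'; have [S'0 S'B _ S'd] := sS'.
rewrite -[X in acyclic_rel _ (KD X (fun=> 0)) (KP _ X _) (KP _ X _)]map_id.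
apply: (@acyclic_rel_Kmap A A id augW (aug r) (fun v => v r) _ _
  (int * int)%type tau2 delta2 _ _ _ _ Xs) => //.
- exact: subcomplex_aug sS.
- move=> j v Pv; have [P1 P2 P3] := Pv r; split=> // j0; apply: P3.
  by rewrite eq_sym.
- move=> [i l] m [/= [Pm Sm] m0]; have [ir|ir] := eqVneq i r%:Z.
    by rewrite ir; exists (single r m); [exact: single_part|exact: single_eq].
  by exists 0; [exact: (sub_0 (subcomplex_aug sS))|rewrite m0].
- by move=> j; split=> //; split; [exact: gm_0|].
- move=> j u v [[Pu Su] u0] [[Pv Sv] v0]; split.
    by split; [exact: gm_B|exact: S'B].
  by move=> j0; rewrite u0 // v0 // subr0.
- move=> j v Pv; rewrite subr0.
  have [Q1 _ Q3] := sub_D (subcomplex_aug sS) Pv r.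
  split; last by rewrite eq_sym.
  split=> //=; case: (r) SS' => [//|i] SS'; apply: S'd.
  by apply: SS'; [rewrite gtn_eqF|have [] := Pv i].
- move=> j v Pv; split.
    move=> [[_ Sv] _] i; have [P1 P2 P3] := Pv i; split=> //.
    by have [ri|/SS'] := eqVneq r i; [subst i|exact].
  by move=> Qv; have [Q1 Q2 Q3] := Qv r; split=> // ?; apply: Q3; rewrite eq_sym.
Qed.

Lemma acyclic_rel_top i l :
  acyclic_rel delta2 (KD s augD) KW (KQ 0%N) (i, l) <->
  acyclic delta2 (KD s (fun=> 0))
    (KP tau2 s (concentrated 0 (gm_part M))) (i, l).
Proof.
apply: (iff_trans (@acyclic_rel_position _ _ 0%N (i, l) stable_all
  (stable_tors_upto 0) _ _)) => //; first by case.
have -> : at_position all_part 0 = gm_part M.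
  by apply: funext => l'; apply/seteqP; split=> v // [].
apply: acyclic_rel0; apply: KP_zero => e v; split; first by move=> [[_ ->]].
by move=> ->; split=> //; split=> //; exact: gm_0.
Qed.

(** The quotient is [E^r] modulo torsion. *)
Lemma acyclic_rel_step r e :
  acyclic_rel delta2 (KD s augD) (KQ r) (KQ r.+1) e.
Proof.
apply: (iffRL (@acyclic_rel_position _ _ r.+1 e (stable_tors_upto r)
  (stable_tors_upto r.+1) (@tors_uptoS r) _)).
  move=> [|j] rj v //=; case: ifP => jr; case: ifP => jr' //.
  by move: rj jr jr'; lia.
have -> : at_position (tors_upto r) r.+1 = gm_part (aug r.+1).
  apply: funext => l; rewrite /at_position /= ltnn.
  by apply/seteqP; split=> v // [].
have -> : at_position (tors_upto r.+1) r.+1 = @torsion_part A G (aug r.+1).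
  by apply: funext => l; rewrite /at_position /= ltnSn.
case: e => i l; have [T0 _ _] := stable_torsion (aug r.+1).
apply: acyclic_rel_concentrated => [l'|l'|]; try exact: gm_0.
  by split; [exact: gm_0|].
apply: (injective_Koszul_torsion gen gen.1 _ bA); exact: ir_injective.
Qed.

Lemma acyclic_rel_upto r e : acyclic_rel delta2 (KD s augD) (KQ 0%N) (KQ r) e.
Proof.
have [D1 D2 D3] := differential_K differential_aug s.
have sK r' := subcomplex_K (fun x xs => xs)
  (subcomplex_aug (stable_tors_upto r')).
elim: r => [|r IH].
  move=> v Pv Qv; exists 0; first exact: (sub_0 (sK 0%N)).
  by rewrite (addf0 D1) subr0.
have subQ r' : forall e, KQ r' e `<=` KQ 0%N e.
  by apply: KP_sub; apply: aug_partS => -[|j] v.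
apply: (acyclic_rel_trans (differential_K differential_aug s) (sK 0%N)
  (subQ r) _ IH (@acyclic_rel_step r e)).
by apply: KP_sub; apply: aug_partS; exact: tors_uptoS.
Qed.

(** In a given bidegree only finitely many [E^i] occur, so that the filtration
    reaches its end after finitely many steps. *)
Lemma KP_stable_range r t e w : e.1 + (size t)%:Z <= r%:Z ->
  KP tau2 t (aug_part (tors_upto r)) e w -> KP tau2 t (aug_part tors_all) e w.
Proof.
elim: t e w => [|x t IH] e w er.
  move=> Pw j; have [P1 P2 P3] := Pw j; split=> //.
  case: j P1 P2 P3 => [//|j] P1 P2 P3 /=.
  have [jr|jr] := ltnP j r; first by move: P2; rewrite /= jr.
  rewrite P3; first by case: (stable_torsion (aug j.+1)).
  by apply/eqP; move: er => /=; lia.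
case: w => u v [/= Pu Pv]; split; apply: IH => //.
  by move: er => /=; lia.
by case: e er {Pu Pv} => i l /=; lia.
Qed.

Lemma acyclic_rel_torsion e : acyclic_rel delta2 (KD s augD) (KQ 0%N) KT e.
Proof.
move=> v Pv Qv.
have [|u Pu Qu] := @acyclic_rel_upto (absz (e.1 + (size s)%:Z)) e v Pv.
  by move: Qv; apply: KP_sub; apply: aug_partS; exact: tors_all_upto.
by exists u => //; apply: KP_stable_range Qu; exact: lez_abs.
Qed.

Lemma tors_homology_aug : tors_homology tau2 delta2 Xs augD (aug_part tors_all).
Proof.
move=> x [i l] v xs Pv _.
have [D1 D2 D3] := differential_aug.
have Z := sub_0 (subcomplex_aug stable_tors_all).
suff [N xv] : exists N, x ^+ N *: v = 0.
  by exists N, 0; split; [exact: Z|rewrite xv (addf0 D1)].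
have [i0|i0] := ltP i 0.
  by exists 0%N; rewrite (aug_part_neg Pv) // scaler0.
case: i i0 Pv => // r _ Pv.
have vr := aug_part_single (r := r) Pv erefl.
have [_ Tv _] := Pv r.
have [N vN] : exists N, x ^+ N *: v r = 0.
  case: r v Pv vr Tv => [|r] v Pv vr /=.
    by move=> ->; exists 0%N; rewrite scaler0.
  move=> [N H]; exists N; apply: H; elim: N => [//|N IHN].
  rewrite exprS; apply: ideal_mul_in IHN.
  by apply: ideal_gen_in; exists 1%N => //; exact: gen.1.
exists N; apply: dprod_eq => j.
rewrite -[LHS]/(x ^+ N *: v j) -[RHS]/(0 : aug j).
have [<-//|rj] := eqVneq r j.
have [_ _ ->] := Pv j; first exact: scaler0.
by rewrite /= eq_sym; apply: contra rj; lia.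
Qed.

(** The torsion of the resolution computes local cohomology; [H^i] is found at
    position [i + 1], and the term at position 0 vanishes. *)
Lemma cocyclesP l :
  (forall i, acyclic delta2 augD (aug_part tors_all) (i, l)) <->
  (forall i, cocycles (E := E) (i := i) l `<=` coboundaries (E := E) (i := i) l).
Proof.
have [D1 D2 D3] := differential_aug.
have sT := subcomplex_aug stable_tors_all.
split=> H.
  move=> i v [Pv Tv dv].
  have [||u Pu uv] := H i.+1%:Z (single i.+1 v).
  - exact: (@single_part tors_all i.+1 v l stable_tors_all Pv Tv).
  - rewrite augD_single -[aug_d _ _]/(ir_d E i v) dv.
    apply: dprod_eq => j; have [<-|ij] := eqVneq i.+2 j.
      exact: (@single_eq i.+2 0).
    exact: (@single_neq i.+2 0).
  have := congr1 (fun w : augW => w i.+1) uv; rewrite /= (@single_eq i.+1 v).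
  have [Pui Tui _] := Pu i; move: Pui Tui; rewrite /= subr0.
  case: i v Pv Tv dv H u Pu uv => [|i] v _ _ _ _ u _ _ /=.
    by move=> _ -> <-; exact: (raddf0 (ir_aug E)).
  by move=> Pui Tui uv; exists (u i.+1).
move=> i v Pv Dv.
have [v0|v0] := eqVneq v 0.
  by exists 0; [exact: (sub_0 sT)|rewrite v0 (addf0 D1)].
have [i0|i0] := ltP i 0.
  by rewrite (aug_part_neg Pv) ?eqxx in v0.
case: i i0 Pv => // r _ Pv.
have vr := aug_part_single (r := r) Pv erefl.
have [Pvr Tvr _] := Pv r.
have dv : aug_d r (v r) = 0 by exact: (congr1 (fun w : augW => w r.+1) Dv).
have single0 j : single j 0 = 0.
  apply: dprod_eq => j'; have [<-|ij] := eqVneq j j'.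
    exact: (@single_eq j 0).
  exact: (@single_neq j 0).
case: r vr Pv Pvr Tvr dv => [|j] vr Pv Pvr Tvr dv.
  by move: v0; rewrite vr Tvr single0 eqxx.
have := H j (v j.+1) (And3 Pvr Tvr dv).
case: j vr Pv Pvr Tvr dv => [|j] vr Pv Pvr Tvr dv.
  by move=> vj; move: v0; rewrite vr vj single0 eqxx.
move=> [u [Pu Tu] uv].
exists (single j.+1 u); last by rewrite augD_single [RHS]vr -uv.
have -> : (j.+2%:Z, l) - delta2 = (j.+1%:Z, l).
  by congr pair; rewrite /= ?subr0 //; lia.
exact: (@single_part tors_all j.+1 u l stable_tors_all Pu Tu).
Qed.

(** Let [E] be the resolution, [T] its torsion, and [K] denote Koszul complexes.
    As the augmented resolution is exact, [K(M)] and [K(E)] have the same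
    homology up to the index; [K(T)] and [K(E)] have the same homology, by
    [injective_Koszul_torsion]. Finally [T], whose homology is the local
    cohomology of [M], is torsion: its exactness above degree [a] and that of
    [K(T)] above degree [a + size s] are equivalent, by [acyclic_K] and
    [acyclic_of_K]. *)
Theorem local_cohomology_Koszul (a : int) :
  (forall l, a < l -> forall i,
     cocycles (E := E) (i := i) l `<=` coboundaries (E := E) (i := i) l) <->
  (forall l, a + (size s)%:Z < l ->
     acyclic 0 (KD s (fun=> 0)) (KP (-1) s (gm_part M)) l).
Proof.
have dA := differential_aug; have dK := differential_K dA s.
have sX x : x \in s -> Xs x by [].
have sW := subcomplex_aug stable_all.
have sQ := subcomplex_aug (stable_tors_upto 0).
have sT := subcomplex_aug stable_tors_all.
have sKW := subcomplex_K sX sW; have sKQ := subcomplex_K sX sQ.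
have sKT := subcomplex_K sX sT.
have subQW e : KQ 0%N e `<=` KW e by apply: KP_sub; exact: aug_partS.
have subTQ e : KT e `<=` KQ 0%N e.
  by apply: KP_sub; apply: aug_partS; exact: tors_all_upto.
(* from [K(M)] to [K(E)] *)
have step1 l : acyclic 0 (KD s (fun=> 0)) (KP (-1) s (gm_part M)) l <->
    forall i, acyclic delta2 (KD s augD) (KQ 0%N) (i, l).
  rewrite (acyclic_concentrated 0) => [||l' u v]; try exact: gm_B.
    split=> H i.
      apply: (acyclic_small dK subQW); first exact: acyclic_K_aug.
      have -> : (i, l) - delta2 = (i - 1, l) by congr pair; rewrite /= subr0.
      exact/acyclic_rel_top.
    apply/acyclic_rel_top.
    apply: (acyclic_quotient dK sKW subQW); first exact: acyclic_K_aug.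
    have -> : (i, l) + delta2 = (i + 1, l) by congr pair; rewrite /= addr0.
    exact: H.
  exact: gm_0.
(* from [K(E)] to [K(T)] *)
have step2 l : (forall i, acyclic delta2 (KD s augD) (KQ 0%N) (i, l)) <->
    forall i, acyclic delta2 (KD s augD) KT (i, l).
  split=> H i.
    apply: (acyclic_small dK subTQ); first exact: H.
    exact: acyclic_rel_torsion.
  apply: (acyclic_big dK sKQ subTQ); [exact: acyclic_rel_torsion| |exact: H].
  exact: (sub_0 sKT).
have tauE n : tau2 *+ n = (n%:Z, - n%:Z).
  elim: n => [|n IH]; first by congr pair; rewrite oppr0.
  by rewrite mulrS IH -[LHS]/(1 + n%:Z, -1 - n%:Z); congr pair; lia.
pose U := [set e : int * int | a < e.2].
have Utau e : U (e + tau2) -> U e by rewrite /U /=; lia.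
have Ux e : U e -> U (e + (delta2 - tau2)).
  by rewrite /U /=; lia.
split=> H l al.
  apply/step1/step2 => i; apply: (acyclic_K dA Utau sX sT).
    by move=> [i' l'] /H /cocyclesP; exact.
  by rewrite tauE /U /= /=; lia.
apply/cocyclesP => i.
apply: (acyclic_of_K dA Ux sX sT tors_homology_aug (U := U)) => //.
move=> [i' l']; rewrite tauE /U /= => l'a.
by move: i'; apply/step2/step1/H; lia.
Qed.

End LocalCohomologyKoszul.

(** * Injective resolutions over a graded algebra over a field *)

Section FieldLinear.
Variables (A : comPzRingType) (kappa : subring A).
Hypothesis kappa_field :
  forall c, kappa c -> c = 0 \/ exists2 c', kappa c' & c' * c = 1.

Definition klinear (U V : lmodType A) (f : U -> V) :=
  {morph f : u v / u + v} /\ forall c v, kappa c -> f (c *: v) = c *: f v.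

Section Extension.
Variables (U V : lmodType A) (S : set U) (Y : set V) (phi : U -> V).
Hypothesis kS : submodule kappa S.
Hypothesis phiY : forall u, S u -> Y (phi u).
Hypothesis phiD : forall u v, S u -> S v -> phi (u + v) = phi u + phi v.
Hypothesis phiZ : forall c u, kappa c -> S u -> phi (c *: u) = c *: phi u.

Definition graph0 : set (U * V) := [set w | S w.1 /\ w.2 = phi w.1].

(** Extensions of [phi] are represented by their graphs, for which the union of
    a chain is a union of sets. *)
Definition partial_map (g : set (U * V)) :=
  [/\ submodule kappa (g : set (U * V)%type), forall v, g (0, v) -> v = 0,
      forall w, g w -> Y w.2 & graph0 `<=` g].

Lemma partial_map0 : partial_map graph0.
Proof.
have [S0 SD SZ] := kS.
have phi0 : phi 0 = 0.
  by apply: (@addrI _ (phi 0)); rewrite -phiD // !addr0.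
split=> //.
- split.
  + by split; rewrite ?phi0.
  + move=> [u v] [u' v'] [/= Su ->] [/= Su' ->]; split=> /=; first exact: SD.
    by rewrite phiD.
  + by move=> c [u v] kc [/= Su ->]; split=> /=; [exact: SZ|rewrite phiZ].
- by move=> v [/= _ ->].
- by move=> [u v] [/= Su ->]; exact: phiY.
Qed.

Lemma partial_map_bigcup (F : set (set (U * V))) :
  (forall g, F g -> partial_map (g `|` graph0)) -> total_on F subset ->
  partial_map ((\bigcup_(g in F) g) `|` graph0).
Proof.
move=> FP Ft.
have cover2 w w' : ((\bigcup_(g in F) g) `|` graph0) w ->
    ((\bigcup_(g in F) g) `|` graph0) w' -> exists g,
    [/\ partial_map g, g w, g w' & g `<=` (\bigcup_(g in F) g) `|` graph0].
  have sub g : F g -> g `|` graph0 `<=` (\bigcup_(g in F) g) `|` graph0.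
    by move=> Fg x [gx|x0]; [left; exists g|right].
  move=> [[g Fg gw]|w0] [[g' Fg' gw']|w0'].
  - have [gg'|g'g] := Ft _ _ Fg Fg'.
      exists (g' `|` graph0); split; [exact: FP| | |exact: sub].
        by left; exact: gg'.
      by left.
    exists (g `|` graph0); split; [exact: FP| | |exact: sub].
      by left.
    by left; exact: g'g.
  - exists (g `|` graph0); split; [exact: FP| | |exact: sub].
      by left.
    by right.
  - exists (g' `|` graph0); split; [exact: FP| | |exact: sub].
      by right.
    by left.
  - by exists graph0; split=> //; exact: partial_map0.
split.
- split.
  + by right; have [[]] := partial_map0.
  + move=> u v Hu Hv; have [g [[[_ gD _] _ _ _] gu gv sub]] := cover2 _ _ Hu Hv.
    by apply: sub; exact: gD.
  + move=> c v kc Hv; have [g [[[_ _ gZ] _ _ _] gv _ sub]] := cover2 _ _ Hv Hv.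
    by apply: sub; exact: gZ.
- by move=> v Hv; have [g [[_ g0 _ _] gv _ _]] := cover2 _ _ Hv Hv; exact: g0.
- by move=> w Hw; have [g [[_ _ gY _] gv _ _]] := cover2 _ _ Hw Hw; exact: gY.
- by move=> w w0; right.
Qed.

(** By Zorn's lemma there is a maximal extension of [phi] with values in [Y]. A
    vector [u0] outside its domain could be sent to 0: the enlarged graph is
    still that of a function, because the coefficient of [u0] is invertible
    unless it is zero. *)
Lemma klinear_extension : exists psi : U -> V,
  [/\ klinear psi, forall u, S u -> psi u = phi u & forall u, Y (psi u)].
Proof.
(* the union with [graph0] takes care of the empty chain *)
have [|g0 [gP gmax]] :=
    @Zorn_bigcup _ (fun g : set (U * V) => partial_map (g `|` graph0)).
  by move=> F FP Ft; apply: partial_map_bigcup.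
set g := g0 `|` graph0 in gP.
have [[gz gD gZ] gfun gY g0S] := gP.
have tot u0 : exists v, g (u0, v).
  apply: contrapT => nu0.
  pose h : set (U * V) := [set w | exists u c,
    [/\ g (u, w.2), kappa c & w.1 = u + c *: u0]].
  have gh : g `<=` h.
    move=> [u v] guv; exists u, 0; split=> //=; first exact: sr0.
    by rewrite scale0r addr0.
  have hP : partial_map h.
    split.
    - split.
      + exact: gh.
      + move=> [u v] [u' v'] [/= a [c [ga kc ->]]] [/= a' [c' [ga' kc' ->]]].
        exists (a + a'), (c + c'); split=> /=; first exact: gD ga ga'.
          exact: srD.
        by rewrite scalerDl addrACA.
      + move=> c [u v] kc [/= a [e [ga ke ->]]].
        exists (c *: a), (c * e); split=> /=; first exact: gZ kc ga.
          exact: sr_mul.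
        by rewrite scalerDr scalerA.
    - move=> v [/= u [c [gu kc]]] /eqP; rewrite eq_sym addr_eq0 => /eqP uE.
      have [c0|[c' kc' c'c]] := kappa_field kc.
        by apply: gfun; move: gu; rewrite uE c0 scale0r oppr0.
      case: nu0; exists (- c' *: v).
      have gu' : g (- c' *: u, - c' *: v) := gZ (- c') (u, v) (srN kc') gu.
      rewrite (_ : u0 = - c' *: u) //.
      by rewrite uE scaleNr scalerN opprK scalerA c'c scale1r.
    - by move=> [u v] [/= a [c [/gY]]].
    - by move=> w w0; apply: gh; exact: g0S.
  have hE : h `|` graph0 = h.
    apply/seteqP; split=> w; last by left.
    by move=> [//|w0]; apply: gh; exact: g0S.
  apply: (gmax h); last by rewrite hE.
  split; first by move=> w gw; apply: gh; left.
  move=> hg0; apply: nu0; exists 0; left; apply: hg0.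
  exists 0, 1; split=> //=; first exact: sr_one.
  by rewrite add0r scale1r.
have [psi psiP] := choice tot.
have uniq_g u v v' : g (u, v) -> g (u, v') -> v = v'.
  move=> guv /(gZ (-1)) guv'; apply/eqP; rewrite -subr_eq0; apply/eqP.
  apply: gfun; have := gD _ _ guv (guv' (srN (sr_one _))).
  rewrite -[_ + _]/((u + -1 *: u, v + -1 *: v') : U * V).
  by rewrite !scaleN1r subrr.
exists psi; split.
- split; first by move=> u v; apply: (uniq_g (u + v)) => //; exact: (gD (_, _) (_, _)).
  by move=> c v kc; apply: (uniq_g (c *: v)) => //; exact: (gZ c (_, _)).
- by move=> u Su; apply: (uniq_g u) => //; apply: g0S.
- by move=> u; have := gY _ (psiP u).
Qed.

End Extension.

(** A projection onto [S] is an extension of the identity of [S] with values in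
    [S]. *)
Lemma klinear_kernel (V : lmodType A) (S : set V) : submodule kappa S ->
  exists2 pi : V -> V, klinear pi & forall v, pi v = 0 <-> S v.
Proof.
move=> kS; have [||||f [[fD fZ] fS fY]] := @klinear_extension V V S S id => //.
exists (fun v => v - f v).
  split=> [u v|c v kc]; first by rewrite fD opprD addrACA.
  by rewrite fZ // scalerBr.
move=> v; split=> [/eqP|Sv]; last by rewrite fS // subrr.
by rewrite subr_eq0 => /eqP ->.
Qed.

Section Coinduced.
Variable V : lmodType A.

(** The coinduced module of [kappa]-linear maps from [A] to [V^Z]. Homomorphisms
    to its graded part correspond to families of linear maps to [V], one for
    each degree, through evaluation at 1; so they extend if linear maps do. *)
Record coind := Coind {
  cv : A -> int -> V;
  cvD : forall b b' t, cv (b + b') t = cv b t + cv b' t;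
  cvZ : forall c b t, kappa c -> cv (c * b) t = c *: cv b t }.

HB.instance Definition _ := gen_eqMixin coind.
HB.instance Definition _ := gen_choiceMixin coind.

Lemma coind_eq (u v : coind) : (forall b t, cv u b t = cv v b t) -> u = v.
Proof.
case: u v => [u uD uZ] [v vD vZ] /= E.
have uv : u = v by apply: funext => b; apply: funext => t; exact: E.
by subst v; rewrite (Prop_irrelevance uD vD) (Prop_irrelevance uZ vZ).
Qed.

Definition coind_zero : coind.
Proof.
by exists (fun _ _ => 0) => *; rewrite ?addr0 ?scaler0.
Defined.

Definition coind_add (u v : coind) : coind.
Proof.
exists (fun b t => cv u b t + cv v b t).
- by move=> b b' t; rewrite !cvD addrACA.
- by move=> c b t kc; rewrite !cvZ // scalerDr.
Defined.

Definition coind_opp (u : coind) : coind.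
Proof.
exists (fun b t => - cv u b t).
- by move=> b b' t; rewrite cvD opprD.
- by move=> c b t kc; rewrite cvZ // scalerN.
Defined.

Definition coind_scale (a : A) (u : coind) : coind.
Proof.
exists (fun b t => cv u (a * b) t).
- by move=> b b' t; rewrite mulrDr cvD.
- by move=> c b t kc; rewrite [a * _]mulrCA; exact: cvZ.
Defined.

Lemma coind_addA : associative coind_add.
Proof. by move=> u v w; apply: coind_eq => b t; exact: addrA. Qed.

Lemma coind_addC : commutative coind_add.
Proof. by move=> u v; apply: coind_eq => b t; exact: addrC. Qed.

Lemma coind_add0 : left_id coind_zero coind_add.
Proof. by move=> u; apply: coind_eq => b t; exact: add0r. Qed.

Lemma coind_addN : left_inverse coind_zero coind_opp coind_add.
Proof. by move=> u; apply: coind_eq => b t; exact: addNr. Qed.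

HB.instance Definition _ :=
  GRing.isZmodule.Build coind coind_addA coind_addC coind_add0 coind_addN.

Lemma coind_scaleA a b (u : coind) :
  coind_scale a (coind_scale b u) = coind_scale (a * b) u.
Proof. by apply: coind_eq => c t /=; rewrite mulrA [b * a]mulrC. Qed.

Lemma coind_scale1 : left_id 1 coind_scale.
Proof. by move=> u; apply: coind_eq => b t /=; rewrite mul1r. Qed.

Lemma coind_scaleDr : right_distributive coind_scale +%R.
Proof. by move=> a u v; apply: coind_eq. Qed.

Lemma coind_scaleDl (u : coind) : {morph coind_scale^~ u : a b / a + b}.
Proof. by move=> a b; apply: coind_eq => c t /=; rewrite mulrDl cvD. Qed.

HB.instance Definition _ := GRing.Zmodule_isLmodule.Build A coind
  coind_scaleA coind_scale1 coind_scaleDr coind_scaleDl.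

Variable G : grading A.
Hypothesis kappaG : forall c, kappa c -> G 0%N c.

(** Maps of degree [l], the copy of [V] at [t] having degree [t]. *)
Definition coind_part (l : int) : set coind :=
  [set u | forall j b, G j b -> forall t, t != l + j%:Z -> cv u b t = 0].

Lemma cv_addD b t : {morph (fun u => cv u b t) : u v / u + v}.
Proof. by []. Qed.

Lemma coind_part0 l : coind_part l 0.
Proof. by []. Qed.

Lemma coind_partB l u v : coind_part l u -> coind_part l v ->
  coind_part l (u - v).
Proof.
move=> Pu Pv j b Gb t tl; rewrite (addfB (cv_addD b t)).
by rewrite (Pu j) // (Pv j) // subr0.
Qed.

Lemma coind_ind (s : seq int) (c : int -> coind) : uniq s ->
  (forall l, coind_part l (c l)) -> \sum_(l <- s) c l = 0 ->
  forall l, l \in s -> c l = 0.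
Proof.
move=> us cP s0 l ls; apply: coind_eq => b t.
have cvDb u : {morph (fun b => cv u b t) : b b' / b + b'}.
  by move=> b1 b2; exact: cvD.
rewrite -(sum_comp (gr_direct G) b) (addf_sum (cvDb _)) big1 // => j _.
move: (hcomp _ b j) (comp_part (gr_direct G) b j) => {}b Gb.
have [tl|tl] := eqVneq t (l + j%:Z); last exact: cP Gb _ tl.
have := congr1 (fun u => cv u b t) s0.
rewrite (addf_sum (cv_addD b t)) (bigD1_seq l) //= big1 ?addr0 // => i il.
by apply: (cP i j b Gb); rewrite tl; apply: contra il; lia.
Qed.

Lemma coind_part_scale i l a u : G i a -> coind_part l u ->
  coind_part (i%:Z + l) (a *: u).
Proof.
move=> Ga Pu j b Gb t tl; apply: (Pu (i + j)%N); first exact: gr_mul.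
by apply: contra tl; lia.
Qed.

Definition coind_family : gfamily G coind :=
  GFamily coind_part0 coind_partB coind_ind coind_part_scale.

Definition coind_grmod : grmod G := sum_grmod coind_family.

Section ToCoinduced.
Variables (N : grmod G) (psi : int -> N -> V).
Hypothesis psiK : forall t, klinear (psi t).

Lemma comp_kscale (w : N) c t : kappa c ->
  hcomp (gm_direct N) (c *: w) t = c *: hcomp (gm_direct N) w t.
Proof.
move=> /kappaG Gc.
apply: (@comp_morph _ _ _ _ _ _ (gm_direct N) (gm_direct N) ( *:%R c) id) => //.
  by move=> u v; rewrite scalerDr.
by move=> l u Pu; have := gm_scale Gc Pu; rewrite add0r.
Qed.

Definition to_coind0 (w : N) : coind.
Proof.
exists (fun b t => psi t (hcomp (gm_direct N) (b *: w) t)).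
- move=> b b' t; rewrite scalerDl (compD (gm_direct N)).
  by have [+ _] := psiK t; exact.
- move=> c b t kc; rewrite -scalerA comp_kscale //.
  by have [_ +] := psiK t; exact.
Defined.

Lemma to_coind0D : {morph to_coind0 : u v / u + v}.
Proof.
move=> u v; apply: coind_eq => b t; rewrite /= scalerDr (compD (gm_direct N)).
by have [+ _] := psiK t; exact.
Qed.

Lemma to_coind0Z a w : to_coind0 (a *: w) = a *: to_coind0 w.
Proof.
by apply: coind_eq => b t /=; rewrite scalerA mulrC.
Qed.

Lemma to_coind0_part l w : gm_part N l w -> coind_part l (to_coind0 w).
Proof.
move=> Pw j b Gb t tl /=.
rewrite (comp_neq (gm_direct N) (gm_scale Gb Pw)); last by rewrite addrC.
by have [+ _] := psiK t; exact: addf0.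
Qed.

Lemma to_coind0_hsum w : hsum coind_family (to_coind0 w).
Proof.
rewrite -(sum_comp (gm_direct N) w) (addf_sum to_coind0D).
apply: in_sum_span => [||l _]; [exact: hsum0|exact: hsumD|].
by apply: (hsum_part (P := coind_family) (l := l)); apply: to_coind0_part;
  exact: comp_part.
Qed.

Lemma to_coind : exists2 f : {linear N -> coind_grmod}, degree0 f &
  forall w b t, cv (hs_val (f w)) b t = psi t (hcomp (gm_direct N) (b *: w) t).
Proof.
pose f w : coind_grmod := hs_elt (to_coind0_hsum w).
have fL : linear f.
  move=> a u v; apply: (hs_val_inj (P := coind_family)).
  rewrite hs_valD (hs_valZ (P := coind_family)) /=.
  by rewrite to_coind0D to_coind0Z.
exists (mk_linear fL) => // l w Pw; exact: to_coind0_part.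
Qed.

End ToCoinduced.

(** The linear maps [ev t] of [f] are extended from the image of the part of
    degree [t] to all of [N']; the extensions define a homomorphism. *)
Lemma coind_injective : injective_grmod coind_grmod.
Proof.
move=> N N' i f i0 f0 iinj.
pose ev t (v : N) : V := cv (hs_val (f v)) 1 t.
have evD t : {morph ev t : u v / u + v}.
  move=> u v; rewrite /ev (raddfD f).
  by rewrite (hs_valD (P := coind_family)).
have evK c t v : kappa c -> ev t (c *: v) = c *: ev t v.
  move=> kc; rewrite /ev (linearZZ f) (hs_valZ (P := coind_family)) /=.
  by rewrite cvZ.
have ext t : exists psi : N' -> V,
    klinear psi /\ forall v, gm_part N t v -> psi (i v) = ev t v.
  pose S : set N' := [set i v | v in gm_part N t].
  have kS : submodule kappa S.
    split.
    - by exists 0; [exact: gm_0|exact: (raddf0 i)].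
    - move=> _ _ [u Pu <-] [v Pv <-]; exists (u + v); first exact: gm_D.
      exact: (raddfD i).
    - move=> c _ kc [v Pv <-]; exists (c *: v); last exact: (linearZZ i).
      by have := gm_scale (kappaG kc) Pv; rewrite add0r.
  pose phi (w : N') : V :=
    if pselect (exists v, i v = w) is left H then ev t (sval (cid H)) else 0.
  have phiE v : phi (i v) = ev t v.
    rewrite /phi; case: pselect => [H|[]]; last by exists v.
    by case: (cid H) => v' /= /iinj ->.
  have [|||psi [kpsi psiS _]] := @klinear_extension N' V S setT phi kS => //.
  - by move=> _ _ [u _ <-] [v _ <-]; rewrite -(raddfD i) !phiE evD.
  - by move=> c _ kc [u _ <-]; rewrite -(linearZZ i) !phiE evK.
  by exists psi; split=> // v Pv; rewrite psiS ?phiE //; exists v.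
have [psi psiP] := choice ext.
have [g g0 gE] := @to_coind N' psi (fun t => (psiP t).1).
exists g => // v; apply: (hs_val_inj (P := coind_family)).
apply: coind_eq => b t; rewrite gE -(linearZZ i).
have := @comp_morph _ _ _ _ _ _ (gm_direct N) (gm_direct N') i id
  (raddfD i) (fun _ _ => id) i0 (b *: v) t.
rewrite /= => ->; rewrite (psiP t).2; last exact: comp_part.
have -> : cv (hs_val (f v)) b t = ev t (b *: v).
  by rewrite /ev (linearZZ f) (hs_valZ (P := coind_family)) /= mulr1.
rewrite -[in RHS](sum_comp (gm_direct N) (b *: v)) (addf_sum (evD t)).
move: (b *: v) => {v}w; have [_ us c0 _] := compP (gm_direct N) w.
have ev0 l : l != t -> ev t (hcomp (gm_direct N) w l) = 0.
  move=> lt; apply: (f0 l _ (comp_part _ _ _) 0%N 1 (gr_one G)).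
  by rewrite addr0 eq_sym.
have [tw|/c0 tw] := boolP (t \in supp (gm_direct N) w).
  by rewrite (bigD1_seq t) //= big1 ?addr0.
rewrite tw (addf0 (evD t)) big1 // => l _.
by have [->|/ev0//] := eqVneq l t; rewrite tw (addf0 (evD t)).
Qed.

End Coinduced.

Variable G : grading A.
Hypothesis kappaG : forall c, kappa c -> G 0%N c.

(** Let [pi] be linear with kernel [S]. The kernel of the homomorphism defined
    by [pi] in every degree consists of the [v] such that all components of all
    multiples of [v] lie in [S]; this is [S] for a graded submodule. *)
Lemma injective_with_kernel (N : grmod G) (S : set N) :
  S 0 -> (forall u v, S u -> S v -> S (u + v)) ->
  (forall a v, S v -> S (a *: v)) ->
  (forall v l, S v -> S (hcomp (gm_direct N) v l)) ->
  exists (E : grmod G) (f : {linear N -> E}),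
    [/\ injective_grmod E, degree0 f & forall v, f v = 0 <-> S v].
Proof.
move=> S0 SD SZ Sc.
have kS : submodule kappa S by split=> // c v _; exact: SZ.
have [pi kpi piS] := klinear_kernel kS.
have [f f0 fE] := to_coind kappaG (fun _ => kpi).
exists (coind_grmod N G), f; split=> //; first exact: coind_injective.
move=> v; split=> [fv|Sv].
  rewrite -(sum_comp (gm_direct N) v); apply: in_sum_span => // t _.
  apply/piS; have := fE v 1 t; rewrite scale1r => <-.
  by rewrite fv; have -> := addf0 (hs_valD (P := coind_family N G)).
apply: (hs_val_inj (P := coind_family N G)); apply: coind_eq => b t.
rewrite fE (addf0 (hs_valD (P := coind_family N G))).
by apply/piS; apply: Sc; exact: SZ.
Qed.

Lemma exact_step (M N : grmod G) (f : {linear M -> N}) : degree0 f ->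
  exists (E : grmod G) (g : {linear N -> E}),
    [/\ injective_grmod E, degree0 g & forall v, g v = 0 <-> exists u, f u = v].
Proof.
move=> f0.
apply: (@injective_with_kernel N [set v | exists u, f u = v]).
- by exists 0; exact: (raddf0 f).
- by move=> _ _ [u <-] [v <-]; exists (u + v); exact: (raddfD f).
- by move=> a _ [v <-]; exists (a *: v); exact: (linearZZ f).
- move=> _ l [v <-]; exists (hcomp (gm_direct M) v l); apply/esym.
  exact: (@comp_morph _ _ _ _ _ _ (gm_direct M) (gm_direct N) f id
    (raddfD f) (fun _ _ => id) f0).
Qed.

(** The state of the recursive construction of a resolution: the last map,
    whose image becomes the kernel of the next one. *)
Record complex_step := ComplexStep {
  cs_src : grmod G; cs_tgt : grmod G;
  cs_map : {linear cs_src -> cs_tgt};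
  cs_degree0 : degree0 cs_map }.

Definition next_tgt (c : complex_step) : grmod G :=
  sval (cid (exact_step (@cs_degree0 c))).

Definition next_map (c : complex_step) : {linear cs_tgt c -> next_tgt c} :=
  sval (cid (svalP (cid (exact_step (@cs_degree0 c))))).

Lemma next_mapP c : [/\ injective_grmod (next_tgt c), degree0 (next_map c) &
  forall v, next_map c v = 0 <-> exists u, cs_map c u = v].
Proof. exact: svalP (cid (svalP (cid (exact_step (@cs_degree0 c))))). Qed.

Definition next_step (c : complex_step) : complex_step :=
  @ComplexStep (cs_tgt c) (next_tgt c) (next_map c)
    (let: And3 _ H _ := next_mapP c in H).

(** The recursion starts with the zero endomorphism of [M], for which the next
    map, the augmentation, is injective. *)
Lemma injective_resolution_ex (M : grmod G) : inhabited (injective_resolution M).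
Proof.
have z0 : degree0 (\0 : {linear M -> M}) by move=> l v _; exact: gm_0.
pose c i := iter i next_step (ComplexStep z0).
split; apply: (@InjectiveResolution A G M (fun i => cs_tgt (c i.+1))
  (cs_map (c 1%N)) (fun i => cs_map (c i.+2))).
- by move=> i; case: (next_mapP (c i)).
- exact: (@cs_degree0 (c 1%N)).
- by move=> i; exact: (@cs_degree0 (c i.+2)).
- move=> u v uv; apply/eqP; rewrite -subr_eq0; apply/eqP.
  have [_ _ H] := next_mapP (c 0%N).
  have /H[w <-//] : next_map (c 0%N) (u - v) = 0.
  by rewrite (raddfB (next_map _)) [X in X - _]uv subrr.
- by move=> v; have [_ _] := next_mapP (c 1%N); exact.
- by move=> i v; have [_ _] := next_mapP (c i.+2); exact.
Qed.

End FieldLinear.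

(** * Top degrees of local cohomology *)

Lemma int_max (D : set int) (B l0 : int) : D l0 -> (forall l, D l -> l <= B) ->
  exists2 l, D l & forall l', D l' -> l' <= l.
Proof.
move=> Dl0 DB.
have ex : exists n, `[< D (B - n%:Z) >].
  exists (absz (B - l0)); apply/asboolP.
  have := DB _ Dl0 => l0B.
  by rewrite (_ : B - _ = l0) //; lia.
case: (ex_minnP ex) => n /asboolP Dn nmin; exists (B - n%:Z) => // l' Dl'.
have l'B := DB _ Dl'.
have := nmin (absz (B - l')).
have -> : `[< D (B - (absz (B - l'))%:Z) >].
  by apply/asboolP; rewrite (_ : B - _ = l') //; lia.
by move=> /(_ isT); lia.
Qed.

Section AStar.
Variables (A : comPzRingType) (G : grading A).
Variable s : seq A.
Hypothesis gen : generated_by G s.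
Variable b0 : int.
Hypothesis bA : forall p, b0 <= p ->
  acyclic 0 (KD s (fun=> 0)) (KP (-1) s (zpart G : int -> set A^o)) p.
Variable kappa : subring A.
Hypothesis kappa_field :
  forall c, kappa c -> c = 0 \/ exists2 c', kappa c' & c' * c = 1.
Hypothesis kappaG : forall c, kappa c -> G 0%N c.
Variable M : grmod G.

Local Notation Kacyclic :=
  (acyclic 0 (KD s (fun=> 0)) (KP (-1) s (gm_part M))).

Lemma lc_vanish a : (forall l, a + (size s)%:Z < l -> Kacyclic l) ->
  forall l i, lc_nonzero M i l -> l <= a.
Proof.
move=> H l i [E nE]; rewrite leNgt; apply/negP => al; apply: nE.
exact: (iffRL (local_cohomology_Koszul gen bA E a) H).
Qed.

(** By [local_cohomology_Koszul] for [b - size s] and for [b - size s - 1],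
    local cohomology vanishes in degrees greater than [b - size s], and some
    [H^i] is nonzero in degree [b - size s]. *)
Lemma is_astar_max (b : int) : ~ Kacyclic b -> (forall l, b < l -> Kacyclic l) ->
  is_astar M (b - (size s)%:Z)%:E%E.
Proof.
move=> nb Hb; pose a := b - (size s)%:Z.
have vanish l i : lc_nonzero M i l -> l <= a.
  by apply: lc_vanish => l' al'; apply: Hb; move: al'; rewrite subrK.
have inv i : exists v, is_a_inv M i v.
  have [[l Hl]|no] := pselect (exists l, lc_nonzero M i l).
    have [l' Dl' l'max] := int_max Hl (fun l => @vanish l i).
    exists l'%:E%E; right; split; first by exists l'.
    by move=> _ [l'' Dl'' <-]; rewrite lee_fin; exact: l'max.
  exists -oo%E; left; split=> //; apply/seteqP; split=> // v [l Dl _].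
  by apply: no; exists l.
have [v vP] := choice inv.
exists v; split=> //; right; split; last first.
  move=> _ [i _ <-]; have [[_ ->]|[[l Dl <-] _]] := vP i; first exact: leNye.
  by rewrite lee_fin; exact: vanish Dl.
have [E] := injective_resolution_ex kappa_field kappaG M.
have [i [l [al nE]]] : exists i l, a - 1 < l /\
    ~ (cocycles (E := E) (i := i) l `<=` coboundaries (E := E) (i := i) l).
  apply: contrapT => no; apply: nb.
  apply: (iffLR (local_cohomology_Koszul gen bA E (a - 1))); last first.
    by rewrite /a; lia.
  move=> l al i; apply: contrapT => nE; apply: no; by exists i, l.
have lc : lc_nonzero M i l by exists E.
have la : l = a by have := vanish _ _ lc; move: al; lia.
exists i => //; rewrite -[b - _]/a -la.
have [[D0 _]|[[l' Dl' <-] vmax]] := vP i.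
  have : [set l%:E%E | l in [set l | lc_nonzero M i l]] l%:E%E by exists l.
  by rewrite D0.
congr (_%:E)%E; apply/eqP; rewrite eq_le {1}la (vanish _ _ Dl') /=.
by have := vmax l%:E%E; rewrite lee_fin; apply; exists l.
Qed.

Lemma is_astar_ninfty : (forall l, Kacyclic l) -> is_astar M -oo%E.
Proof.
move=> H.
have no l i : ~ lc_nonzero M i l.
  move=> Hl; have := @lc_vanish (l - 1) (fun l _ => H l) l i Hl; lia.
exists (fun _ => -oo%E); split; last by right; split=> [|_ [_ _ <-]//]; exists 0%N.
move=> i; left; split=> //; apply/seteqP; split=> // v [l Dl _].
exact: no Dl.
Qed.

End AStar.

(** * Noetherian subrings *)

Section Noetherian.
Variable A : comPzRingType.
Implicit Types B : subring A.

Section Span.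
Variables (V : lmodType A).
Implicit Types (l : seq V) (J : set V).

Definition span B l : set V := [set v | exists t : seq (A * V),
  (forall z, z \in t -> B z.1 /\ z.2 \in l) /\ v = \sum_(z <- t) z.1 *: z.2].

Lemma span_submodule B l : submodule B (span B l).
Proof.
split.
- by exists [::]; rewrite big_nil.
- move=> _ _ [s [sP ->]] [t [tP ->]]; exists (s ++ t); rewrite big_cat.
  by split=> // z; rewrite mem_cat => /orP[/sP|/tP].
- move=> c _ Bc [s [sP ->]]; exists [seq (c * z.1, z.2) | z <- s]; split.
    by move=> z /mapP[y /sP[By yl] ->]; split=> //; exact: sr_mul.
  by rewrite big_map scaler_sumr; apply: eq_bigr => z _; rewrite scalerA.
Qed.

Lemma span_in B l v : v \in l -> span B l v.
Proof.
move=> vl; exists [:: (1, v)]; rewrite big_seq1 scale1r; split=> // z.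
by rewrite inE => /eqP ->; split=> //; exact: sr_one.
Qed.

Lemma span_min B l J : submodule B J -> (forall v, v \in l -> J v) ->
  span B l `<=` J.
Proof.
move=> [J0 JD JZ] lJ _ [t [tP ->]]; apply: in_sum_span => // z /tP[Bz zl].
by apply: JZ => //; exact: lJ.
Qed.

(** All rings of the basis theorem are subrings of [A], and the modules are
    subsets of modules over [A]. *)
Definition noetherian B (W : set V) := forall J, submodule B J -> J `<=` W ->
  exists l, (forall v, v \in l -> J v) /\ J `<=` span B l.

End Span.

(** Generators of the image of [J] in [V] are lifted to [J], and completed with
    generators of the kernel. *)
Lemma noetherian_prod B (V W : lmodType A) :
  noetherian B [set: V] -> noetherian B [set: W] ->
  noetherian B [set: (V * W)%type].
Proof.
move=> nV nW J sJ _; have [J0 JD JZ] := sJ.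
have [|//|l1 [l1J J1l]] := nV [set v | exists w, J (v, w)].
  split=> [|u v [a Ja] [b Jb]|c v Bc [a Ja]]; first by exists 0.
    by exists (a + b); exact: (JD _ _ Ja Jb).
  by exists (c *: a); exact: (JZ _ _ Bc Ja).
have [|//|l2 [l2J J2l]] := nW [set w | J (0, w)].
  split=> [//|u v Ja Jb|c v Bc Ja].
    by have := JD _ _ Ja Jb; rewrite -[_ + _]/(0 + 0, u + v) addr0.
  by have := JZ _ _ Bc Ja; rewrite -[_ *: _]/(c *: 0, c *: v) scaler0.
have /choice[g gP] v : exists w, v \in l1 -> J (v, w).
  have [/l1J[w Jw]|] := boolP (v \in l1); first by exists w.
  by exists 0.
pose F := [seq (v, g v) | v <- l1] ++ [seq (0, w) | w <- l2].
have FJ w : w \in F -> J w.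
  rewrite mem_cat => /orP[/mapP[v vl ->]|/mapP[v /l2J vl ->//]].
  exact: gP.
have sF := span_submodule B F; have [F0 FD FZ] := sF.
exists F; split=> // -[v w] Jvw.
have [f Ff fv] : exists2 f, span B F f & f.1 = v.
  have : span B l1 v by apply: J1l; exists w.
  apply: (@span_min _ B l1 [set v | exists2 f, span B F f & f.1 = v]).
    split.
    - by exists 0.
    - by move=> _ _ [f Ff <-] [f' Ff' <-]; exists (f + f') => //; exact: FD.
    - by move=> c _ Bc [f Ff <-]; exists (c *: f) => //; exact: FZ.
  move=> u ul; exists (u, g u) => //; apply: span_in.
  by rewrite mem_cat map_f.
have Jf : J f by exact: (span_min sJ FJ).
have J2 : J (0, w - f.2).
  have := submoduleB sJ Jvw Jf; case: (f) fv => a b /= ->.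
  by rewrite -[_ - _]/(v - v, w - b) subrr.
have F2 : span B F (0, w - f.2).
  have : span B l2 (w - f.2) by exact: J2l.
  apply: (@span_min _ B l2 [set w | span B F (0, w)]).
    split=> [//|u u' Fu Fu'|c u Bc Fu].
      by have := FD _ _ Fu Fu'; rewrite -[_ + _]/(0 + 0, u + u') addr0.
    by have := FZ _ _ Bc Fu; rewrite -[_ *: _]/(c *: 0, c *: u) scaler0.
  by move=> u ul; apply: span_in; rewrite mem_cat map_f // orbT.
have := FD _ _ Ff F2; case: (f) fv => a b /= ->.
by rewrite -[_ + _]/(v + 0, b + (w - b)) addr0 addrC subrK.
Qed.

Section Adjoin.
Variables (B : subring A) (y : A).

(** Polynomials of degree less than [n], evaluated at [y]; an element of
    [B[y]] may have several such expressions. *)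
Definition low n : set A := [set x | exists r : nat -> A,
  (forall i, B (r i)) /\ x = \sum_(i < n) r i * y ^+ i].

Lemma low0 n : low n 0.
Proof.
exists (fun=> 0); split=> [_|]; first exact: sr0.
by rewrite big1 // => i _; rewrite mul0r.
Qed.

Lemma lowD n a b : low n a -> low n b -> low n (a + b).
Proof.
move=> [r [rB ->]] [r' [rB' ->]]; exists (fun i => r i + r' i); split.
  by move=> i; exact: srD.
by rewrite -big_split; apply: eq_bigr => i _; rewrite mulrDl.
Qed.

Lemma lowZ n c a : B c -> low n a -> low n (c * a).
Proof.
move=> Bc [r [rB ->]]; exists (fun i => c * r i); split.
  by move=> i; exact: sr_mul.
by rewrite mulr_sumr; apply: eq_bigr => i _; rewrite mulrA.
Qed.

Lemma lowB n a b : low n a -> low n b -> low n (a - b).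
Proof.
move=> La Lb; apply: lowD => //; rewrite -mulN1r; apply: lowZ => //.
by apply: srN; exact: sr_one.
Qed.

Lemma lowS n a : low n.+1 a -> exists2 b, B b & low n (a - b * y ^+ n).
Proof.
move=> [r [rB ->]]; exists (r n) => //; exists r; split=> //.
by rewrite big_ord_recr /= addrK.
Qed.

Lemma low_lead n b : B b -> low n.+1 (b * y ^+ n).
Proof.
move=> Bb; exists (fun i => if i == n then b else 0); split.
  by move=> i; case: eqP => // _; exact: sr0.
rewrite big_ord_recr /= eqxx big1 ?add0r // => i _.
by rewrite ltn_eqF ?mul0r.
Qed.

Lemma low_shift n a : low n a -> low n.+1 (y * a).
Proof.
move=> [r [rB ->]]; exists (fun i => if i is j.+1 then r j else 0); split.
  by case=> [|i] //; exact: sr0.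
rewrite big_ord_recl /= mul0r add0r mulr_sumr; apply: eq_bigr => i _.
by rewrite /bump /= add1n exprS mulrCA.
Qed.

Lemma low_leq m n a : (m <= n)%N -> low m a -> low n a.
Proof.
move=> mn [r [rB ->]]; exists (fun i => if (i < m)%N then r i else 0); split.
  by move=> i; case: ifP => // _; exact: sr0.
rewrite (big_ord_widen n (fun i => r i * y ^+ i) mn) big_mkcond.
by apply: eq_bigr => i _; case: ifP => _; rewrite ?mul0r.
Qed.

Definition adjoin_set : set A := [set x | exists n, low n x].

Lemma adjoinD a b : adjoin_set a -> adjoin_set b -> adjoin_set (a + b).
Proof.
move=> [m La] [n Lb]; exists (maxn m n); apply: lowD.
  exact: low_leq (leq_maxl _ _) La.
exact: low_leq (leq_maxr _ _) Lb.
Qed.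

Lemma adjoin1 : adjoin_set 1.
Proof. by exists 1%N; have := low_lead 0 (sr_one B); rewrite mulr1. Qed.

Lemma adjoinB a b : adjoin_set a -> adjoin_set b -> adjoin_set (a - b).
Proof.
move=> Ha [n Lb]; apply: adjoinD => //; exists n.
by rewrite -sub0r; apply: lowB => //; exact: low0.
Qed.

Lemma adjoinM a b : adjoin_set a -> adjoin_set b -> adjoin_set (a * b).
Proof.
move=> [m [r [rB ->]]] Hb; rewrite mulr_suml.
apply: in_sum_span => [|u v|i _]; [by exists 0%N; exact: low0|exact: adjoinD|].
rewrite -mulrA.
have [n Ln] : adjoin_set (y ^+ i * b).
  elim: (nat_of_ord i) => [|j [n IH]]; first by rewrite mul1r.
  by exists n.+1; rewrite exprS -mulrA; exact: low_shift.
by exists n; exact: lowZ.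
Qed.

Definition adjoin : subring A := Subring adjoin1 adjoinB adjoinM.

Lemma adjoin_base b : B b -> adjoin b.
Proof. by move=> Bb; exists 1%N; have := low_lead 0 Bb; rewrite mulr1. Qed.

Lemma adjoin_gen : adjoin y.
Proof. by exists 2; have := low_lead 1 (sr_one B); rewrite mul1r. Qed.

(** Hilbert's argument. The leading coefficients of the elements of degree [n]
    of [J] form a submodule [L n] of [B], and [L n] is constant for [n >= N]. Let
    [F] consist of elements of [J] whose leading coefficients generate [L n] for
    [n <= N]. The leading term of any element of [J] can be cancelled by a
    combination of [F], and induction on the degree applies. *)
Theorem noetherian_adjoin :
  noetherian B (B : set A^o) -> noetherian adjoin (adjoin : set A^o).
Proof.
move=> nB J sJ JB'; have [J0 JD JZ] := sJ.
have sJB : submodule B J.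
  by split=> // c v Bc; apply: JZ; exact: adjoin_base.
pose L n : set A^o := [set b | B b /\ exists2 x, J x & low n (x - b * y ^+ n)].
have sL n : submodule B (L n).
  split.
  - split; first exact: sr0.
    by exists 0 => //; rewrite mul0r subr0; exact: low0.
  - move=> b c [Bb [u Ju Lu]] [Bc [v Jv Lv]]; split; first exact: srD.
    exists (u + v); first exact: JD.
    by rewrite mulrDl opprD addrACA; exact: lowD.
  - move=> c b Bc [Bb [u Ju Lu]]; split; first exact: sr_mul.
    exists (c * u); first by apply: JZ => //; exact: adjoin_base.
    by rewrite -[c *: b]/(c * b) -mulrA -mulrBr; exact: lowZ.
have LS m n : (m <= n)%N -> L m `<=` L n.
  move=> /subnK <-; elim: (n - m)%N => [//|k IH] b /IH[Bb [u Ju Lu]].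
  split=> //; exists (y * u); first by apply: JZ => //; exact: adjoin_gen.
  by rewrite addSn exprS mulrCA -mulrBr; exact: low_shift.
have LB n : L n `<=` (B : set A^o) by move=> b [].
have [||linf [linfL Linfl]] := nB (\bigcup_n L n).
- split.
  + by exists 0%N => //; have [] := sL 0%N.
  + move=> b c [m _ Lb] [n _ Lc]; exists (maxn m n) => //.
    have [_ LD _] := sL (maxn m n); apply: LD.
      exact: LS (leq_maxl _ _) _ Lb.
    exact: LS (leq_maxr _ _) _ Lc.
  + by move=> c b Bc [m _ Lb]; exists m => //; have [_ _] := sL m; apply.
- by move=> b [n _ /LB].
have [N LN] : exists N, \bigcup_n L n `<=` L N.
  have [N HN] : exists N, forall b, b \in linf -> L N b.
    elim: linf linfL {Linfl} => [|b l IH] lL; first by exists 0%N.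
    have [N HN] : exists N, forall b, b \in l -> L N b.
      by apply: IH => c cl; apply: lL; rewrite inE cl orbT.
    have [n _ Lb] := lL b (mem_head _ _).
    exists (maxn n N) => c; rewrite inE => /orP[/eqP ->|/HN].
      exact: LS (leq_maxl _ _) _ Lb.
    by apply: LS; exact: leq_maxr.
  by exists N => b /Linfl; exact: (span_min (sL N)).
have /choice[l lP] n : exists l : seq A^o,
    (forall b, b \in l -> L n b) /\ L n `<=` span B l.
  exact: nB (sL n) (LB n).
have /choice[f fP] (nb : nat * A) : exists x, L nb.1 nb.2 ->
    J x /\ low nb.1 (x - nb.2 * y ^+ nb.1).
  have [[_ [x Jx Lx]]|nL] := pselect (L nb.1 nb.2); first by exists x.
  by exists 0.
pose F : seq A^o := flatten [seq [seq f (n, b) | b <- l n] | n <- iota 0 N.+1].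
have FJ x : x \in F -> J x.
  by move=> /flatten_mapP[n _ /mapP[b /(lP n).1 Lb ->]]; have [] := fP (n, b) Lb.
have sF := span_submodule adjoin F; have [F0 FD FZ] := sF.
exists F; split=> //.
have lead_small n b : (n <= N)%N -> L n b ->
    exists2 x, span adjoin F x & low n (x - b * y ^+ n).
  move=> nN /(lP n).2; pose H : set A^o := [set b | exists2 x, span adjoin F x &
    low n (x - b * y ^+ n)].
  apply: (@span_min _ B (l n) H).
    split.
    - by exists 0 => //; rewrite mul0r subr0; exact: low0.
    - move=> b1 b2 [u Fu Lu] [v Fv Lv]; exists (u + v); first exact: FD.
      by rewrite mulrDl opprD addrACA; exact: lowD.
    - move=> c b1 Bc [u Fu Lu]; exists (c * u).
        by apply: FZ => //; exact: adjoin_base.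
      by rewrite -[c *: b1]/(c * b1) -mulrA -mulrBr; exact: lowZ.
  move=> c cl; have Lc := (lP n).1 c cl; have [_ Lx] := fP (n, c) Lc.
  exists (f (n, c)) => //; apply: span_in; apply/flatten_mapP.
  by exists n; rewrite ?mem_iota //; exact: map_f.
have lead n b : L n b -> exists2 x, span adjoin F x & low n (x - b * y ^+ n).
  have [nN|Nn] := leqP n N; first exact: lead_small.
  move=> Lb; have LNb : L N b by apply: LN; exists n.
  have [x Fx Lx] := lead_small N b (leqnn _) LNb.
  rewrite -(subnK (ltnW Nn)); elim: (n - N)%N => [|k [z Fz Lz]]; first by exists x.
  exists (y * z); first by apply: FZ => //; exact: adjoin_gen.
  by rewrite addSn exprS mulrCA -mulrBr; exact: low_shift.
move=> x Jx; have [n Lx] := JB' x Jx.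
elim: n x Jx Lx => [|n IH] x Jx Lx.
  by have [r [_ ->]] := Lx; rewrite big_ord0.
have [b Bb Lb] := lowS Lx.
have [|z Fz Lz] := lead n b; first by split=> //; exists x.
have Jz : J z by exact: (span_min sJ FJ).
rewrite -(subrK z x); apply: FD => //; apply: IH.
  exact: submoduleB sJ Jx Jz.
have := lowB Lb Lz; congr (low n _).
by rewrite opprB addrA subrK.
Qed.

End Adjoin.

Definition adjoin_seq (B : subring A) (ys : seq A) : subring A :=
  foldr (fun y C => adjoin C y) B ys.

Lemma noetherian_adjoin_seq B ys : noetherian B (B : set A^o) ->
  noetherian (adjoin_seq B ys) (adjoin_seq B ys : set A^o).
Proof. by move=> nB; elim: ys => [//|y ys IH]; exact: noetherian_adjoin. Qed.

Lemma adjoin_seq_base B ys b : B b -> adjoin_seq B ys b.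
Proof. by move=> Bb; elim: ys => [//|y ys IH]; exact: adjoin_base. Qed.

Lemma adjoin_seq_gen B ys y : y \in ys -> adjoin_seq B ys y.
Proof.
elim: ys => [//|z ys IH]; rewrite inE => /orP[/eqP ->|/IH]; first exact: adjoin_gen.
exact: adjoin_base.
Qed.

Lemma noetherian_field (kappa : subring A) :
  (forall c, kappa c -> c = 0 \/ exists2 c', kappa c' & c' * c = 1) ->
  noetherian kappa (kappa : set A^o).
Proof.
move=> kf J sJ Jk; have [J0 JD JZ] := sJ.
have [[c [Jc c0]]|no] := pselect (exists c, J c /\ c <> 0).
  exists [:: c]; split=> [v|v Jv]; first by rewrite inE => /eqP ->.
  have [//|[c' kc' c'c]] := kf c (Jk _ Jc).
  have [_ _ SZ] := span_submodule (V := A^o) kappa [:: c].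
  have -> : v = (v * c') *: (c : A^o) by rewrite /GRing.scale /= -mulrA c'c mulr1.
  by apply: SZ; [apply: sr_mul => //; exact: Jk|apply: span_in; rewrite mem_head].
exists [::]; split=> // v Jv.
have -> : v = 0 by apply: contrapT => v0; apply: no; exists v.
by have [] := span_submodule (V := A^o) kappa [::].
Qed.

End Noetherian.

(** * Homogeneous prime ideals *)

Section GradedPrime.
Variables (A : comPzRingType) (G : grading A) (p : set A).
Hypotheses (ip : is_ideal p) (gp : graded_sub G p).

Local Notation cmp a i := (hcomp (gr_direct G) a i).

Lemma idealB a b : p a -> p b -> p (a - b).
Proof.
have [_ pD pM] := ip => pa pb; apply: pD => //.
by rewrite -mulN1r; exact: pM.
Qed.

Lemma graded_ideal_comp a i : p a -> p (cmp a i).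
Proof.
have [p0 pD pM] := ip.
move=> /gp[t [tP ->]]; rewrite (addf_sum (compD (gr_direct G) i)).
apply: ideal_sum => // u /tP[pu [j Gu]].
have [->|ij] := eqVneq i j; first by rewrite comp_eq.
by rewrite (comp_neq (gr_direct G) Gu).
Qed.

Lemma top_component a : ~ p a ->
  exists2 i, ~ p (cmp a i) & forall j, (i < j)%N -> p (cmp a j).
Proof.
have [p0 pD pM] := ip.
move=> npa; have [_ _ c0 _] := compP (gr_direct G) a.
have ex : exists i, `[< ~ p (cmp a i) >].
  apply: contrapT => no; apply: npa; rewrite -(sum_comp (gr_direct G) a).
  apply: ideal_sum => // i _; apply: contrapT => npi; apply: no.
  by exists i; apply/asboolP.
have bd i : `[< ~ p (cmp a i) >] ->
    (i <= \max_(j <- supp (gr_direct G) a) j)%N.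
  move=> /asboolP npi; apply: (@leq_bigmax_seq _ _ xpredT id) => //.
  by apply: contrapT => /negP /c0 E; apply: npi; rewrite E.
case: (ex_maxnP ex bd) => i /asboolP npi imax; exists i => // j ij.
apply: contrapT => /asboolP /imax; lia.
Qed.

(** Let [i] and [j] be the top degrees in which [a] and [b] have components
    outside [p]. Modulo [p], the component of degree [i + j] of [a * b] is the
    product of these two components. *)
Lemma graded_prime : ~ p 1 ->
  (forall i j a b, G i a -> G j b -> p (a * b) -> p a \/ p b) ->
  prime_ideal p.
Proof.
have [p0 pD pM] := ip.
move=> p1 hp; split=> // a b pab; apply: contrapT => /not_orP[npa npb].
have [i npi imax] := top_component npa; have [j npj jmax] := top_component npb.
have Gi := comp_part (gr_direct G) a i; have Gj := comp_part (gr_direct G) b j.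
suff : p (cmp a i * cmp b j) by move=> /(hp _ _ _ _ Gi Gj)[].
pose T s t := cmp (cmp a s * cmp b t) (i + j).
have term s t : (s != i) || (t != j) -> p (T s t).
  move=> st; have [E|E] := eqVneq (i + j)%N (s + t)%N; last first.
    rewrite /T (comp_neq (gr_direct G) _ E) //.
    by apply: gr_mul; exact: comp_part.
  apply: graded_ideal_comp; have [si|si] := ltnP i s.
    by rewrite mulrC; apply: pM; exact: imax.
  by apply: pM; apply: jmax; move: st E si; lia.
have [_ us sa _] := compP (gr_direct G) a.
have [_ ut tb _] := compP (gr_direct G) b.
have is_ : i \in supp (gr_direct G) a.
  by apply: contrapT => /negP /sa E; apply: npi; rewrite E.
have jt : j \in supp (gr_direct G) b.
  by apply: contrapT => /negP /tb E; apply: npj; rewrite E.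
have : cmp (a * b) (i + j) =
    \sum_(s <- supp (gr_direct G) a) \sum_(t <- supp (gr_direct G) b) T s t.
  rewrite -{1}(sum_comp (gr_direct G) a) -{1}(sum_comp (gr_direct G) b).
  rewrite mulr_suml (addf_sum (compD (gr_direct G) _)).
  apply: eq_bigr => s _; rewrite mulr_sumr (addf_sum (compD (gr_direct G) _)).
  by [].
have Tij : T i j = cmp a i * cmp b j.
  by apply: (comp_eq (gr_direct G)); exact: gr_mul.
rewrite (bigD1_seq i) //= (bigD1_seq j) //= Tij.
rewrite -addrA; set Z := (X in _ = _ + X) => E.
rewrite -(addrK Z (_ * _)) -E.
apply: idealB; first exact: graded_ideal_comp.
apply: (pD); apply: big_ind; [exact: p0|exact: pD| |exact: p0|exact: pD|].
  by move=> t tj; apply: term; rewrite tj orbT.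
by move=> t ti; apply: ideal_sum => // t' _; apply: term; rewrite ti.
Qed.

End GradedPrime.

(** * The bigraded Rees algebra *)

Section ReesAlgebra.
Variables (k : fieldType) (R : comAlgType k) (G : grading R).
Variables (n : nat) (x : 'I_n.+1 -> R).
Hypothesis R_std : standard_graded G x.
Variables (d m : nat) (F : 'I_m.+1 -> R).
Hypothesis F_hom : forall i, G d (F i).

Local Notation I := (ideal_gen (range F)).
Local Notation A := (rees F).

Definition xs : seq R := [seq x i | i <- enum 'I_n.+1].
Definition Fs : seq R := [seq F j | j <- enum 'I_m.+1].

Lemma mem_xs i : x i \in xs.
Proof. by apply: map_f; rewrite mem_enum. Qed.

Lemma mem_Fs j : F j \in Fs.
Proof. by apply: map_f; rewrite mem_enum. Qed.

Lemma xs1 y : y \in xs -> G 1%N y.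
Proof. by move=> /mapP[i _ ->]; have [_ + _] := R_std; exact. Qed.

Lemma lincombZ (s : seq R) (Q Q' : set R^o) b a :
  (forall v, Q v -> Q' (b * v)) -> lincomb s Q a -> lincomb s Q' (b * a).
Proof.
move=> H [t [tP ->]]; rewrite mulr_sumr.
apply: (lincomb_sum (V := R^o)) => z /tP[zs Qz].
by rewrite /GRing.scale /= mulrCA; apply: lincomb_in => //; exact: H.
Qed.

(** Sums of homogeneous elements that are constants or combinations of the
    [x i] form a subring, which contains the generators of [R]. *)
Lemma generated_xs : generated_by G xs.
Proof.
split=> [y|l a Ga]; first exact: xs1.
pose nice j (u : R) := G j u /\
  if j is i.+1 then lincomb xs (G i : set R^o) u else True.
have [G0E _ R_gen] := R_std.
have niceM i j u v : nice i u -> nice j v -> nice (i + j)%N (u * v).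
  move=> [Gu Lu] [Gv Lv]; split; first exact: gr_mul.
  case: i Gu Lu => [|i] Gu Lu.
    case: j Gv Lv => [//|j] Gv Lv.
    by apply: lincombZ Lv => w Gw; have := gr_mul Gu Gw.
  rewrite mulrC; apply: lincombZ Lu => w Gw; rewrite mulrC; exact: gr_mul.
have GN i u : G i u -> G i (- u) by exact: partN (gr_direct G) i u.
have niceN j u : nice j u -> nice j (- u).
  move=> nu; have := niceM 0%N j (-1) u _ nu; rewrite mulN1r; apply.
  by split=> //; apply: GN; exact: gr_one.
pose C := finite_sums [set u | exists j, nice j u].
have nC j u : nice j u -> C u.
  by move=> nu; apply: finite_sums_in; exists j.
have C0 : C 0 by exact: finite_sums0.
have CD u v : C u -> C v -> C (u + v) by exact: finite_sumsD.
have C1 : C 1 by apply: (nC 0%N); split=> //; exact: gr_one.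
have CM u v : C u -> C v -> C (u * v).
  move=> [t [tP ->]] [t' [tP' ->]]; rewrite mulr_suml.
  apply: in_sum_span => // w /tP[i ni]; rewrite mulr_sumr.
  by apply: in_sum_span => // w' /tP'[j nj]; apply: (nC (i + j)%N); exact: niceM.
have CB u v : C u -> C v -> C (u - v).
  move=> Cu Cv; apply: CD => //; rewrite -mulN1r; apply: CM => //.
  by apply: (nC 0%N); apply: niceN; split=> //; exact: gr_one.
have : subring_gen (range (fun c : k => c%:A) `|` range x) a.
  by rewrite R_gen.
move=> /(_ (Subring C1 CB CM)) [].
  move=> _ [[c _ <-]|[i _ <-]].
    by apply: (nC 0%N); split=> //; rewrite G0E; exists c.
  apply: (nC 1%N); split; first exact: xs1 (mem_xs i).
  rewrite -[x i]mulr1; apply: (lincomb_in (V := R^o)); first exact: mem_xs.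
  exact: gr_one.
move=> t [tP aE]; rewrite -(comp_eq (gr_direct G) Ga) aE.
rewrite (addf_sum (compD (gr_direct G) l.+1)).
apply: (lincomb_sum (V := R^o)) => u /tP[j nu].
have [jl|jl] := eqVneq l.+1 j; last first.
  by rewrite (comp_neq (gr_direct G) nu.1) //; exact: (lincomb0 (V := R^o)).
by rewrite (comp_eq (gr_direct G)) ?jl ?nu.1 //; case: nu; rewrite -jl.
Qed.

(** Degrees in [I^q] are counted from [q * d], that of its generators. *)
Definition Iq q p : set R^o := [set a | ideal_exp I q a /\ G (p + q * d)%N a].

Lemma ideal_exp_comp q a e : ideal_exp I q a ->
  ideal_exp I q (hcomp (gr_direct G) a e).
Proof.
move=> Ia; have [t [tP ->]] := ideal_exp_graded F_hom Ia.
rewrite (addf_sum (compD (gr_direct G) e)).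
apply: ideal_sum => [|u /tP[Iu [i Gu]]]; first exact: ideal_expP.
have [->|ei] := eqVneq e i; first by rewrite comp_eq.
by rewrite (comp_neq (gr_direct G) Gu) //; have [] := ideal_expP I q.
Qed.

Lemma Iq_low q a e : ideal_exp I q a -> G e a -> (e < q * d)%N -> a = 0.
Proof.
move=> Ia Ga eq; have [t [tP aE]] := ideal_exp_graded_shift F_hom Ia.
rewrite -(comp_eq (gr_direct G) Ga) aE (addf_sum (compD (gr_direct G) e)).
rewrite big_seq big1 // => u /tP[_ [i Gu]]; apply: (comp_neq (gr_direct G) Gu).
by apply/eqP => E; move: eq; rewrite E; lia.
Qed.

(** Together with [Iq_x] this says that the Rees algebra is generated over its
    part of bidegree [(0, 0)] by elements of bidegrees [(1, 0)] and [(0, 1)]. *)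
Lemma Iq_F q p a : Iq q.+1 p a -> lincomb Fs (Iq q p) a.
Proof.
move=> [Ia Ga].
have : lincomb Fs (ideal_exp I q : set R^o) a.
  have Lid J : is_ideal J -> is_ideal (lincomb Fs (J : set R^o)).
    move=> [J0 JD JM]; split; [exact: (lincomb0 (V := R^o))|exact: (lincombD (V := R^o))|].
    by move=> b c; apply: lincombZ => v; exact: JM.
  apply: (ideal_gen_min (Lid _ (ideal_expP I q)) _ Ia) => _ [u Iu [b Ib <-]].
  have [L0 LD LM] := Lid _ (ideal_expP I q).
  have Cid : is_ideal [set u | lincomb Fs (ideal_exp I q : set R^o) (u * b)].
    split=> [|u1 u2 /= H1 H2|u1 u2 /= H2]; rewrite /= ?mul0r ?mulrDl //.
      exact: LD.
    by rewrite -mulrA; exact: LM.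
  apply: (ideal_gen_min Cid _ Iu) => _ [j _ <-] /=.
  by apply: (lincomb_in (V := R^o)) => //; exact: mem_Fs.
move=> [t [tP aE]]; rewrite -(comp_eq (gr_direct G) Ga) aE.
rewrite (addf_sum (compD (gr_direct G) _)).
apply: (lincomb_sum (V := R^o)) => z /tP[/mapP[j _ zE] Iz].
have -> : (p + q.+1 * d = d + (p + q * d))%N by lia.
rewrite zE /GRing.scale /=.
rewrite (@comp_morph _ _ _ _ _ _ (gr_direct G) (gr_direct G) ( *%R (F j))
  (addn d)) => [||i j' /addnI //|i u Gu].
- apply: (lincomb_in (V := R^o)); first exact: mem_Fs.
  by split; [exact: ideal_exp_comp|exact: comp_part].
- by move=> u v; rewrite mulrDr.
- exact: gr_mul.
Qed.

Lemma Iq_x q p a : Iq q p.+1 a -> lincomb xs (Iq q p) a.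
Proof.
elim: q p a => [|q IH] p a.
  move=> [_]; rewrite mul0n addn0 => /generated_xs.2[t [tP ->]].
  exists t; split=> // z /tP[zs Gz]; split=> //; split=> //.
  by rewrite mul0n addn0.
move=> /Iq_F[t [tP ->]].
apply: (lincomb_sum (V := R^o)) => z /tP[/mapP[j _ zE] /IH Lz].
rewrite zE; apply: lincombZ Lz => v [Iv Gv]; split.
  apply: ideal_mul_in => //; apply: ideal_gen_in; by exists j.
by have := gr_mul (F_hom j) Gv; congr (G _ _); lia.
Qed.

Definition rmono_subproof q a (Ia : ideal_exp I q a) : rees_set F (a *: 'X^q).
Proof.
move=> j; rewrite coefZ coefXn; case: eqP => [->|_]; first by rewrite mulr1.
by rewrite mulr0; have [] := ideal_expP I j.
Qed.

(** The element [a t^q]; the default value 0 makes the function total. *)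
Definition rmono q a : A :=
  if pselect (ideal_exp I q a) is left Ia
  then @sr_elt _ (rees_subring F) _ (rmono_subproof Ia) else 0.

Lemma rmonoE q a : ideal_exp I q a -> sr_val (rmono q a) = a *: 'X^q.
Proof. by rewrite /rmono; case: pselect. Qed.

Lemma rees_eq (f g : A) : sr_val f = sr_val g -> f = g.
Proof. exact: val_inj. Qed.

Lemma rees_valD : {morph (fun f : A => sr_val f) : f g / f + g}.
Proof. by []. Qed.

Lemma rmonoD q a b : ideal_exp I q a -> ideal_exp I q b ->
  rmono q (a + b) = rmono q a + rmono q b.
Proof.
move=> Ia Ib; apply: rees_eq; rewrite rees_valD !rmonoE ?scalerDl //.
by have [_ ID _] := ideal_expP I q; exact: ID.
Qed.

Lemma rmono_sum q (T : eqType) (t : seq T) (f : T -> R) :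
  (forall z, z \in t -> ideal_exp I q (f z)) ->
  rmono q (\sum_(z <- t) f z) = \sum_(z <- t) rmono q (f z).
Proof.
move=> tI; apply: rees_eq; rewrite rmonoE; last first.
  by apply: ideal_sum => //; exact: ideal_expP.
rewrite (addf_sum rees_valD) scaler_suml; apply: eq_big_seq => z zt.
by rewrite rmonoE //; exact: tI.
Qed.

Definition rcst (r : R) : A := rmono 0 r.

Lemma rcstE r : sr_val (rcst r) = r%:P.
Proof. by rewrite rmonoE // expr0 alg_polyC. Qed.

Lemma rmonoZ q r a : ideal_exp I q a -> rmono q (r * a) = rcst r * rmono q a.
Proof.
move=> Ia; apply: rees_eq; rewrite -[sr_val (_ * _)]/(sr_val _ * sr_val _).
rewrite rcstE !rmonoE //; first by rewrite -scalerA mul_polyC.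
by have [_ _ IM] := ideal_expP I q; exact: IM.
Qed.

Lemma I1_F j : ideal_exp I 1 (F j).
Proof.
rewrite -[F j]mulr1; apply: ideal_mul_in => //.
by apply: ideal_gen_in; exists j.
Qed.

Definition rF j : A := rmono 1 (F j).

Lemma rFE j : sr_val (rF j) = F j *: 'X.
Proof. by rewrite rmonoE ?expr1 //; exact: I1_F. Qed.

Lemma rF_rmono q j a : ideal_exp I q a -> rmono q.+1 (F j * a) = rF j * rmono q a.
Proof.
move=> Ia; apply: rees_eq; rewrite -[sr_val (_ * _)]/(sr_val _ * sr_val _).
rewrite rFE !rmonoE //.
  by rewrite -scalerAl -scalerAr scalerA exprS.
apply: ideal_mul_in => //; apply: ideal_gen_in; by exists j.
Qed.

Lemma rees_coef (f : A) q : ideal_exp I q (sr_val f)`_q.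
Proof. exact: sr_valP f q. Qed.

Lemma rees_partE e q (f : A) : rees_part G d e q f <->
  exists2 a, Iq q e a & f = rmono q a.
Proof.
split=> [[c Gc fE]|[a [Ia Ga] ->]]; last by exists a => //; exact: rmonoE.
have Ic : ideal_exp I q c.
  by have := rees_coef f q; rewrite fE coefZ coefXn eqxx mulr1.
by exists c => //; apply: rees_eq; rewrite rmonoE.
Qed.

Definition xsR : seq A := map rcst xs.
Definition FsR : seq A := [seq rF j | j <- enum 'I_m.+1].

Lemma rees_part_x e q f : rees_part G d e.+1 q f ->
  lincomb xsR (rees_part G d e q : set A^o) f.
Proof.
move=> /rees_partE[a /Iq_x[t [tP ->]] ->]; rewrite rmono_sum => [|z /tP[_ [Iz _]]].
  apply: (lincomb_sum (V := A^o)) => z /tP[zs Iz].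
  rewrite rmonoZ; last by case: Iz.
  apply: (lincomb_in (V := A^o)); first exact: map_f.
  by apply/rees_partE; exists z.2.
by have [_ _ IM] := ideal_expP I q; exact: IM.
Qed.

Lemma rees_part_F e q f : rees_part G d e q.+1 f ->
  lincomb FsR (rees_part G d e q : set A^o) f.
Proof.
move=> /rees_partE[a /Iq_F[t [tP ->]] ->].
rewrite rmono_sum => [|z /tP[/mapP[j _ ->] [Iz _]]].
  apply: (lincomb_sum (V := A^o)) => z /tP[/mapP[j _ ->] Iz].
  rewrite rF_rmono; last by case: Iz.
  apply: (lincomb_in (V := A^o)); first by apply: map_f; rewrite mem_enum.
  by apply/rees_partE; exists z.2.
apply: ideal_mul_in => //; apply: ideal_gen_in; by exists j.
Qed.

(** Bidegrees in the integers allow the shifts of the Koszul complex; the parts of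
    negative bidegree are zero. *)
Definition bipart (e : int * int) : set A^o :=
  if (0 <= e.1) && (0 <= e.2) then rees_part G d (absz e.1) (absz e.2)
  else [set 0].

Lemma bipart0 e : bipart e 0.
Proof. by rewrite /bipart; case: ifP => // _; exact: rees_part0. Qed.

Lemma bipartB e f g : bipart e f -> bipart e g -> bipart e (f - g).
Proof.
rewrite /bipart; case: ifP => _; first exact: rees_partB.
by move=> -> ->; exact: subr0.
Qed.

Lemma bipartM a e f g : bipart a f -> bipart e g -> bipart (a + e) (f * g).
Proof.
case: a e => a1 a2 [e1 e2]; rewrite {1 2}/bipart /=.
case: ifP => [/andP[a10 a20]|_]; last by move=> -> _; rewrite mul0r; exact: bipart0.
case: ifP => [/andP[e10 e20]|_]; last by move=> _ ->; rewrite mulr0; exact: bipart0.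
move=> Rf Rg; have := rees_partM Rf Rg; rewrite /bipart /= !addr_ge0 //=.
have -> : (absz a1 + absz e1 = absz (a1 + e1)%R)%N by lia.
by have -> : (absz a2 + absz e2 = absz (a2 + e2)%R)%N by lia.
Qed.

Lemma bipart_x y : y \in xsR -> bipart (1, 0) y.
Proof.
move=> /mapP[r rs ->]; apply/rees_partE; exists r => //; split=> //.
by rewrite mul0n addn0; exact: xs1.
Qed.

Lemma bipart_F y : y \in FsR -> bipart (0, 1) y.
Proof.
move=> /mapP[j _ ->]; apply/rees_partE; exists (F j) => //; split.
  exact: I1_F.
by rewrite mul1n.
Qed.

Lemma bipart_lin_x e f : 0 < e.1 -> bipart e f ->
  lincomb xsR (bipart (e - (1, 0))) f.
Proof.
case: e => p q /= p0; rewrite /bipart /= subr0 (ltW p0) /=.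
case: ifP => [q0|_]; last by move=> ->; exact: (lincomb0 (V := A^o)).
have -> : absz p = (absz (p - 1)).+1 by lia.
have -> : 0 <= p - 1 by lia.
exact: rees_part_x.
Qed.

Lemma bipart_lin_F e f : 0 < e.2 -> bipart e f ->
  lincomb FsR (bipart (e - (0, 1))) f.
Proof.
case: e => p q /= q0; rewrite /bipart /= subr0 (ltW q0) andbT.
case: ifP => [p0|_]; last by move=> ->; exact: (lincomb0 (V := A^o)).
have -> : absz q = (absz (q - 1)).+1 by lia.
have -> : 0 <= q - 1 by lia.
exact: rees_part_F.
Qed.

Lemma rees_homP f : finite_sums [set u | exists e, bipart e u] f.
Proof.
have H0 := @finite_sums0 _ [set u : A | exists e, bipart e u].
have HD := @finite_sumsD _ [set u : A | exists e, bipart e u].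
have -> : f = \sum_(q <- iota 0 (size (sr_val f))) rmono q (sr_val f)`_q.
  apply: rees_eq; rewrite (addf_sum rees_valD).
  rewrite -{1}[sr_val f]coefK poly_def.
  rewrite -(big_mkord xpredT (fun i => (sr_val f)`_i *: 'X^i)).
  rewrite /index_iota subn0; apply: eq_bigr => q _.
  by rewrite rmonoE //; exact: rees_coef.
apply: in_sum_span => // q _.
have [t [tP ->]] := ideal_exp_graded_shift F_hom (rees_coef f q).
rewrite rmono_sum => [|u /tP[]//].
apply: in_sum_span => // u /tP[Iu [p Gu]].
apply: finite_sums_in.
by exists (p%:Z, q%:Z); apply/rees_partE; exists u.
Qed.

Lemma bipart_direct : is_direct_sum bipart.
Proof.
split; [exact: bipart0|exact: bipartB| |].
  move=> f _; have [t [tP ->]] := rees_homP f.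
  by exists t; split=> // u /tP.
move=> s c us cP s0 e es.
have [|e0] := boolP ((0 <= e.1) && (0 <= e.2)); last first.
  by have := cP e; rewrite /bipart (negPf e0).
move=> /andP[p0 q0].
pose pr (f : A) : R :=
  hcomp (gr_direct G) (sr_val f)`_(absz e.2) (absz e.1 + absz e.2 * d)%N.
have prD : {morph pr : f g / f + g}.
  by move=> f g; rewrite /pr rees_valD coefD (compD (gr_direct G)).
have := congr1 pr s0; rewrite (addf_sum prD) (addf0 prD) (bigD1_seq e) //=.
rewrite big1 ?addr0 => [|e' e'e]; last first.
  have := cP e'; rewrite /bipart; case: ifP => [|_ ->]; last exact: addf0 prD.
  move=> /andP[p0' q0'] [a Ga aE]; rewrite /pr aE coefZ coefXn.
  case: eqP => [eq2|_]; last by rewrite mulr0 (addf0 (compD _ _)).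
  rewrite mulr1 (comp_neq (gr_direct G) Ga) // eq2.
  apply: contra e'e => /eqP/addIn E; apply/eqP.
  by case: (e) (e') p0 q0 p0' q0' eq2 E => a1 a2 [b1 b2] /= *; congr pair; lia.
have := cP e; rewrite /bipart p0 q0 /= => -[a Ga aE].
rewrite /pr aE coefZ coefXn eqxx mulr1 (comp_eq (gr_direct G) Ga) => a0.
by apply: rees_eq; rewrite aE a0 scale0r.
Qed.

(** * Koszul homology of the Rees algebra *)

Lemma rcst1 : rcst 1 = 1.
Proof. by apply: rees_eq; rewrite rcstE. Qed.

Lemma rcstD : {morph rcst : a b / a + b}.
Proof. by move=> a b; exact: rmonoD. Qed.

Lemma rcstM a b : rcst (a * b) = rcst a * rcst b.
Proof. exact: rmonoZ. Qed.

Lemma base_field c : G 0%N c -> c = 0 \/ exists2 c', G 0%N c' & c' * c = 1.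
Proof.
have [-> _ _] := R_std => -[a _ <-]; have [->|a0] := eqVneq a 0.
  by left; rewrite scale0r.
right; exists (a^-1)%:A; first by exists a^-1.
by rewrite -scalerAl mul1r scalerA mulVf // scale1r.
Qed.

Definition rees_base : subring A.
Proof.
refine (@Subring _ [set rcst c | c in G 0%N] _ _ _).
- by exists 1; [exact: gr_one|exact: rcst1].
- move=> _ _ [a Ga <-] [b Gb <-]; exists (a - b).
    exact: partB (gr_direct G) _ _ _ Ga Gb.
  exact: addfB rcstD _ _.
- move=> _ _ [a Ga <-] [b Gb <-]; exists (a * b); last exact: rcstM.
  exact: (gr_mul Ga Gb).
Defined.

Lemma rees_base_field c : rees_base c ->
  c = 0 \/ exists2 c', rees_base c' & c' * c = 1.
Proof.
move=> [a Ga <-]; have [->|[b Gb ba]] := base_field Ga.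
  by left; exact: addf0 rcstD.
right; exists (rcst b); first by exists b.
by rewrite -rcstM ba rcst1.
Qed.

Definition rees_gen : subring A := adjoin_seq rees_base (xsR ++ FsR).

Lemma rees_gen_full f : rees_gen f.
Proof.
have lin s Q u : (forall y, y \in s -> rees_gen y) ->
    (forall v, Q v -> rees_gen v) -> lincomb s (Q : set A^o) u -> rees_gen u.
  move=> sg Qg [t [tP ->]].
  apply: sr_sum => z /tP[zs Qz].
  by apply: sr_mul; [exact: sg|exact: Qg].
have part p q u : rees_part G d p q u -> rees_gen u.
  elim: q p u => [|q IHq] p u.
    elim: p u => [|p IHp] u.
      move=> /rees_partE[a [_ Ga] ->]; by apply: adjoin_seq_base; exists a.
    move=> /rees_part_x; apply: lin IHp => y ys.
    by apply: adjoin_seq_gen; rewrite mem_cat ys.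
  move=> /rees_part_F; apply: lin (IHq p) => y ys.
  by apply: adjoin_seq_gen; rewrite mem_cat ys orbT.
have [t [tP ->]] := rees_homP f.
apply: sr_sum => u /tP[e].
rewrite /bipart; case: ifP => [_|_ ->]; [exact: part|exact: sr0].
Qed.

(** The Rees algebra is of finite type over a field, and [Kmod s A^o] is a
    product of finitely many copies of it. *)
Lemma noetherian_Kmod s : noetherian rees_gen [set: Kmod s A^o].
Proof.
elim: s => [|y s IH]; last exact: noetherian_prod.
have -> : [set: Kmod [::] A^o] = (rees_gen : set A^o).
  by apply/seteqP; split=> // v _; exact: rees_gen_full.
exact/noetherian_adjoin_seq/noetherian_field/rees_base_field.
Qed.

Local Notation zero := (fun=> 0).
Local Notation tauR := ((-1, 0) : int * int).
Local Notation KR := (KP tauR xsR bipart).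
Local Notation DR := (KD xsR (zero : A^o -> A^o)).

Definition dKR : differential DR := differential_K (differential0 A^o) xsR.

Lemma subcomplex_bipart :
  subcomplex tauR 0 [set y | y \in xsR] (zero : A^o -> A^o) bipart.
Proof.
split; [exact: bipart0|exact: bipartB|by move=> *; exact: bipart0|].
move=> y e v /= ys Rv; have := bipartM (bipart_x ys) Rv.
congr bipart; case: (e) => p q; rewrite -[LHS]/(1 + p, 0 + q).
by rewrite -[RHS]/(p + (0 - -1), q + (0 - 0)); congr pair; lia.
Qed.

Lemma subcomplex_KR : subcomplex tauR 0 [set y | y \in xsR] DR KR.
Proof. by apply: subcomplex_K => //; exact: subcomplex_bipart. Qed.

Lemma KR_direct : is_direct_sum KR.
Proof. exact: direct_sum_K bipart_direct. Qed.

Lemma KR_scale s a e f (w : Kmod s A^o) : bipart a f -> KP tauR s bipart e w ->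
  KP tauR s bipart (a + e) (f *: w).
Proof.
move=> Rf; elim: s e w => [|y s IH] e w; first exact: bipartM.
by case: w => u v [Pu Pv]; split; [exact: IH|rewrite -addrA; exact: IH].
Qed.

(** Cycles form a submodule of a noetherian module; the components of finitely
    many generators are bihomogeneous generators, and the coefficients can be
    replaced by their components. *)
Lemma cycles_generated : exists zs : seq ((int * int) * Kmod xsR A^o),
  (forall z, z \in zs -> KR z.1 z.2 /\ DR z.2 = 0) /\
  forall e w, KR e w -> DR w = 0 ->
    exists t : seq (A * ((int * int) * Kmod xsR A^o)),
      (forall y, y \in t -> y.2 \in zs /\ bipart (e - y.2.1) y.1) /\
      w = \sum_(y <- t) y.1 *: y.2.2.
Proof.
have [D1 D2 D3] := dKR.
have dK := KR_direct.
have [||l [lZ Zl]] := @noetherian_Kmod xsR [set w | DR w = 0].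
- split; first exact: addf0 D1.
    by move=> u v /= Du Dv; rewrite D1 Du Dv addr0.
  by move=> c v _ /= Dv; rewrite D2 Dv scaler0.
- by [].
pose zs := flatten [seq [seq (e, hcomp dK w e) | e <- supp dK w] | w <- l].
have compZ w e : DR w = 0 -> DR (hcomp dK w e) = 0.
  move=> Dw; have := @comp_morph _ _ _ _ _ _ dK dK DR id D1 (fun _ _ => id) _ w e.
  rewrite /= Dw => <-; first exact: addf0 (compD dK e).
  by move=> i u /(sub_D subcomplex_KR); rewrite addr0.
exists zs; split=> [z /flatten_mapP[w wl /mapP[e _ ->]]|e w Kw Dw].
  by split=> /=; [exact: comp_part|apply: compZ; exact: lZ].
pose H := [set w : Kmod xsR A^o | exists t : seq (A * ((int * int) * Kmod xsR A^o)),
  (forall y, y \in t -> y.2 \in zs) /\ w = \sum_(y <- t) y.1 *: y.2.2].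
have sH : submodule rees_gen H.
  split.
  - by exists [::]; rewrite big_nil.
  - move=> _ _ [t [tP ->]] [t' [tP' ->]]; exists (t ++ t'); rewrite big_cat.
    by split=> // y; rewrite mem_cat => /orP[/tP|/tP'].
  - move=> c _ _ [t [tP ->]]; exists [seq (c * y.1, y.2) | y <- t]; split.
      by move=> y /mapP[y' /tP y't ->].
    by rewrite big_map scaler_sumr; apply: eq_bigr => y _; rewrite scalerA.
have [H0 HD HZ] := sH.
have [t [tP wE]] : H w.
  have : span rees_gen l w by exact: Zl.
  apply: (span_min sH) => v vl; rewrite -(sum_comp dK v) big_seq.
  apply: big_ind => // e' e'v; exists [:: (1, (e', hcomp dK v e'))].
  rewrite big_seq1 scale1r; split=> // y /[1!inE] /eqP -> /=.
  apply/flatten_mapP; exists v => //; exact: map_f.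
exists [seq (hcomp bipart_direct y.1 (e - y.2.1), y.2) | y <- t]; split.
  by move=> y /mapP[y' /tP y't ->]; split=> //=; exact: comp_part.
rewrite big_map -(comp_eq dK Kw) wE (addf_sum (compD dK e)).
apply: eq_big_seq => y /tP /= /flatten_mapP[v vl /mapP[e' _ yE]].
have Ky : KR y.2.1 y.2.2 by rewrite yE; exact: comp_part.
rewrite -{1}(subrK y.2.1 e).
apply: (@comp_morph _ _ _ _ _ _ bipart_direct dK (fun f : A^o => f *: y.2.2)
  (fun a => a + y.2.1)).
- by move=> a b; rewrite scalerDl.
- exact: addIr.
- by move=> a f Rf; exact: KR_scale.
Qed.

Lemma boundaries_sum e (T : eqType) (t : seq T) (f : T -> Kmod xsR A^o) :
  (forall y, y \in t -> exists2 u, KR e u & DR u = f y) ->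
  exists2 u, KR e u & DR u = \sum_(y <- t) f y.
Proof.
have [D1 _ _] := dKR; have sK := subcomplex_KR.
move=> H; rewrite big_seq; apply: (big_ind (fun w => exists2 u, KR e u & DR u = w)).
- by exists 0; [exact: (sub_0 sK)|exact: addf0 D1].
- move=> _ _ [u Ku <-] [v Kv <-]; exists (u + v); first exact: (subD sK).
  exact: D1.
- by move=> y yt; exact: H.
Qed.

(** Write a cycle with finitely many bihomogeneous cycles as generators. If its
    first degree exceeds those of the generators, then the coefficients lie in
    the ideal of the [x i], which kills Koszul homology. If its second degree
    exceeds those of the generators, then the coefficients are combinations of
    the [F_j t], so that the cycle is a combination of cycles of the row
    below. *)
Lemma Koszul_bounds : exists P Q : int,
  (forall e, P < e.1 -> acyclic 0 DR KR e) /\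
  (forall e, Q < e.2 -> acyclic 0 DR KR (e - (0, 1)) -> acyclic 0 DR KR e).
Proof.
have [zs [zsP gen]] := cycles_generated.
have [D1 D2 D3] := dKR.
have [P HP] : exists P : int, forall z, z \in zs -> z.1.1 <= P.
  elim: (zs) => [|z l [P HP]]; first by exists 0.
  exists (Num.max z.1.1 P) => y; rewrite inE le_max => /orP[/eqP ->|/HP ->].
    by rewrite lexx.
  by rewrite orbT.
have [Q HQ] : exists Q : int, forall z, z \in zs -> z.1.2 <= Q.
  elim: (zs) => [|z l [Q HQ]]; first by exists 0.
  exists (Num.max z.1.2 Q) => y; rewrite inE le_max => /orP[/eqP ->|/HQ ->].
    by rewrite lexx.
  by rewrite orbT.
have sub_e (e e' c : int * int) : e - e' - c + e' = e - c.
  by rewrite addrAC subrK.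
exists P, Q; split=> e.
  move=> Pe w Kw Dw; have [t [tP ->]] := gen e w Kw Dw; rewrite subr0.
  apply: boundaries_sum => y /tP[yz Ry]; have [Kz Dz] := zsP _ yz.
  have e0 : 0 < (e - y.2.1).1.
    rewrite -[(_ - _).1]/(e.1 - y.2.1.1) subr_gt0.
    exact: le_lt_trans (HP _ yz) Pe.
  have [t' [tP' ->]] := bipart_lin_x e0 Ry; rewrite scaler_suml.
  apply: boundaries_sum => a /tP'[axs Ra].
  have Kaz : KR (e - (1, 0)) (a.2 *: y.2.2).
    by rewrite -(sub_e e y.2.1 (1, 0)); exact: KR_scale.
  have [||u Ku uE] := K_killed (X := [set y | y \in xsR]) (differential0 A^o)
    subcomplex_bipart _ axs Kaz _ => //.
    by rewrite D2 Dz scaler0.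
  exists u; last by rewrite uE scalerA.
  suff -> : e = e - (1, 0) - tauR by [].
  by case: (e) => p q; rewrite -[RHS]/(p - 1 - -1, q - 0 - 0); congr pair; lia.
move=> Qe He w Kw Dw; have [t [tP ->]] := gen e w Kw Dw; rewrite subr0.
apply: boundaries_sum => y /tP[yz Ry]; have [Kz Dz] := zsP _ yz.
have e0 : 0 < (e - y.2.1).2.
  rewrite -[(_ - _).2]/(e.2 - y.2.1.2) subr_gt0.
  exact: le_lt_trans (HQ _ yz) Qe.
have [t' [tP' ->]] := bipart_lin_F e0 Ry; rewrite scaler_suml.
apply: boundaries_sum => a /tP'[axs Ra].
have Kaz : KR (e - (0, 1)) (a.2 *: y.2.2).
  by rewrite -(sub_e e y.2.1 (0, 1)); exact: KR_scale.
have [|u Ku uE] := He _ Kaz; first by rewrite D2 Dz scaler0.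
exists (a.1 *: u); last by rewrite D2 uE scalerA.
have := KR_scale (bipart_F axs) Ku; congr (KP _ _ _ _ (_ *: u)).
by rewrite subr0 addrC subrK.
Qed.

(** * The coordinate ring of the image *)

Section SbarStandard.
Local Notation S := (Sbar F).
Local Notation SG := (Sbar_grading F).

Lemma Sbar_rees f : Sbar_subring F f -> rees_set F f.
Proof.
move=> /(_ (rees_subring F)); apply=> _ [[c _ <-]|[j _ <-]].
  by rewrite -rcstE; exact: sr_valP.
by rewrite -rFE; exact: sr_valP.
Qed.

Definition to_rees (a : S) : A := @sr_elt _ (rees_subring F) _ (Sbar_rees (sr_valP a)).

Lemma to_reesD : {morph to_rees : a b / a + b}.
Proof. by move=> a b; apply: rees_eq. Qed.

Lemma to_reesM a b : to_rees (a * b) = to_rees a * to_rees b.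
Proof. exact: rees_eq. Qed.

Lemma to_rees_bipart q a : SG q a -> bipart (0, q%:Z) (to_rees a).
Proof.
move=> qa; exists (sr_val a)`_q; last exact: (tmonoP qa).
by rewrite add0n; apply: (Sbar_deg R_std F_hom); exact: sr_valP.
Qed.

Definition Sgen_subproof j : Sbar_subring F (F j *: 'X).
Proof. by move=> C; apply; right; exists j. Qed.

Definition Sgen j : S := @sr_elt _ (Sbar_subring F) _ (Sgen_subproof j).

Lemma to_rees_Sgen j : to_rees (Sgen j) = rF j.
Proof. by apply: rees_eq; rewrite rFE. Qed.

Lemma Sgen_deg j : SG 1%N (Sgen j).
Proof. by exists (F j); rewrite expr1. Qed.

Lemma rees0_Sbar q (f : A) : rees_part G d 0 q f -> Sbar_subring F (sr_val f).
Proof.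
elim: q f => [|q IH] f.
  move=> [c]; have [-> _ _] := R_std => -[b _ <-] ->.
  by move=> C; apply; left; exists b => //; rewrite expr0 alg_polyC.
move=> /rees_part_F[t [tP ->]]; rewrite (addf_sum rees_valD).
apply: sr_sum => z /tP[/mapP[j _ ->] Rz].
rewrite -[sr_val _]/(sr_val (rF j) * sr_val z.2) rFE.
by apply: sr_mul; [exact: Sgen_subproof|exact: IH].
Qed.

Definition of_rees q (f : A) (Rf : rees_part G d 0 q f) : S :=
  @sr_elt _ (Sbar_subring F) _ (rees0_Sbar Rf).

Lemma to_rees_inj : injective to_rees.
Proof. by move=> a b E; apply: val_inj; exact: (congr1 (fun f : A => sr_val f) E). Qed.

Lemma to_rees_onto q f : bipart (0, q%:Z) f -> exists2 a, SG q a & to_rees a = f.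
Proof.
move=> Rf; exists (of_rees (q := q) Rf); last exact: rees_eq.
by have [c _ fE] := Rf; exists c.
Qed.

(** [S] is the part of the Rees algebra of first degree 0, where each element
    of positive second degree is a combination of the [F_j t]. *)
Lemma Sbar_split q a : SG q.+1 a -> exists t : seq ('I_m.+1 * S),
  (forall z, z \in t -> SG q z.2) /\ a = \sum_(z <- t) Sgen z.1 * z.2.
Proof.
move=> qa.
have /rees_part_F[t [tP aE]] : rees_part G d 0 q.+1 (to_rees a) := to_rees_bipart qa.
have /choice[r rP] (z : A * A) : exists r : 'I_m.+1 * S, z \in t ->
    [/\ rF r.1 = z.1, SG q r.2 & to_rees r.2 = z.2].
  have [/tP[/mapP[j _ zE] Rz]|] := boolP (z \in t); last by exists (ord0, 0).
  have [b qb bz] := to_rees_onto Rz.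
  by exists (j, b).
exists (map r t); split; first by move=> _ /mapP[z /rP[_ + _] ->].
apply: to_rees_inj; rewrite (addf_sum to_reesD) big_map aE; apply: eq_big_seq => z zt.
by have [<- _ <-] := rP z zt; rewrite to_reesM to_rees_Sgen.
Qed.

Fixpoint monomials q : seq S :=
  if q is r.+1 then [seq Sgen j * u | j <- enum 'I_m.+1, u <- monomials r]
  else [:: 1].

Lemma monomials_deg q u : u \in monomials q -> SG q u.
Proof.
elim: q u => [|q IH] u /=; first by rewrite inE => /eqP ->; exact: (gr_one SG).
by move=> /allpairsP[[j v] [_ /IH qv ->]]; exact: (gr_mul (g := SG) (Sgen_deg j) qv).
Qed.

Lemma monomials_span q a J : is_ideal J -> (forall u, u \in monomials q -> J u) ->
  SG q a -> J a.
Proof.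
elim: q a J => [|q IH] a J iJ Ju qa.
  by rewrite -[a]mulr1; case: iJ => _ _; apply; apply: Ju; rewrite mem_head.
have [t [tP ->]] := Sbar_split qa; have [J0 JD JM] := iJ.
apply: ideal_sum => // z /tP qz.
apply: (IH z.2 [set b | J (Sgen z.1 * b)]) => // [|u uq].
  split=> [|b c /= Jb Jc|b c /= Jc]; rewrite /= ?mulr0 ?mulrDr //.
    exact: JD.
  by rewrite mulrCA; exact: JM.
apply: Ju; apply/allpairsP; exists (z.1, u); split=> //=.
by rewrite mem_enum.
Qed.

(** The product of [S_q] and [S_r] generates [S_(q+r)], since [S] is standard
    graded. *)
Lemma degreeD_span q r w J : is_ideal J ->
  (forall u v, SG q u -> SG r v -> J (u * v)) -> SG (q + r)%N w -> J w.
Proof.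
elim: q w J => [|q IH] w J iJ H qw.
  by rewrite -[w]mul1r; apply: H => //; exact: (gr_one SG).
have [t [tP ->]] := Sbar_split qw; have [J0 JD JM] := iJ.
apply: ideal_sum => // z /tP qz.
apply: (IH z.2 [set b | J (Sgen z.1 * b)]) => // [|u v qu rv].
  split=> [|b c /= Jb Jc|b c /= Jc]; rewrite /= ?mulr0 ?mulrDr //.
    exact: JD.
  by rewrite mulrCA; exact: JM.
by rewrite /= mulrA; apply: H => //; exact: (gr_mul (g := SG) (Sgen_deg _) qu).
Qed.

(** The irrelevant ideal of [S] is generated in degree 1. *)
Lemma degree1_not_in (p : set S) : Proj SG p -> exists2 y, SG 1%N y & ~ p y.
Proof.
move=> [[pid _ _] _ pirr]; apply: contrapT => no; apply: pirr.
apply: (ideal_gen_min pid) => a [t t0 ta].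
have := ta; rewrite -(prednK t0) -add1n; apply: degreeD_span => // u v u1 _.
rewrite mulrC; have [_ _ pM] := pid; apply: pM.
by apply: contrapT => npu; apply: no; exists u.
Qed.

End SbarStandard.

(** * Powers and fibers inside the Rees algebra *)

Lemma acyclic_reindex (A' : comPzRingType) (V : lmodType A') (s : seq A')
    (D : Kmod s V -> Kmod s V) (J J' : comPzRingType) (tau : J) (tau' : J')
    (h : J -> J') (P : J' -> set V) j :
  (forall j, h (j + tau) = h j + tau') ->
  acyclic 0 D (KP tau s (fun j => P (h j))) j <->
  acyclic 0 D (KP tau' s P) (h j).
Proof.
move=> hh; have E i w := @KP_reindex A' J J' tau tau' h s V P hh i w.
split=> H w Pw Dw.
  have [|u Pu <-] := H w _ Dw; first exact/E.
  by exists u => //; rewrite subr0; apply/E; move: Pu; rewrite subr0.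
have [|u Pu <-] := H w _ Dw; first exact/E.
by exists u => //; rewrite subr0; apply/E; move: Pu; rewrite subr0.
Qed.

(** Multiplication by [t^q] identifies [I^q], with degrees counted from [q * d],
    with the row of second degree [q] of the Rees algebra. *)
Lemma Koszul_ideal_exp q p :
  acyclic 0 (KD xs zero) (KP (-1) xs (gm_part (ideal_exp_grmod F_hom q)))
    (p + (q * d)%N%:Z) <->
  acyclic 0 DR KR (p, q%:Z).
Proof.
pose M := ideal_exp_grmod F_hom q.
pose D0 := KD xs (zero : M -> M).
have h1 j : j + -1 + (q * d)%N%:Z = j + (q * d)%N%:Z + -1 by lia.
rewrite -(@acyclic_reindex R M xs D0 int int (-1) (-1)
  (fun p => p + (q * d)%N%:Z) (gm_part M) p h1).
have h2 j : (j + -1, q%:Z) = (j, q%:Z) + tauR.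
  by rewrite -[RHS]/(j + -1, q%:Z + 0) addr0.
rewrite -(@acyclic_reindex A A^o xsR DR int (int * int)%type (-1) tauR
  (fun p => (p, q%:Z)) bipart p h2).
have valI (a : M) : ideal_exp I q (id_val a) by exact: id_valP.
apply: (@acyclic_Kmap R A rcst M A^o (fun a : M => rmono q (id_val a)) _ _
  int (-1) 0 (fun p => gm_part M (p + (q * d)%N%:Z)) (fun p => bipart (p, q%:Z))
  [set y | y \in xs]) => //.
- by move=> a b; exact: rmonoD (valI a) (valI b).
- by move=> r a; exact: rmonoZ r _ (valI a).
- have [S0 SB SD SX] := subcomplex_gm M (s := xs) xs1.
  split=> [j|j u v|j v _|y j v ys Pv]; [exact: S0|exact: SB|exact: S0|].
  by have := SX _ _ _ ys Pv; congr gm_part; lia.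
- move=> j a; rewrite /bipart /= andbT; case: ifP => j0 Pa.
    apply/rees_partE; exists (id_val a) => //; split=> //.
    have {Pa} : zpart G (j + (q * d)%N%:Z) (id_val a) := Pa.
    by have -> : j + (q * d)%N%:Z = (absz j + q * d)%N by lia.
  suff a0 : id_val a = 0 by apply: rees_eq; rewrite a0 rmonoE ?scale0r // -a0.
  have {Pa} : zpart G (j + (q * d)%N%:Z) (id_val a) := Pa.
  case E : (j + _) => [l|l] //= Ga.
  by apply: (Iq_low (valI a) Ga); move: j0 E; lia.
- move=> j w; rewrite /bipart /= andbT; case: ifP => j0.
    move=> /rees_partE[a [Ia Ga] ->].
    pose a' : M := IdealElt (introT (asboolP _) Ia).
    exists a' => //; suff : zpart G (j + (q * d)%N%:Z) a by [].
    by have -> : j + (q * d)%N%:Z = (absz j + q * d)%N by lia.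
  move=> ->; exists (0 : M); first exact: (gm_0 M).
  have E : id_val (0 : M) = 0 by exact: id_val0.
  by apply: rees_eq; rewrite E rmonoE ?scale0r // -E.
- by move=> v; apply: rees_eq; rewrite (id_val0 (ideal_expP I q)) rmonoE
    ?scale0r //; have [] := ideal_expP I q.
- move=> j v _ v0; have := congr1 (fun f : A => (sr_val f)`_q) v0.
  rewrite rmonoE // coefZ coefXn eqxx mulr1 coef0 => E.
  apply: val_inj; rewrite [LHS]E; apply/esym; exact: id_val0.
Qed.

Lemma Koszul_base p :
  acyclic 0 (KD xs zero) (KP (-1) xs (zpart G : int -> set R^o)) p <->
  acyclic 0 DR KR (p, 0).
Proof.
have h2 j : (j + -1, 0) = (j, 0) + tauR by rewrite -[RHS]/(j + -1, 0 + 0) addr0.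
rewrite -(@acyclic_reindex A A^o xsR DR int (int * int)%type (-1) tauR
  (fun p => (p, 0)) bipart p h2).
apply: (@acyclic_Kmap R A rcst R^o A^o rcst _ _
  int (-1) 0 (zpart G : int -> set R^o) (fun p => bipart (p, 0))
  [set y | y \in xs]) => //.
- exact: rcstD.
- exact: rcstM.
- exact: (subcomplex_gm (self_grmod G) xs1).
- case=> [j|j] a; rewrite /bipart /= => Ga; last by rewrite Ga (addf0 rcstD).
  by apply/rees_partE; exists a => //; split=> //; rewrite mul0n addn0.
- case=> [j|j] w; rewrite /bipart /=; last first.
    by move=> ->; exists 0; rewrite ?(addf0 rcstD).
  by move=> /rees_partE[a [_ Ga] ->]; exists a => //; move: Ga; rewrite mul0n addn0.
- by move=> v; exact: addf0 rcstD.
- move=> j v _ v0; have := congr1 (fun f : A => (sr_val f)`_0) v0.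
  by rewrite rcstE coefC coef0.
Qed.

Section FiberTransfer.
Variable pt : closed_point (Sbar_grading F).
Local Notation W := (fiber_den pt).
Local Notation L := (localization W).
Local Notation Fib := (fiber pt).
Local Notation FG := (fiber_grading R_std F_hom pt).
Local Notation dval s := (sr_val (Loc.den_val s)).

Definition over (s : Loc.den W) (f : A^o) : L^o := Loc.frac f s.
Definition loc1 (f : A) : L := Loc.frac f (Loc.den1 W).

Lemma overD s : {morph over s : f g / f + g}.
Proof.
move=> f g; rewrite /over -[RHS]/(Loc.addl _ _) Loc.addlE.
by apply: Loc.frac_eq => /=; ring.
Qed.

Lemma overX s f g : over s (f *: g) = loc1 f *: over s g.
Proof.
rewrite /over /loc1 -[RHS]/(Loc.mull _ _) Loc.mullE.
by apply: Loc.frac_eq => /=; rewrite /GRing.scale /=; ring.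
Qed.

Lemma over_den s t f : over (Loc.denM s t) (Loc.den_val t *: f) = over s f.
Proof. by apply: Loc.frac_eq => /=; rewrite /GRing.scale /=; ring. Qed.

Lemma den_bipart (s : Loc.den W) q : tmono q (dval s) -> bipart (0, q%:Z) (Loc.den_val s).
Proof. exact: (rees_part_den R_std F_hom). Qed.

Lemma den_tmono (s : Loc.den W) : exists q, tmono q (dval s).
Proof. by have [u [<- [q uq] _]] := Loc.denP s; exists q. Qed.

Definition fcst_subproof r : fiber_subring pt (loc1 (rcst r)).
Proof.
exists 0%N, (rcst r), (Loc.den1 W); split=> //; last exact: tmono1.
by exists r; rewrite rcstE expr0 alg_polyC.
Qed.

Definition fcst (r : R) : Fib := sr_elt (fcst_subproof r).
Definition xsFib : seq Fib := map fcst xs.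
Definition xsL : seq L := map loc1 xsR.

Lemma xsL_E : map (@sr_val _ _) xsFib = xsL.
Proof. by rewrite /xsL /xsFib /xsR -!map_comp. Qed.

(** The grading of the fiber, seen inside the full localization: fractions can
    be added and multiplied there without proofs of membership. *)
Definition loc_part (l : int) : set L^o := [set y | exists q f (s : Loc.den W),
  [/\ bipart (l, q%:Z) f, tmono q (dval s) & y = over s f]].

Lemma fcst_degree e r : G e r -> FG e (fcst r).
Proof.
move=> Gr; exists 0%N, (rcst r), (Loc.den1 W); split=> //; last exact: tmono1.
by exists r; rewrite ?mul0n ?addn0 // rcstE expr0 alg_polyC.
Qed.

Lemma loc_part_fiber l (y : Fib) : zpart FG l y <-> loc_part l (sr_val y).
Proof.
case: l => [e|e]; split.
- move=> [q [f [s [Rf sq yE]]]]; exists q, f, s; split=> //.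
- by move=> [q [f [s [Rf sq yE]]]]; exists q, f, s.
- move=> ->; exists 0%N, 0, (Loc.den1 W); split=> //; exact: tmono1.
- move=> [q [f [s [-> sq yE]]]]; apply: val_inj.
  by rewrite /= yE (addf0 (@overD s)).
Qed.

Lemma Koszul_fiber p :
  acyclic 0 (KD xsFib zero) (KP (-1) xsFib (zpart FG : int -> set Fib^o)) p <->
  acyclic 0 (KD xsL zero) (KP (-1) xsL loc_part) p.
Proof.
rewrite -xsL_E.
apply: (@acyclic_Kmap Fib L (@sr_val _ _) Fib^o L^o (@sr_val _ _) _ _
  int (-1) 0 (zpart FG : int -> set Fib^o) loc_part [set y | y \in xsFib]) => //.
- apply: (subcomplex_gm (self_grmod FG)) => _ /mapP[r rs ->].
  exact/fcst_degree/xs1.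
- by move=> l y /loc_part_fiber.
- move=> l w Lw.
  have wF : fiber_subring pt w.
    have [q [f [s [Rf sq ->]]]] := Lw; exists q, f, s; split=> //.
    move: Rf; rewrite /bipart /=; case: ifP => [_ [c _ ->]|_ ->]; first by exists c.
    exact: tmono0.
  by exists (sr_elt wF) => //; exact/loc_part_fiber.
- by move=> l v _ v0; exact: val_inj.
Qed.

Lemma generated_xsFib : generated_by FG xsFib.
Proof.
split=> [_ /mapP[r rs ->]|l y]; first exact/fcst_degree/xs1.
move=> [q [f [s [Rf sq yE]]]].
have [t [tP fE]] := rees_part_x Rf.
have hF (g : A) : fiber_subring pt (over s (if pselect (rees_part G d l q g) then g else 0)).
  exists q, (if pselect (rees_part G d l q g) then g else 0), s; split=> //.
  case: pselect => [Rg|nRg]; last exact: tmono0.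
  by have [c _ gE] := Rg; exists c.
pose h g : Fib := sr_elt (hF g).
have hE g : rees_part G d l q g -> sr_val (h g) = over s g.
  by move=> Rg /=; case: pselect.
have /choice[r rP] z : exists r, z \in t -> r \in xs /\ rcst r = z.1.
  have [/tP[/mapP[r rs zE] _]|] := boolP (z \in t); first by exists r.
  by exists 0.
exists [seq (fcst (r z), h z.2) | z <- t]; split.
  move=> _ /mapP[z zt ->]; have [rx _] := rP z zt; have [_ Rz] := tP z zt.
  split; first exact: map_f.
  exists q, z.2, s; split=> //; exact: hE.
apply: val_inj; rewrite /= yE -[LHS]/(over s f) fE (addf_sum (@overD s)).
rewrite big_map fiber_val_sum; apply: eq_big_seq => z zt.
have [_ rz] := rP z zt; have [_ Rz] := tP z zt.
rewrite overX -rz -[RHS]/(sr_val (fcst (r z)) * sr_val (h z.2)).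
by rewrite hE.
Qed.

Definition fiber_base : subring Fib.
Proof.
refine (@Subring _ [set fcst c | c in G 0%N] _ _ _).
- by exists 1; [exact: gr_one|apply: val_inj; rewrite /= rcst1].
- move=> _ _ [a Ga <-] [b Gb <-]; exists (a - b).
    exact: partB (gr_direct G) _ _ _ Ga Gb.
  apply: val_inj; rewrite -[RHS]/(sr_val (fcst a) - sr_val (fcst b)) /=.
  by rewrite (addfB rcstD) -[LHS]/(over _ _) (addfB (@overD _)).
- move=> _ _ [a Ga <-] [b Gb <-]; exists (a * b); first exact: (gr_mul Ga Gb).
  apply: val_inj; rewrite -[RHS]/(sr_val (fcst a) * sr_val (fcst b)) /= rcstM.
  exact: (overX (Loc.den1 W)).
Defined.

Lemma fiber_base_field c : fiber_base c ->
  c = 0 \/ exists2 c', fiber_base c' & c' * c = 1.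
Proof.
move=> [a Ga <-]; have [->|[b Gb ba]] := base_field Ga.
  left; apply: val_inj; rewrite /= (addf0 rcstD).
  exact: addf0 (@overD (Loc.den1 W)).
right; exists (fcst b); first by exists b.
apply: val_inj; rewrite -[LHS]/(sr_val (fcst b) * sr_val (fcst a)) /=.
by rewrite -[LHS]/(loc1 _ *: over _ _) -overX -[_ *: _]/(_ * _) -rcstM ba rcst1.
Qed.

Lemma fiber_base_degree0 c : fiber_base c -> FG 0%N c.
Proof.
by move=> [a Ga <-]; exact: fcst_degree.
Qed.

Lemma Kmap_over_den l s t (w : Kmod l A^o) :
  Kmap loc1 (over (Loc.denM s t)) l (Loc.den_val t *: w) =
  Kmap loc1 (over s) l w.
Proof.
elim: l w => [|y l IH] w; first exact: over_den.
by case: w => u v /=; congr pair; exact: IH.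
Qed.

(** Multiplying by denominators leaves the first degree unchanged and only
    moves an element to another row. *)
Lemma common_denominator l e z : KP (-1) (map loc1 l) loc_part e z ->
  exists q (s : Loc.den W) (w : Kmod l A^o),
    [/\ tmono q (dval s), KP tauR l bipart (e, q%:Z) w &
        Kmap loc1 (over s) l w = z].
Proof.
elim: l e z => [|y l IH] e z.
  by move=> [q [f [s [Rf sq ->]]]]; exists q, s, f.
case: z => z1 z2 [/= /IH[q [s [w [sq Kw <-]]]] /IH[r [t [v [tr Kv <-]]]]].
exists (q + r)%N, (Loc.denM s t), (Loc.den_val t *: w, Loc.den_val s *: v).
split; first exact: tmonoM.
- split=> /=.
    have := KR_scale (den_bipart tr) Kw; congr (KP _ _ _ _ _).
    by rewrite -[LHS]/(0 + e, r%:Z + q%:Z) add0r addrC.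
  have := KR_scale (den_bipart sq) Kv; congr (KP _ _ _ _ _).
  rewrite -[LHS]/(0 + (e + -1), q%:Z + r%:Z) add0r.
  by rewrite -[RHS]/(e + -1, (q + r)%N%:Z + 0) addr0.
- congr pair; rewrite /=; first exact: Kmap_over_den.
  by rewrite Loc.denC; exact: Kmap_over_den.
Qed.

Lemma localization_kernel l s (w : Kmod l A^o) :
  Kmap loc1 (over s) l w = 0 -> exists u : Loc.den W, Loc.den_val u *: w = 0.
Proof.
elim: l w => [|y l IH] w.
  rewrite /= -(addf0 (@overD (Loc.den1 W))) => /Loc.fracE[u Wu].
  rewrite /= mulr1 mul0r mulr0 => uw.
  by exists (Loc.mkden Wu).
case: w => w1 w2 [/IH[u1 E1] /IH[u2 E2]]; exists (Loc.denM u1 u2).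
congr pair; rewrite /=; last by rewrite -scalerA E2 scaler0.
by rewrite mulrC -scalerA E1 scaler0.
Qed.

Lemma over_part s q l e (w : Kmod l A^o) : tmono q (dval s) ->
  KP tauR l bipart (e, q%:Z) w -> KP (-1) (map loc1 l) loc_part e (Kmap loc1 (over s) l w).
Proof.
move=> sq; elim: l e w => [|y l IH] e w; first by move=> Rw; exists q, w, s.
case: w => u v [/= Pu Pv]; split=> /=; first exact: IH.
by apply: IH; move: Pv; rewrite -[_ + tauR]/(e + -1, q%:Z + 0) addr0.
Qed.

Lemma over_diff s (w : Kmod xsR A^o) :
  KD xsL zero (Kmap loc1 (over s) xsR w) = Kmap loc1 (over s) xsR (DR w).
Proof.
rewrite (Kmap_diff (@overD s) (@overX s) (D2 := zero)) // => v.
exact: addf0 (@overD s).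
Qed.

Lemma Kmap_overD s : {morph Kmap loc1 (over s) xsR : u v / u + v}.
Proof. exact: KmapD (@overD s) _. Qed.

Lemma den_of_degree q : exists s : Loc.den W, tmono q (dval s).
Proof.
have [y y1 npy] := degree1_not_in (cp_Proj pt).
have Wy : W (to_rees y) by exists y; split=> //; exists 1%N.
elim: q => [|q [s sq]]; first by exists (Loc.den1 _); exact: tmono1.
by exists (Loc.denM (Loc.mkden Wy) s); rewrite -add1n; exact: tmonoM.
Qed.

(** A cycle of the fiber is a fraction. Multiplied by a suitable denominator,
    its numerator becomes a cycle of the Rees algebra, in a row as high as
    desired, where it is a boundary. *)
Lemma fiber_acyclic p q0 : (forall q, (q0 <= q)%N -> acyclic 0 DR KR (p, q%:Z)) ->
  acyclic 0 (KD xsL zero) (KP (-1) xsL loc_part) p.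
Proof.
move=> H z Kz Dz; have [D1 D2 D3] := dKR.
have [q [s [w [sq Kw wz]]]] := common_denominator Kz.
have [u uDw] : exists u : Loc.den W, Loc.den_val u *: DR w = 0.
  by apply: (@localization_kernel _ s); rewrite -over_diff wz.
have [r ur] := den_tmono u.
have [v vQ] := den_of_degree q0.
pose c := Loc.denM v u.
have cQ : tmono (q0 + r) (dval c) by exact: tmonoM.
have Kcw : KR (p, (q0 + r + q)%N%:Z) (Loc.den_val c *: w).
  have := KR_scale (den_bipart cQ) Kw; congr (KP _ _ _ _ _).
  by rewrite -[LHS]/(0 + p, (q0 + r)%N%:Z + q%:Z) add0r.
have [||b Kb bE] := H (q0 + r + q)%N _ _ Kcw; first by lia.
  by rewrite D2 /= -scalerA uDw scaler0.
rewrite subr0 in Kb.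
exists (Kmap loc1 (over (Loc.denM s c)) xsR b).
  rewrite subr0; apply: over_part Kb; rewrite addnC; exact: tmonoM.
by rewrite over_diff bE Kmap_over_den.
Qed.

End FiberTransfer.

(** * Homology classes that persist at a closed point *)

Section ClosedPoint.
Local Notation S := (Sbar F).
Local Notation SG := (Sbar_grading F).

(** By the last condition [J] contains no power of the irrelevant ideal, that
    is, [J] defines a nonempty subset of [Proj S]. *)
Definition proper_homogeneous (J0 J : set S) :=
  [/\ is_ideal J, graded_sub SG J, J0 `<=` J &
      forall q, exists2 a, SG q a & ~ J a].

(** Zorn's lemma applies because [S_q] is spanned by finitely many monomials: if
    the union of a chain contained [S_q], then so would a member. *)
Lemma maximal_homogeneous J0 : proper_homogeneous J0 J0 ->
  exists p, proper_homogeneous J0 p /\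
    forall J, proper_homogeneous J0 J -> p `<=` J -> J `<=` p.
Proof.
move=> gJ0.
(* [set0] is there for the empty chain *)
pose P (X : set S) := X = set0 \/ proper_homogeneous J0 X.
have [|p [[p0|gp] pmax]] := @Zorn_bigcup S P.
- move=> Fm FP Ft.
  have [[X0 [FX0 gX0]]|no] := pselect (exists X, Fm X /\ proper_homogeneous J0 X);
    last first.
    left; apply/seteqP; split=> // v [X FX Xv].
    have [X0|gX] := FP _ FX; first by rewrite X0 in Xv.
    by apply: no; exists X.
  have good X v : Fm X -> X v -> proper_homogeneous J0 X.
    by move=> FX Xv; have [X0'|//] := FP _ FX; rewrite X0' in Xv.
  have [[X00 _ _] _ J0X0 _] := gX0.
  right; split.
  + split; first by exists X0.
    * move=> a b [X FX Xa] [Y FY Yb].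
      have [[_ XD _] _ _ _] := good _ _ FX Xa.
      have [[_ YD _] _ _ _] := good _ _ FY Yb.
      have [XY|YX] := Ft _ _ FX FY.
        by exists Y => //; apply: YD => //; exact: XY.
      by exists X => //; apply: XD => //; exact: YX.
    * move=> a b [X FX Xb]; have [[_ _ XM] _ _ _] := good _ _ FX Xb.
      by exists X => //; exact: XM.
  + move=> v [X FX Xv]; have [_ Xg _ _] := good _ _ FX Xv.
    have [t [tP vE]] := Xg v Xv; exists t; split=> // u /tP[Xu Pu].
    by split=> //; exists X.
  + by move=> v /J0X0 X0v; exists X0.
  + move=> q; apply: contrapT => no.
    have all a : SG q a -> (\bigcup_(X in Fm) X) a.
      by move=> qa; apply: contrapT => na; apply: no; exists a.
    have [X [FX gX HX]] : exists X, [/\ Fm X, proper_homogeneous J0 X &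
        forall u, u \in monomials q -> X u].
      have := @monomials_deg q; elim: (monomials q) => [|u l IH] ld.
        by exists X0.
      have [|X [FX gX HX]] := IH; first by move=> v vl; apply: ld; rewrite inE vl orbT.
      have [Y FY Yu] := all u (ld u (mem_head _ _)).
      have gY := good _ _ FY Yu.
      have [XY|YX] := Ft _ _ FX FY.
        by exists Y; split=> // v /[1!inE] /orP[/eqP ->//|/HX]; exact: XY.
      by exists X; split=> // v /[1!inE] /orP[/eqP ->|/HX//]; exact: YX.
    have [iX _ _ /(_ q)[a qa nXa]] := gX.
    by apply: nXa; exact: monomials_span iX HX qa.
- have [[J00 _ _] _ _ _] := gJ0.
  exfalso; apply: (pmax J0); last by right.
  by rewrite p0; split=> // /(_ 0 J00).
exists p; split=> // J gJ pJ v Jv; apply: contrapT => npv.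
apply: (pmax J); last by right.
by split=> // Jp; apply: npv; exact: Jp.
Qed.

Lemma exprG q a r : SG q a -> SG (q * r)%N (a ^+ r).
Proof.
move=> qa; elim: r => [|r IH]; first by rewrite muln0; exact: (gr_one SG).
by rewrite mulnS exprS; exact: gr_mul.
Qed.

(** Let [p] be maximal. If homogeneous [a] and [b] are not in [p], then
    [p + (a)] contains some [S_q] and [p + (b)] some [S_r], so [p + (a b)] contains
    [S_(q+r)] and [a b] is not in [p]; hence [p] is prime. A point of [Proj S]
    whose ideal contains [p] is equal to [p], so [p] is closed. *)
Lemma closed_point_over J0 : proper_homogeneous J0 J0 ->
  exists pt : closed_point SG, J0 `<=` pt.
Proof.
move=> /maximal_homogeneous[p [gp pmax]].
have [ip pg J0p np] := gp; have [p0 pD pM] := ip.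
have p1 : ~ p 1.
  move=> p1; have [a _ npa] := np 0%N; apply: npa.
  by rewrite -[a]mulr1; exact: pM.
(* for homogeneous [a] outside [p], the ideal [p + (a)] contains some [S_q] *)
have bigger i a : SG i a -> ~ p a ->
    exists q, forall u, SG q u -> exists2 c, p (u - c * a) & True.
  move=> ia npa; apply: contrapT => no.
  pose J := [set u | exists2 c, p (u - c * a) & True].
  apply: npa; apply: (pmax J); last first.
    by exists 1 => //; rewrite mul1r subrr.
    by move=> u pu; exists 0 => //; rewrite mul0r subr0.
  split.
  - split; first by exists 0 => //; rewrite mul0r subrr.
      move=> u v [c pc _] [e pe _]; exists (c + e) => //.
      by rewrite mulrDl opprD addrACA; exact: pD.
    move=> b u [c pc _]; exists (b * c) => //.
    by rewrite -mulrA -mulrBr; exact: pM.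
  - move=> v [c pc _].
    have [t [tP E]] := pg _ pc.
    exists (t ++ [seq hcomp (gr_direct SG) c j * a | j <- supp (gr_direct SG) c]).
    split=> [u|]; last first.
      rewrite big_cat /= big_map -mulr_suml sum_comp -E subrK //.
    rewrite mem_cat => /orP[/tP[pu [j ju]]|/mapP[j _ ->]].
      by split; [exists 0 => //; rewrite mul0r subr0|exists j].
    split; first by exists (hcomp (gr_direct SG) c j) => //; rewrite subrr.
    by exists (j + i)%N; apply: gr_mul => //; exact: comp_part.
  - by move=> u /J0p pu; exists 0 => //; rewrite mul0r subr0.
  - move=> q; apply: contrapT => all; apply: no; exists q => u qu.
    by apply: contrapT => nu; apply: all; exists u.
have pp : prime_ideal p.
  apply: (graded_prime ip pg p1) => i j a b ia jb pab.
  apply: contrapT => /not_orP[npa npb].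
  have [q Hq] := bigger _ _ ia npa; have [r Hr] := bigger _ _ jb npb.
  have [w qrw] := np (q + r)%N; apply.
  apply: (degreeD_span ip _ qrw) => u v /Hq[c pc _] /Hr[e pe _].
  have -> : u * v = v * (u - c * a) + (c * a) * (v - e * b) + (c * e) * (a * b).
    by ring.
  by apply: (pD); [apply: (pD)|]; exact: pM.
have irr J q : is_ideal J -> (forall a b, J (a * b) -> J a \/ J b) -> ~ J 1 ->
    (forall a, SG q a -> J a) -> irrelevant SG `<=` J.
  move=> iJ Jp J1 Jq; apply: (ideal_gen_min iJ) => a [t t0 ta].
  have Jpow r : J (a ^+ r) -> J a.
    by elim: r => [/J1//|r IH]; rewrite exprS => /Jp[].
  apply: (Jpow q).
  have := exprG q ta; have -> : (t * q = q + (t - 1) * q)%N.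
    by case: (t) t0 => // t' _; rewrite mulSn subn1.
  apply: degreeD_span => // u v qu _; rewrite mulrC.
  by case: iJ => _ _; apply; exact: Jq.
have pP : Proj SG p.
  split=> // Hirr; have [a a1 npa] := np 1%N; apply: npa.
  by apply: Hirr; apply: ideal_gen_in; exists 1%N.
have pc : Proj_closed SG [set p].
  exists p; split=> //; apply/seteqP; split=> [_ ->|p' [[[ip' p'1 p'p] p'g nirr] pp']].
    by split.
  rewrite /=; apply/seteqP; split=> //; apply: pmax => //.
  split=> //; first by move=> v /J0p /pp'.
  move=> q; apply: contrapT => no; apply: nirr; apply: (irr p' q) => // a qa.
  by apply: contrapT => na; apply: no; exists a.
by exists (ClosedPoint pP pc).
Qed.

Definition boundary (w : Kmod xsR A^o) := exists u, DR u = w.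

Lemma boundary_homogeneous e w : KR e w -> boundary w ->
  exists2 u, KR e u & DR u = w.
Proof.
have [D1 D2 D3] := dKR; have dK := KR_direct.
move=> Kw [u uw]; exists (hcomp dK u e); first exact: comp_part.
rewrite -(comp_eq dK Kw) -uw; apply/esym.
apply: (@comp_morph _ _ _ _ _ _ dK dK DR id D1 (fun _ _ => id)) => i v Kv.
by have := sub_D subcomplex_KR Kv; rewrite addr0.
Qed.

Lemma boundary_submodule : submodule rees_gen (boundary : set (Kmod xsR A^o)).
Proof.
have [D1 D2 D3] := dKR; split.
- by exists 0; exact: addf0 D1.
- by move=> _ _ [u <-] [v <-]; exists (u + v); exact: D1.
- by move=> c _ _ [u <-]; exists (c *: u); exact: D2.
Qed.

Lemma boundaryZ f w : boundary w -> boundary (f *: w).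
Proof.
by have [_ _ H] := boundary_submodule => bw; apply: H => //; exact: rees_gen_full.
Qed.

Lemma KR_neg l e w : e.2 < 0 -> KP tauR l bipart e w -> w = 0.
Proof.
elim: l e w => [|y l IH] e w e0.
  by rewrite /= /bipart [0 <= e.2]leNgt e0 andbF.
case: w => u v [/= Pu Pv]; congr pair; first exact: IH Pu.
by apply: IH Pv; rewrite -[(_ + _).2]/(e.2 + 0) addr0.
Qed.

(** In a row of large second degree, a cycle of first degree [p] is modulo
    boundaries a combination of generating cycles of first degree [p], with
    coefficients in [S] of large degree. If each of these generators were
    killed by all elements of [S] of large degree, then the rows would be
    exact at [p] from some [q] on. *)
Lemma persistent_cycle p : (forall q0, exists2 q, (q0 <= q)%N &
    ~ acyclic 0 DR KR (p, q%:Z)) ->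
  exists (q1 : nat) (g : Kmod xsR A^o), [/\ KR (p, q1%:Z) g, DR g = 0 &
    forall r, exists2 f, bipart (0, r%:Z) f & ~ boundary (f *: g)].
Proof.
have [D1 D2 D3] := dKR; have [B0 BD BZ] := boundary_submodule.
move=> nac; apply: contrapT => no.
have [zs [zsP gen]] := cycles_generated.
have [N HN] : exists N : nat, forall z, z \in zs -> z.1.1 = p ->
    forall r, (N <= r)%N -> forall f, bipart (0, r%:Z) f -> boundary (f *: z.2).
  elim: (zs) zsP => [|z l IH] lP; first by exists 0%N.
  have [|N HN] := IH; first by move=> y yl; apply: lP; rewrite inE yl orbT.
  suff [N' HN'] : exists N' : nat, z.1.1 = p ->
      forall r, (N' <= r)%N -> forall f, bipart (0, r%:Z) f -> boundary (f *: z.2).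
    exists (maxn N' N) => y /[1!inE] /orP[/eqP ->|yl] yp r; rewrite geq_max.
      by move=> /andP[N'r _]; exact: (HN' yp r N'r).
    by move=> /andP[_ Nr]; exact: (HN y yl yp r Nr).
  have [zp|/eqP zp] := eqVneq z.1.1 p; last by exists 0%N => /zp.
  have [Kz Dz] := lP z (mem_head _ _).
  have [z0|z0] := ltP z.1.2 0.
    exists 0%N => _ r _ f _.
    by rewrite (KR_neg z0 Kz) scaler0.
  have [N' HN'] : exists N' : nat, forall f, bipart (0, N'%:Z) f -> boundary (f *: z.2).
    apply: contrapT => no'; apply: no; exists (absz z.1.2), z.2; split=> //.
      by move: Kz; rewrite gez0_abs // -zp -surjective_pairing.
    move=> r; apply: contrapT => no''; apply: no'; exists r => f Rf.
    by apply: contrapT => nb; apply: no''; exists f.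
  exists N' => _ r /subnK <-; elim: (r - N')%N => [|c IHc] f; first exact: HN'.
  rewrite addSn => Rf; have [t [tP ->]] := rees_part_F Rf.
  rewrite scaler_suml; apply: in_sum_span => // y /tP[_ Ry].
  by rewrite -scalerA; apply: BZ; [exact: rees_gen_full|exact: IHc].
have [Q HQ] : exists Q : nat, forall z, z \in zs -> z.1.2 <= Q%:Z.
  elim: (zs) => [|z l [Q HQ]]; first by exists 0%N.
  exists (maxn (absz z.1.2) Q) => y /[1!inE] /orP[/eqP ->|/HQ yQ].
    by apply: le_trans (lez_abs _) _; rewrite lez_nat leq_maxl.
  by apply: le_trans yQ _; rewrite lez_nat leq_maxr.
have [q Nq] := nac (N + Q)%N; apply=> w Kw Dw; rewrite subr0.
apply: boundary_homogeneous => //.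
have [t [tP ->]] := gen _ _ Kw Dw.
apply: in_sum_span => // y /tP[yz Ry]; have [Kz Dz] := zsP _ yz.
have [pe|pe] := ltP 0 ((p, q%:Z) - y.2.1).1.
  have [t' [tP' ->]] := bipart_lin_x pe Ry; rewrite scaler_suml.
  apply: in_sum_span => // a /tP'[axs Ra]; rewrite -scalerA.
  have [||u Ku <-] := K_killed (X := [set y | y \in xsR]) (differential0 A^o)
    subcomplex_bipart _ axs (KR_scale Ra Kz) _ => //; last by exists u.
  by rewrite D2 Dz scaler0.
have E1 : ((p, q%:Z) - y.2.1).1 = p - y.2.1.1 by [].
have E2 : ((p, q%:Z) - y.2.1).2 = q%:Z - y.2.1.2 by [].
have [pe'|pe'] := ltP ((p, q%:Z) - y.2.1).1 0.
  by move: Ry; rewrite /bipart [0 <= _]leNgt pe' /= => ->; rewrite scale0r.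
have pE : y.2.1.1 = p by move: pe pe'; rewrite E1; lia.
have qy := HQ _ yz.
apply: (HN _ yz pE (absz (q%:Z - y.2.1.2))); first by lia.
have -> : (0, (absz (q%:Z - y.2.1.2))%:Z) = (p, q%:Z) - y.2.1.
  by rewrite [RHS]surjective_pairing E1 E2; congr pair; lia.
exact: Ry.
Qed.

(** Take a class of first degree [p] that no power of the irrelevant ideal of
    [S] kills, and a closed point that contains its annihilator [J]. The class
    remains nonzero in the fiber, because no denominator lies in [J]. *)
Lemma fiber_not_acyclic p : (forall q0, exists2 q, (q0 <= q)%N &
    ~ acyclic 0 DR KR (p, q%:Z)) ->
  exists pt : closed_point SG,
    ~ acyclic 0 (KD (xsL pt) zero) (KP (-1) (xsL pt) (@loc_part pt)) p.
Proof.
have [D1 D2 D3] := dKR; have [B0 BD BZ] := boundary_submodule.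
move=> /persistent_cycle[q1 [g [Kg Dg gP]]].
pose J := [set a : S | boundary (to_rees a *: g)].
have [|pt Jpt] := @closed_point_over J.
  split=> //.
  - split; first by rewrite /J /= (addf0 to_reesD) scale0r.
      by move=> a b Ja Jb; rewrite /J /= to_reesD scalerDl; exact: BD.
    by move=> a b Jb; rewrite /J /= to_reesM -scalerA; exact: boundaryZ.
  - move=> a Ja; exists [seq hcomp (gr_direct SG) a q | q <- supp (gr_direct SG) a].
    rewrite big_map sum_comp; split=> // u /mapP[q _ ->]; split; last first.
      by exists q; exact: comp_part.
    have [u0 u0E] := Ja.
    have dK := KR_direct.
    exists (hcomp dK u0 (p, q%:Z + q1%:Z)).
    have <- := @comp_morph _ _ _ _ _ _ dK dK DR id D1 (fun _ _ => id) _ u0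
      (p, q%:Z + q1%:Z); last first.
      by move=> i v Kv; have := sub_D subcomplex_KR Kv; rewrite addr0.
    rewrite /= u0E.
    have <- := @comp_morph _ _ _ _ _ _ (gr_direct SG) dK (fun a => to_rees a *: g)
      (fun q : nat => (p, q%:Z + q1%:Z)) _ _ _ a q => //.
    + by move=> b c; rewrite to_reesD scalerDl.
    + by move=> i j /(congr1 snd) /=; lia.
    + move=> i v iv; have := KR_scale (to_rees_bipart iv) Kg; congr (KP _ _ _ _ _).
      by rewrite -[LHS]/(0 + p, i%:Z + q1%:Z) add0r.
  - move=> q; have [f Rf nb] := gP q; have [a qa af] := to_rees_onto Rf.
    by exists a; rewrite // /J /= af.
exists pt => ac.
have den_to_rees (u : Loc.den (fiber_den pt)) : exists2 a : S, to_rees a = Loc.den_val u & ~ pt a.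
  have [a [aE _ npa]] := Loc.denP u; exists a => //; exact: rees_eq.
have [s sq] := den_of_degree pt q1.
have [||eta Keta etaE] := ac (Kmap (loc1 pt) (over (pt := pt) s) xsR g).
- exact: (over_part sq Kg).
- by rewrite over_diff Dg; exact: (addf0 (@Kmap_overD pt s)).
rewrite subr0 in Keta.
have [q2 [t [b [tq2 Kb bE]]]] := common_denominator Keta.
have E : Kmap (loc1 pt) (over (Loc.denM s t)) xsR
    (Loc.den_val t *: g - Loc.den_val s *: DR b) = 0.
  rewrite (addfB (@Kmap_overD pt _)) Kmap_over_den Loc.denC Kmap_over_den.
  by rewrite -over_diff bE etaE subrr.
have [u uE] := localization_kernel E.
have [a aE npa] := den_to_rees (Loc.denM u t).
apply: npa; apply: Jpt; rewrite /J /= aE /=.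
exists (Loc.den_val u *: (Loc.den_val s *: b)); rewrite !D2.
apply/eqP; rewrite eq_sym -subr_eq0 -scalerA -scalerBr; apply/eqP.
exact: uE.
Qed.

End ClosedPoint.

(** * Comparison of the invariants *)

Section Conclusion.
Local Notation pts := (closed_point (Sbar_grading F)).
Local Notation FG pt := (fiber_grading R_std F_hom pt).
Local Notation row q p := (acyclic 0 DR KR (p, q%:Z)).
Local Notation fib pt p :=
  (acyclic 0 (KD (xsL pt) zero) (KP (-1) (xsL pt) (@loc_part pt)) p).

Lemma row_neg q p : p < 0 -> row q p.
Proof.
have neg l e w : e.1 < 0 -> KP tauR l bipart e w -> w = 0.
  elim: l e w => [|y l IH] e w e0; first by rewrite /= /bipart [0 <= e.1]leNgt e0.
  case: w => u v [/= Pu Pv]; congr pair; first exact: IH Pu.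
  by apply: IH Pv; rewrite -[(_ + _).1]/(e.1 + -1); lia.
have [D1 _ _] := dKR.
move=> p0 w Kw _; rewrite (neg _ _ _ _ Kw) //; exists 0.
  exact: (sub_0 subcomplex_KR).
exact: addf0 D1.
Qed.

Lemma eventually_exact p : (forall pt : pts, fib pt p) ->
  exists q0, forall q, (q0 <= q)%N -> row q p.
Proof.
move=> H; apply: contrapT => no.
have [|pt] := @fiber_not_acyclic p; last by apply; exact: H.
move=> q0; apply: contrapT => no'; apply: no; exists q0 => q q0q.
by apply: contrapT => nr; apply: no'; exists q.
Qed.

Variables P Q : int.
Hypothesis HP : forall e, P < e.1 -> acyclic 0 DR KR e.
Hypothesis HQ :
  forall e, Q < e.2 -> acyclic 0 DR KR (e - (0, 1)) -> acyclic 0 DR KR e.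

Lemma row_big q p : P < p -> row q p. Proof. by move=> Pp; exact: HP. Qed.

Lemma fib_big pt p : P < p -> fib pt p.
Proof. by move=> Pp; apply: (@fiber_acyclic pt p 0) => q _; exact: row_big. Qed.

(** Only the finitely many [p] with [c < p <= P] require a bound on [q]. *)
Lemma eventually_exact_above c : (forall p, c < p -> forall pt : pts, fib pt p) ->
  exists q0, forall q, (q0 <= q)%N -> forall p, c < p -> row q p.
Proof.
move=> H.
have [q0 Hq0] : exists q0, forall q, (q0 <= q)%N ->
    forall p, c < p -> p <= c + (absz (P - c))%:Z -> row q p.
  elim: (absz (P - c)) => [|N [q0 Hq0]]; first by exists 0%N => q _ p; lia.
  have [|q1 Hq1] := @eventually_exact (c + N.+1%:Z).
    by move=> pt; apply: H; lia.
  exists (maxn q0 q1) => q; rewrite geq_max => /andP[q0q q1q] p cp pN.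
  have [->|pE] := eqVneq p (c + N.+1%:Z); first exact: Hq1.
  by apply: Hq0 => //; lia.
exists q0 => q q0q p cp; have [pP|Pp] := leP p P; last exact: row_big.
by apply: Hq0 => //; lia.
Qed.

(** An exact row with [q >= Q] makes all higher rows exact at [p], and then the
    fiber. *)
Lemma row_not_exact p pt q : ~ fib pt p -> Q <= q%:Z -> ~ row q p.
Proof.
move=> nf Qq Hq; apply: nf; apply: (@fiber_acyclic pt p q) => r /subnK <-.
elim: (r - q)%N => [//|c IH]; apply: HQ => /=; first by lia.
have -> : (p, (c.+1 + q)%N%:Z) - (0, 1) = (p, (c + q)%N%:Z).
  rewrite -[LHS]/(p - 0, (c.+1 + q)%N%:Z - 1); congr pair; lia.
exact: IH.
Qed.

Definition degree0_subring : subring R.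
Proof.
refine (@Subring _ (G 0%N) (gr_one G) _ _).
- exact: partB (gr_direct G) 0%N.
- by move=> a b; exact: gr_mul.
Defined.

Local Notation KI q :=
  (acyclic 0 (KD xs zero) (KP (-1) xs (gm_part (ideal_exp_grmod F_hom q)))).

Lemma KI_row q l : KI q l <-> row q (l - (q * d)%N%:Z).
Proof. by rewrite -Koszul_ideal_exp subrK. Qed.

Lemma base_bound p : P + 1 <= p ->
  acyclic 0 (KD xs zero) (KP (-1) xs (zpart G : int -> set R^o)) p.
Proof. by move=> Pp; apply/Koszul_base; apply: HP => /=; lia. Qed.

Lemma astar_ideal_exp q b : ~ row q b -> (forall p, b < p -> row q p) ->
  is_astar (ideal_exp_grmod F_hom q) ((q * d)%N%:Z%:E + (b - (size xs)%:Z)%:E)%E.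
Proof.
move=> nb Hb; rewrite -EFinD addrA.
apply: (is_astar_max generated_xs base_bound (kappa := degree0_subring)) => //.
- exact: base_field.
- by move=> /KI_row; have -> : (q * d)%N%:Z + b - (q * d)%N%:Z = b by lia.
- by move=> l bl; apply/KI_row; apply: Hb; lia.
Qed.

Lemma astar_ideal_exp_ninfty q : (forall p, row q p) ->
  is_astar (ideal_exp_grmod F_hom q) ((q * d)%N%:Z%:E + -oo)%E.
Proof.
move=> H; apply: (is_astar_ninfty generated_xs base_bound).
by move=> l; apply/KI_row.
Qed.

Lemma astar_fiber (pt : pts) : exists v : \bar int,
  is_astar (self_grmod (FG pt)) v /\
  ((v = -oo%E /\ forall p, fib pt p) \/
   exists b, [/\ v = (b - (size xs)%:Z)%:E%E, ~ fib pt b &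
                 forall p, b < p -> fib pt p]).
Proof.
have gen := generated_xsFib pt.
have bnd p : P + 1 <= p -> acyclic 0 (KD (xsFib pt) zero)
    (KP (-1) (xsFib pt) (zpart (FG pt) : int -> set (fiber pt)^o)) p.
  by move=> Pp; apply/Koszul_fiber; apply: fib_big; lia.
have [all|/existsNP[p np]] := pselect (forall p, fib pt p).
  exists -oo%E; split; last by left.
  by apply: (is_astar_ninfty gen bnd) => l; apply/Koszul_fiber.
have bd l : ~ fib pt l -> l <= P.
  by move=> nl; rewrite leNgt; apply/negP => Pl; apply: nl; exact: fib_big.
have [b nb bmax] := @int_max [set p | ~ fib pt p] P p np bd.
exists (b - (size xs)%:Z)%:E%E; split; last first.
  right; exists b; split=> // l bl; apply: contrapT => nl.
  by have := bmax l nl; lia.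
have -> : size xs = size (xsFib pt) by rewrite [RHS]size_map.
apply: (is_astar_max gen bnd (@fiber_base_field pt) (@fiber_base_degree0 pt)).
  by move=> /Koszul_fiber.
move=> l bl; apply/Koszul_fiber; apply: contrapT => nl.
by have := bmax l nl; lia.
Qed.

(** The invariant is [b - size xs], for [b] the greatest first degree at which
    the Koszul complex of some fiber is not exact. For large [q] this is also
    the greatest degree at which the row [q] is not exact: at [b] by
    [row_not_exact], and above [b] by [eventually_exact_above]. If there is no
    such [b], all fibers and almost all rows are exact, and the invariants are
    [-oo]. *)
Lemma astar_phi_ex : exists a : \bar int, is_astar_phi R_std F_hom a /\
  exists q0 : nat, forall q : nat, (q0 <= q)%N ->
    is_astar (ideal_exp_grmod F_hom q) ((q * d)%N%:Z%:E + a)%E.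
Proof.
have [v vP] := choice astar_fiber.
have [all|some] := pselect (forall p (pt : pts), fib pt p).
  have vE pt : v pt = -oo%E.
    by have [_ [[]//|[b [_ nb _]]]] := vP pt; case: nb.
  exists -oo%E; split.
    exists v; split; first by move=> pt; case: (vP pt).
    have [[pt _]|no] := pselect (exists pt : pts, True).
      by right; split; [exists pt|move=> w [pt' _ <-]; rewrite vE].
    left; split=> //; apply/seteqP; split=> // w [pt _ _].
    by apply: no; exists pt.
  have [q0 Hq0] := @eventually_exact_above (-1) (fun p _ => all p).
  exists q0 => q q0q; apply: astar_ideal_exp_ninfty => p.
  by have [p0|p0] := ltP p 0; [exact: row_neg|apply: Hq0 => //; lia].
have [p1 np1] : exists p, ~ forall pt : pts, fib pt p by exact/existsNP.
have [||b nb bmax] := @int_max [set p | ~ forall pt : pts, fib pt p] P p1 => //.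
  move=> p np; rewrite leNgt; apply/negP => Pp; apply: np => pt.
  exact: fib_big.
have above p : b < p -> forall pt : pts, fib pt p.
  by move=> bp; apply: contrapT => /bmax; lia.
exists (b - (size xs)%:Z)%:E%E; split.
  exists v; split; first by move=> pt; case: (vP pt).
  right; split; last first.
    move=> w [pt _ <-]; have [_ [[-> _]|[c [-> nc _]]]] := vP pt.
      exact: leNye.
    rewrite lee_fin lerD2r; apply: bmax => Hc; exact: nc (Hc pt).
  have [pt npt] : exists pt : pts, ~ fib pt b by exact/existsNP.
  exists pt => //; have [_ [[_ all]|[c [-> nc cmax]]]] := vP pt.
    by case: npt.
  have -> // : c = b.
  apply/eqP; rewrite eq_le; apply/andP; split.
    by apply: bmax => Hc; exact: nc (Hc pt).
  by rewrite leNgt; apply/negP => cb; apply: npt; exact: cmax.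
have [q0 Hq0] := eventually_exact_above above.
have [pt npt] : exists pt : pts, ~ fib pt b by exact/existsNP.
exists (maxn q0 (absz Q)) => q; rewrite geq_max => /andP[q0q Qq].
apply: astar_ideal_exp; last exact: Hq0.
by apply: (row_not_exact npt); lia.
Qed.

End Conclusion.

End ReesAlgebra.

Theorem theorem1p2 (k : fieldType) (R : comAlgType k) (G : grading R)
    (n : nat) (x : 'I_n.+1 -> R) (R_std : standard_graded G x)
    (d m : nat) (F : 'I_m.+1 -> R) (F_hom : forall i, G d (F i)) :
  exists a : \bar int,
    is_astar_phi R_std F_hom a /\
    exists q0 : nat, forall q : nat, (q0 <= q)%N ->
      is_astar (ideal_exp_grmod F_hom q) ((q * d)%N%:Z%:E + a)%E.
Proof.
have [P [Q [HP HQ]]] := Koszul_bounds R_std F_hom.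
exact: astar_phi_ex HP HQ.
Qed.
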